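(* Let $\mathcal H=\mathbb C^d$, $\mathcal K=\mathbb C^k$, let $\mathscr V^{\rm irr}$ be the manifold of isometries $V:\mathcal H\to\mathcal H\otimes\mathcal K$ with irreducible channel, and let $\mathscr P^{\rm irr}$ be the quotient topological space of $\mathscr V^{\rm irr}$ by output equivalence, which is homeomorphic to $\mathscr V^{\rm irr}/\mathscr G$ with $\mathscr G=U(1)\times PU(d)$ acting by $(c,W)\cdot V=\overline c\,(W\otimes\mathbf 1_{\mathcal K})VW^*$. Then $\mathscr P^{\rm irr}\simeq\mathscr V^{\rm irr}/\mathscr G$ can be endowed with the structure of an orbifold.
   Context: For an isometry $V$, the channel is $\mathcal T_V(X)=V^*(X\otimes\mathbf 1_{\mathcal K})V$, with predual $\mathcal T_{V*}(\rho)={\rm Tr}_{\mathcal K}(V\rho V^* )$; it is irreducible if there is a unique state $\rho_V^{\rm ss}>0$ with $\mathcal T_{V*}(\rho_V^{\rm ss})=\rho_V^{\rm ss}$. The set of isometries is a submanifold of $L^\infty(\mathcal H,\mathcal H\otimes\mathcal K)$ and $\mathscr V^{\rm irr}$ is open in it. With $V|\psi\rangle=\sum_iK_i|\psi\rangle\otimes|i\rangle$ and $V(n)|\psi\rangle=\sum K_{i_n}\cdots K_{i_1}|\psi\rangle\otimes|i_1\cdots i_n\rangle$, the stationary output is $\rho_V^{\rm out}(n)={\rm Tr}_{\mathcal H}[V(n)\rho_V^{\rm ss}V(n)^*]$; $V_1,V_2$ are output equivalent if $\rho^{\rm out}_{V_1}(n)=\rho^{\rm out}_{V_2}(n)$ for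 all $n\in\mathbb N$. Orbifolds. Let $X$ be a topological space. An orbifold chart of dimension $m$ for an open connected $U\subseteq X$ is a triple $(\widetilde U,H,\phi)$ where $\widetilde U\subseteq\mathbb R^m$ is open and connected, $H$ is a finite group acting smoothly and effectively on $\widetilde U$, and $\phi:\widetilde U\to U$ is a continuous $H$-invariant surjection inducing a homeomorphism $\widetilde U/H\to U$. An embedding between charts $(\widetilde U_1,H_1,\phi_1)$, $(\widetilde U_2,H_2,\phi_2)$ is a smooth embedding $\lambda:\widetilde U_1\to\widetilde U_2$ with $\phi_1=\phi_2\circ\lambda$. Two charts are compatible if every $x\in U_1\cap U_2$ has a neighbourhood $U_3\subseteq U_1\cap U_2$ with a chart $(\widetilde U_3,H_3,\phi_3)$ admitting embeddings into both. An $m$-dimensional orbifold atlas is a collection of pairwise compatible $m$-dimensional charts covering $X$; an atlas refines another if each of its charts embeds in some chart of the other; two atlases are equivalent if they have a common refinement. An $m$-dimensional orbifold is a Hausdorff paracompact space $X$ with an equivalence class of $m$-dimensional orbifold atlases. *)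

(* Defs.v *)
(* MathComp-Analysis; C^d is the space of column vectors over R[i] with
   R : realType, and C^d (x) C^k is C^(d * k) indexed through mxtens_index. *)
From HB Require Import structures.
From mathcomp Require Import all_boot all_order all_fingroup all_algebra.
From mathcomp Require Import complex mxtens.
From mathcomp Require Import all_classical all_reals all_analysis.

Set Implicit Arguments.
Unset Strict Implicit.
Unset Printing Implicit Defensive.

Import Order.TTheory GRing.Theory Num.Theory.
Import numFieldNormedType.Exports.

Local Open Scope classical_set_scope.
Local Open Scope complex_scope.
Local Open Scope sesquilinear_scope.
Local Open Scope quotient_scope.
Local Open Scope ring_scope.

(* The norm topology; matrices over R[i] then carry the product topology,
   which is the topology of L^oo(C^d, C^d (x) C^k). *)
HB.instance Definition _ (R : realType) := PseudoMetric.copy R[i] (R[i]^o).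

Lemma big_tens (C : nmodType) d k (F : 'I_(d * k) -> C) :
  \sum_u F u = \sum_r \sum_a F (mxtens_index (r, a)).
Proof.
rewrite pair_big /= (reindex (@mxtens_index d k)) /=; last first.
  by exists (@mxtens_unindex d k) => ? _; [exact: mxtens_indexK | exact: mxtens_unindexK].
by apply: eq_bigr => -[].
Qed.

Section QuantumMarkovChains.
Context {R : realType} {d k : nat}.
Local Notation C := R[i].

Definition ptrace_K (A : 'M[C]_(d * k, d * k)) : 'M[C]_d :=
  \matrix_(r, s) \sum_(a < k) A (mxtens_index (r, a)) (mxtens_index (s, a)).

Definition ptrace_H {p : nat} (A : 'M[C]_(d * p, d * p)) : 'M[C]_p :=
  \matrix_(a, b) \sum_(r < d) A (mxtens_index (r, a)) (mxtens_index (r, b)).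

Definition isometry (V : 'M[C]_(d * k, d)) : Prop := V^t* *m V = 1%:M.

Definition channel (V : 'M[C]_(d * k, d)) (X : 'M[C]_d) : 'M[C]_d :=
  V^t* *m (X *t (1%:M : 'M[C]_k)) *m V.

Definition predual (V : 'M[C]_(d * k, d)) (rho : 'M[C]_d) : 'M[C]_d :=
  ptrace_K (V *m rho *m V^t*).

Lemma predual_channel (V : 'M[C]_(d * k, d)) (rho X : 'M[C]_d) :
  \tr (predual V rho *m X) = \tr (rho *m channel V X).
Proof.
rewrite /channel !mulmxA [RHS]mxtrace_mulC !mulmxA /predual.
move: (V *m rho *m _) => A.
rewrite /mxtrace big_tens; apply: eq_bigr => r _; rewrite mxE.
under [RHS]eq_bigr do rewrite mxE big_tens.
rewrite exchange_big /=; apply: eq_bigr => s _.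
rewrite mxE mulr_suml; apply: eq_bigr => a _.
rewrite (bigD1 a) //= tensmxE !mxE eqxx mulr1 big1 ?addr0 // => b ba.
by rewrite tensmxE !mxE (negbTE ba) mulr0 mulr0.
Qed.

(* In the order of R[i], 0 <= z means that z is real and nonnegative, so that
   the condition below entails that rho is Hermitian. *)
Definition is_state (rho : 'M[C]_d) : Prop :=
  (forall psi : 'cV[C]_d, 0 <= (psi^t* *m rho *m psi) 0 0) /\ \tr rho = 1.

Definition posdef (rho : 'M[C]_d) : Prop :=
  forall psi : 'cV[C]_d, psi != 0 -> 0 < (psi^t* *m rho *m psi) 0 0.

Definition stationary_states (V : 'M[C]_(d * k, d)) : set 'M[C]_d :=
  [set rho | is_state rho /\ predual V rho = rho].

Definition irreducible (V : 'M[C]_(d * k, d)) : Prop :=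
  exists2 rho, posdef rho & stationary_states V = [set rho].

Definition rho_ss (V : 'M[C]_(d * k, d)) : 'M[C]_d :=
  xget 0 (stationary_states V).

(* V psi = \sum_i K_i psi (x) |i>. *)
Definition kraus (V : 'M[C]_(d * k, d)) (i : 'I_k) : 'M[C]_d :=
  \matrix_(r, s) V (mxtens_index (r, i)) s.

(* K_{i_n} ... K_{i_1} for the word [:: i_1; ...; i_n]. *)
Definition kraus_word (V : 'M[C]_(d * k, d)) (w : seq 'I_k) : 'M[C]_d :=
  foldl (fun A i => kraus V i *m A) 1%:M w.

(* The basis of K^{(x) n} is indexed by the enumeration of the n-tuples over
   'I_k. *)
Definition V_n (V : 'M[C]_(d * k, d)) (n : nat) :
    'M[C]_(d * #|{: n.-tuple 'I_k}|, d) :=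
  \matrix_(u, s)
    kraus_word V (enum_val (mxtens_unindex u).2 : n.-tuple 'I_k)
      (mxtens_unindex u).1 s.

Definition rho_out (V : 'M[C]_(d * k, d)) (n : nat) :
    'M[C]_#|{: n.-tuple 'I_k}| :=
  ptrace_H (V_n V n *m rho_ss V *m (V_n V n)^t*).

Definition output_equivalent (V1 V2 : 'M[C]_(d * k, d)) : Prop :=
  forall n, rho_out V1 n = rho_out V2 n.

(* (c, W) . V for c in U(1) and W a unitary representative of a class in
   PU(d); the result does not depend on the representative. *)
Definition gauge (c : C) (W : 'M[C]_d) (V : 'M[C]_(d * k, d)) :
    'M[C]_(d * k, d) :=
  c^* *: ((W *t (1%:M : 'M[C]_k)) *m V *m W^t*).

Definition same_orbit (V1 V2 : 'M[C]_(d * k, d)) : Prop :=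
  exists c : C, exists W : 'M[C]_d,
    [/\ `|c| = 1, W \is unitarymx & V2 = gauge c W V1].

Lemma output_equivalent_sym V1 V2 :
  output_equivalent V1 V2 -> output_equivalent V2 V1.
Proof. move=> e n; exact (esym (e n)). Qed.

Lemma output_equivalent_trans V1 V2 V3 :
  output_equivalent V1 V2 -> output_equivalent V2 V3 -> output_equivalent V1 V3.
Proof. move=> e12 e23 n; exact (etrans (e12 n) (e23 n)). Qed.

Lemma tens11mx : (1%:M : 'M[C]_d) *t (1%:M : 'M[C]_k) = 1%:M.
Proof.
apply/matrixP => u v; case: (mxtens_indexP u) => a b.
case: (mxtens_indexP v) => a' b'.
rewrite tensmxE !mxE (can_eq (@mxtens_indexK d k)) xpair_eqE.
by rewrite -natrM mulnb.
Qed.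

Lemma gauge1 (V : 'M[C]_(d * k, d)) : gauge 1 1%:M V = V.
Proof.
by rewrite /gauge rmorph1 scale1r tens11mx mul1mx trmx1 map_mx1 mulmx1.
Qed.

Lemma gauge_gauge c1 c2 (W1 W2 : 'M[C]_d) (V : 'M[C]_(d * k, d)) :
  gauge c2 W2 (gauge c1 W1 V) = gauge (c2 * c1) (W2 *m W1) V.
Proof.
rewrite /gauge.
have -> : (W2 *m W1) *t (1%:M : 'M[C]_k) = (W2 *t 1%:M) *m (W1 *t 1%:M).
  by rewrite tensmx_mul mulmx1.
rewrite -scalemxAr -scalemxAl scalerA rmorphM.
by rewrite trmx_mul map_mxM !mulmxA.
Qed.

Lemma same_orbit_refl (V : 'M[C]_(d * k, d)) : same_orbit V V.
Proof.
exists 1, 1%:M; rewrite normr1 gauge1; split=> //.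
by apply/unitarymxP; rewrite trmx1 map_mx1 mulmx1.
Qed.

Lemma same_orbit_sym V1 V2 : same_orbit V1 V2 -> same_orbit V2 V1.
Proof.
move=> [c [W [c1 Wu ->]]]; exists c^*, (W^t*).
have cu : c^* * c = 1 by rewrite mulrC -normCK c1 expr1n.
split; [by rewrite norm_conjC | by rewrite trmxC_unitary |].
rewrite gauge_gauge cu -[W in _ *m W]trmxCK.
by have /unitarymxP -> : W^t* \is unitarymx; rewrite ?trmxC_unitary ?gauge1.
Qed.

Lemma same_orbit_trans V1 V2 V3 :
  same_orbit V1 V2 -> same_orbit V2 V3 -> same_orbit V1 V3.
Proof.
move=> [c1 [W1 [n1 u1 ->]]] [c2 [W2 [n2 u2 ->]]].
exists (c2 * c1), (W2 *m W1); split; last by rewrite gauge_gauge.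
  by rewrite normrM n1 n2 mulr1.
exact: mul_unitarymx u2 u1.
Qed.

End QuantumMarkovChains.

Section QuotientSpaces.
Variables (R : realType) (d k : nat).

(* Carries the topology of a subspace of 'M[R[i]]_(d * k, d). *)
Definition Virr : Type :=
  set_type [set V : 'M[R[i]]_(d * k, d) | isometry V /\ irreducible V].

HB.instance Definition _ := Topological.on Virr.

Definition out_equiv : rel Virr := fun V1 V2 =>
  `[< output_equivalent (val V1) (val V2) >].

Lemma out_equiv_refl : reflexive out_equiv.
Proof. by move=> V; apply/asboolP. Qed.

Lemma out_equiv_sym : symmetric out_equiv.
Proof.
by move=> V1 V2; apply/asboolP/asboolP; exact: output_equivalent_sym.
Qed.

Lemma out_equiv_trans : transitive out_equiv.
Proof.
move=> V2 V1 V3 /asboolP e12 /asboolP e23; apply/asboolP.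
exact: output_equivalent_trans e12 e23.
Qed.

Canonical out_equiv_equiv :=
  EquivRel out_equiv out_equiv_refl out_equiv_sym out_equiv_trans.

Definition Pirr : Type := quotient_topology {eq_quot out_equiv}.

HB.instance Definition _ := Topological.on Pirr.
HB.instance Definition _ := Quotient.on Pirr.

Definition gauge_equiv : rel Virr := fun V1 V2 =>
  `[< same_orbit (val V1) (val V2) >].

Lemma gauge_equiv_refl : reflexive gauge_equiv.
Proof. by move=> V; apply/asboolP; exact: same_orbit_refl. Qed.

Lemma gauge_equiv_sym : symmetric gauge_equiv.
Proof. by move=> V1 V2; apply/asboolP/asboolP; exact: same_orbit_sym. Qed.

Lemma gauge_equiv_trans : transitive gauge_equiv.
Proof.
move=> V2 V1 V3 /asboolP e12 /asboolP e23; apply/asboolP.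
exact: same_orbit_trans e12 e23.
Qed.

Canonical gauge_equiv_equiv :=
  EquivRel gauge_equiv gauge_equiv_refl gauge_equiv_sym gauge_equiv_trans.

Definition Virr_mod_G : Type := quotient_topology {eq_quot gauge_equiv}.

HB.instance Definition _ := Topological.on Virr_mod_G.
HB.instance Definition _ := Quotient.on Virr_mod_G.

End QuotientSpaces.

Definition homeomorphism (X Y : topologicalType) (f : X -> Y) : Prop :=
  continuous f /\
  exists g : Y -> X, [/\ cancel f g, cancel g f & continuous g].

Definition locally_finite (X : topologicalType) (F : set (set X)) : Prop :=
  forall x : X, exists2 U, nbhs x U & finite_set [set B | F B /\ B `&` U !=set0].

Definition open_cover (X : topologicalType) (F : set (set X)) : Prop :=
  (forall B, F B -> open B) /\ \bigcup_(B in F) B = setT.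

Definition paracompact (X : topologicalType) : Prop :=
  forall F : set (set X), open_cover F -> exists G : set (set X),
    [/\ open_cover G, locally_finite G
      & forall B, G B -> exists2 B', F B' & B `<=` B'].

Section Smooth.
Context {R : realType} {m p : nat}.

(* Class C^n; only meant for open sets A. *)
Fixpoint Cn_on (n : nat) (A : set 'rV[R]_m) (f : 'rV[R]_m -> 'rV[R]_p) : Prop :=
  match n with
  | 0 => forall x, A x -> {for x, continuous f}
  | n'.+1 => (forall x, A x -> differentiable f x) /\
             forall v, Cn_on n' A ('D_v f)
  end.

Definition smooth_on (A : set 'rV[R]_m) (f : 'rV[R]_m -> 'rV[R]_p) : Prop :=
  forall n, Cn_on n A f.

Definition smooth_embedding (A : set 'rV[R]_m) (B : set 'rV[R]_p)
    (f : 'rV[R]_m -> 'rV[R]_p) : Prop :=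
  [/\ smooth_on A f /\ f @` A `<=` B,
      {in A &, injective f},
      forall x, A x -> injective ('d f x : 'rV[R]_m -> 'rV[R]_p)
    & forall O, open O -> O `<=` A ->
        exists2 W, open W & f @` O = W `&` f @` A].

End Smooth.

Section Orbifolds.
Variable R : realType.

(* The values of the action and of the projection outside the domain are
   irrelevant. *)
Record chart (m : nat) (X : Type) := Chart {
  chart_dom : set 'rV[R]_m;
  chart_grp : finGroupType;
  chart_act : chart_grp -> 'rV[R]_m -> 'rV[R]_m;
  chart_map : 'rV[R]_m -> X }.

Definition chart_cod m X (c : chart m X) : set X := chart_map c @` chart_dom c.

Definition smooth_effective_action m (H : finGroupType) (A : set 'rV[R]_m)
    (act : H -> 'rV[R]_m -> 'rV[R]_m) : Prop :=
  [/\ forall h, smooth_on A (act h) /\ act h @` A `<=` A,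
      forall x, A x -> act 1%g x = x,
      forall g h x, A x -> act (g * h)%g x = act g (act h x)
    & forall h, (forall x, A x -> act h x = x) -> h = 1%g].

(* The last two clauses say that the continuous surjection from the orbit space
   of the domain to chart_cod c is injective and open, i.e. a homeomorphism:
   the open subsets of the orbit space are the images of the invariant open
   subsets of the domain. *)
Definition orbifold_chart m (X : topologicalType) (c : chart m X) : Prop :=
  let A := chart_dom c in let phi := chart_map c in let act := @chart_act _ _ c in
  [/\ [/\ open A, connected A, open (chart_cod c) & connected (chart_cod c)],
      smooth_effective_action A act,
      {within A, continuous phi} /\ (forall h x, A x -> phi (act h x) = phi x),
      forall x y, A x -> A y -> phi x = phi y -> exists h, y = act h x
    & forall O, open O -> O `<=` A -> (forall h, act h @` O `<=` O) ->
        open (phi @` O)].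

Definition embeds_in m X (c1 c2 : chart m X) : Prop :=
  exists lambda : 'rV[R]_m -> 'rV[R]_m,
    smooth_embedding (chart_dom c1) (chart_dom c2) lambda /\
    forall x, chart_dom c1 x -> chart_map c1 x = chart_map c2 (lambda x).

Definition compatible m (X : topologicalType) (c1 c2 : chart m X) : Prop :=
  forall x, chart_cod c1 x -> chart_cod c2 x ->
    exists c3 : chart m X,
      [/\ orbifold_chart c3, chart_cod c3 x,
          chart_cod c3 `<=` chart_cod c1 `&` chart_cod c2,
          embeds_in c3 c1 & embeds_in c3 c2].

(* Collections of charts are predicates because chart m X, which contains a
   finGroupType, is in a universe too large for [set _]. *)
Definition orbifold_atlas m (X : topologicalType) (A : chart m X -> Prop) :
    Prop :=
  [/\ forall c, A c -> orbifold_chart c,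
      forall c1 c2, A c1 -> A c2 -> compatible c1 c2
    & forall x, exists2 c, A c & chart_cod c x].

Definition refines m X (A B : chart m X -> Prop) : Prop :=
  forall c, A c -> exists2 c', B c' & embeds_in c c'.

Definition equivalent_atlases m (X : topologicalType)
    (A B : chart m X -> Prop) : Prop :=
  exists D, [/\ orbifold_atlas D, refines D A & refines D B].

Definition is_atlas_class m (X : topologicalType)
    (S : (chart m X -> Prop) -> Prop) : Prop :=
  exists2 A, orbifold_atlas A &
    forall B, S B <-> orbifold_atlas B /\ equivalent_atlases A B.

Definition is_orbifold m (X : topologicalType)
    (S : (chart m X -> Prop) -> Prop) : Prop :=
  [/\ hausdorff_space X, paracompact X & is_atlas_class S].

Definition has_orbifold_structure (X : topologicalType) : Prop :=
  exists m, exists S : (chart m X -> Prop) -> Prop, is_orbifold S.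

End Orbifolds.

(* Main.v *)
(* Two irreducible isometries with the same output are gauge equivalent: if the
   mixed transfer operator X |-> V2^* (X (x) 1) V1 had spectral radius < 1, the
   overlaps of the two outputs would decay, against tr (rho_out(n)^2) >= 1/d^2; so
   it has an eigenvalue of modulus >= 1, and by Cauchy-Schwarz an eigenvector X
   intertwines the Kraus operators up to a phase, X^* X being a fixed point of an
   irreducible channel, hence scalar.
   The compact gauge group acts on irreducible isometries with finite stabilizers:
   the commutation of W with the Kraus operators up to a phase c determines W up
   to a scalar, and c is an eigenvalue of the channel.  The orbifold charts are
   slices of this action.  At V, the inverse function theorem is applied to the
   map sending a pair (V', g) to the component of V' - V orthogonal to the orbit
   and to the Hermitian directions V S, the defect of V' from isometry, the orbit
   component of V', the defect of g from the normalized gauge group, and the orbit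
   component of g V'; its derivative is injective because the action is
   infinitesimally free.  Compactness of the group gives the Hausdorff property and
   the identification of the fibres of a chart with the orbits of the stabilizer. *)
Require Import Defs.
From HB Require Import structures.
From mathcomp Require Import all_boot all_order all_fingroup all_algebra.
From mathcomp Require Import complex mxtens.
From mathcomp Require Import all_classical all_reals all_analysis.
From mathcomp Require Import zify ring lra.

Set Implicit Arguments.
Unset Strict Implicit.
Unset Printing Implicit Defensive.

(* Again, since mathcomp has another [isometry]. *)
Require Import Defs.

Import Order.TTheory GRing.Theory Num.Theory.
Import numFieldNormedType.Exports.

Local Open Scope classical_set_scope.
Local Open Scope complex_scope.
Local Open Scope sesquilinear_scope.
Local Open Scope quotient_scope.
Local Open Scope ring_scope.

(** * Smooth functions *)

(** The group element W ranges over unitary matrices instead of PU(d), so a circle of scalars acts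
    trivially. The normalization Im tr W = 0 removes it; with it the slice map has source and target
    of the same dimension, and one use of the inverse function theorem yields the slice, the slice
    coordinate and the group element carrying a nearby isometry to the slice. The irreducible
    isometries need not be open in the ambient space R^N; they are only relatively open in the
    compact set of all isometries. Everything is therefore phrased with germs in R^N restricted to
    them, without charts of that manifold itself. Relative openness also exhausts the orbit space by
    compact sets, which gives paracompactness. Elements of a stabilizer may fix the slice pointwise.
    The group of a chart is hence the finite set of matrices through which the stabilizer acts on
    slice coordinates, so that effectiveness is automatic and the action on the chart is linear. *)

Lemma cvg_mxP (T : topologicalType) p q (F : set_system 'M[T]_(p, q))
    {FF : Filter F} (M : 'M[T]_(p, q)) :
  F --> M <-> forall i j, (fun N : 'M[T]_(p, q) => N i j) @ F --> M i j.
Proof.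
split => [FM i j U MU|H].
  apply: FM; exists (fun i' j' => if (i' == i) && (j' == j) then U else setT).
    move=> i' j'; case: ifP => [/andP[/eqP -> /eqP ->] //|_]; exact: filterT.
  by move=> N /(_ i j); rewrite !eqxx.
move=> U [P MP PU]; apply: filterS PU _.
apply: filter_forall => i; apply: filter_forall => j; exact: H (MP i j).
Qed.

Lemma continuous_mxP (U T : topologicalType) p q (f : U -> 'M[T]_(p, q)) x :
  {for x, continuous f} <-> forall i j, {for x, continuous (fun y => f y i j)}.
Proof. exact: (cvg_mxP (F := f @ x)). Qed.

Lemma continuous_at_sum {R : realType} (T : topologicalType) (I : Type)
    (r : seq I) (P : pred I) (F : I -> T -> R) x :
  (forall i, P i -> {for x, continuous (F i)}) ->
  {for x, continuous (fun y => \sum_(i <- r | P i) F i y)}.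
Proof.
move=> H; elim: r => [|i r IH].
  rewrite (_ : (fun y => _) = cst 0); first exact: cst_continuous.
  by apply/funext => y; rewrite big_nil.
rewrite (_ : (fun y => _) = (fun y =>
  if P i then F i y + \sum_(j <- r | P j) F j y else \sum_(j <- r | P j) F j y)).
  by case Pi: (P i) => //; apply: continuousD => //; exact: H.
by apply/funext => y; rewrite big_cons.
Qed.

Section MatrixNorm.
Context {R : realType} {p q : nat}.
Implicit Types M : 'M[R]_(p, q).

Lemma mx_entry_norm M i j : `|M i j| <= `|M|.
Proof.
rewrite [leRHS]/Num.Def.normr /= mx_normrE.
exact: (@le_bigmax _ _ _ 0 (fun ij => `|M ij.1 ij.2|) (i, j)).
Qed.

Lemma mx_norm_le M e : 0 <= e -> (forall i j, `|M i j| <= e) -> `|M| <= e.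
Proof.
move=> e0 H; rewrite [leLHS]/Num.Def.normr /= mx_normrE; by apply/bigmax_leP; split.
Qed.

Lemma mx_norm_lt M e : 0 < e -> (forall i j, `|M i j| < e) -> `|M| < e.
Proof.
move=> e0 H; rewrite [ltLHS]/Num.Def.normr /= mx_normrE; by apply/bigmax_ltP; split.
Qed.

End MatrixNorm.

Section DifferentiableCharacterization.
Context {R : realType} {V W : normedModType R}.

(** The little-o definition is unfolded so that an explicit estimate suffices; the derivative of a
    local inverse is established in this way. *)
Lemma differentiable_eps (f : V -> W) x (L : {linear V -> W}) :
  continuous L ->
  (forall e : R, 0 < e ->
     \forall h \near (0 : V), `|f (h + x) - f x - L h| <= e * `|h|) ->
  differentiable f x /\ ('d f x = L :> (V -> W)).
Proof.
move=> cL H.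
have E : f \o shift x = cst (f x) + L +o_ (0 : V) id.
  apply/eqaddoP => e e0; near=> h; rewrite /= !fctE /= opprD addrA.
  by near: h; exact: H.
have dE := diff_unique cL E; split => //.
by apply/diff_locallyP; rewrite dE.
Unshelve. all: by end_near. Qed.

Lemma differentiable_near (f : V -> W) x (e : R) : differentiable f x -> 0 < e ->
  \forall h \near (0 : V), `|f (h + x) - f x - 'd f x h| <= e * `|h|.
Proof.
move=> df e0; have /diff_locallyP[_ /eqaddoP /(_ _ e0)] := df.
by apply: filterS => h; rewrite /= !fctE /= opprD addrA.
Qed.

Lemma near_eq_diff (f g : V -> W) x : (\forall y \near x, f y = g y) ->
  differentiable f x -> differentiable g x.
Proof.
move=> fg df; have fgx : f x = g x by exact: nbhs_singleton fg.
have cL : continuous ('d f x) by exact: diff_continuous.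
case: (@differentiable_eps g x ('d f x) cL) => // e e0.
near=> h; rewrite -fgx -[g (h + x)](_ : f (h + x) = _); last first.
  by near: h; rewrite (near_shift 0 x) subr0 in fg.
by near: h; exact: differentiable_near.
Unshelve. all: by end_near. Qed.

End DifferentiableCharacterization.

Section SmoothFunctions.
Context {R : realType} {m : nat}.
Implicit Types (A : set 'rV[R]_m) (f g : 'rV[R]_m -> R).

(** Scalar counterpart of [Cn_on], closed under products and inverses; [Cn_onP] transfers it to
    row-valued maps. *)
Fixpoint Cn (n : nat) A f : Prop :=
  match n with
  | 0 => forall x, A x -> {for x, continuous f}
  | n'.+1 => (forall x, A x -> differentiable f x) /\ forall v, Cn n' A ('D_v f)
  end.

Definition smooth A f := forall n, Cn n A f.

Lemma Cn_subset n A B f : B `<=` A -> Cn n A f -> Cn n B f.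
Proof.
move=> BA; elim: n f => [|n IH] f /=; first by move=> H x /BA /H.
by case=> H1 H2; split => [x /BA /H1 //|v]; exact: IH.
Qed.

Lemma Cn_ext n A f g : open A -> (forall x, A x -> f x = g x) ->
  Cn n A f -> Cn n A g.
Proof.
move=> oA; have nearA x : A x -> \forall y \near x, A y by move=> Ax; apply: open_nbhs_nbhs.
elim: n f g => [|n IH] f g fg /=.
  move=> H x Ax; rewrite /prop_for /continuous_at -(fg x Ax).
  apply: (@cvg_trans _ (f @ x)); last exact: H.
  have E : \forall y \near x, f y = g y.
    by near=> y; apply/fg; near: y; exact: nearA.
  exact: (near_eq_cvg E).
case=> H1 H2; split => [x Ax|v].
  apply: near_eq_diff (H1 x Ax); near=> y; apply: fg; near: y; exact: nearA.
apply: IH (H2 v) => x Ax; apply: near_eq_derive.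
by near=> y; apply: fg; near: y; exact: nearA.
Unshelve. all: by end_near. Qed.

Lemma Cn_continuous n A f x : Cn n A f -> A x -> {for x, continuous f}.
Proof.
by case: n => [H /H //|n [H _] Ax]; exact/differentiable_continuous/H.
Qed.

Lemma CnW n A f : Cn n.+1 A f -> Cn n A f.
Proof.
elim: n f => [|n IH] f; first by move=> H x; exact: Cn_continuous H.
by move=> [H1 H2]; split => // v; exact/IH/H2.
Qed.

Lemma Cn_cst n A c : Cn n A (cst c).
Proof.
elim: n c => [|n IH] c /=; first by move=> x _; exact: cst_continuous.
split => [x _|v]; first exact: differentiable_cst.
rewrite (_ : 'D_v (cst c) = cst 0) //.
by apply/funext => x; rewrite derive_cst.
Qed.

Lemma CnD n A f g : open A -> Cn n A f -> Cn n A g -> Cn n A (fun x => f x + g x).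
Proof.
move=> oA; elim: n f g => [|n IH] f g.
  by move=> H1 H2 x Ax; apply: continuousD; [exact: H1|exact: H2].
move=> [df Df] [dg Dg]; split => [x Ax|v].
  by apply: differentiableD; [exact: df|exact: dg].
apply: Cn_ext (IH _ _ (Df v) (Dg v)) => // x Ax.
by rewrite deriveD //; apply/diff_derivable; [exact: df|exact: dg].
Qed.

Lemma CnM n A f g : open A -> Cn n A f -> Cn n A g -> Cn n A (fun x => f x * g x).
Proof.
move=> oA; elim: n f g => [|n IH] f g.
  by move=> H1 H2 x Ax; apply: continuousM; [exact: H1|exact: H2].
move=> F G; have [df Df] := F; have [dg Dg] := G; split => [x Ax|v].
  by apply: differentiableM; [exact: df|exact: dg].
apply: (@Cn_ext _ _ (fun x => f x * 'D_v g x + g x * 'D_v f x)) => // [x Ax|].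
  by rewrite deriveM //; apply/diff_derivable; [exact: df|exact: dg].
by apply: CnD => //; [exact: IH (CnW F) (Dg v)|exact: IH (CnW G) (Df v)].
Qed.

Lemma Cn_sum n A (I : Type) (r : seq I) (P : pred I) (F : I -> 'rV[R]_m -> R) :
  open A -> (forall i, P i -> Cn n A (F i)) ->
  Cn n A (fun x => \sum_(i <- r | P i) F i x).
Proof.
move=> oA H; elim: r => [|i r IH].
  rewrite (_ : (fun _ => _) = cst 0); first exact: Cn_cst.
  by apply/funext => x; rewrite big_nil.
under eq_fun do rewrite big_cons.
by case Pi: (P i) => //; apply: CnD => //; exact: H.
Qed.

Lemma Cn_prod n A (I : Type) (r : seq I) (P : pred I) (F : I -> 'rV[R]_m -> R) :
  open A -> (forall i, P i -> Cn n A (F i)) ->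
  Cn n A (fun x => \prod_(i <- r | P i) F i x).
Proof.
move=> oA H; elim: r => [|i r IH].
  rewrite (_ : (fun _ => _) = cst 1); first exact: Cn_cst.
  by apply/funext => x; rewrite big_nil.
under eq_fun do rewrite big_cons.
by case Pi: (P i) => //; apply: CnM => //; exact: H.
Qed.

Lemma Cn_coord n A j : Cn n A (fun x : 'rV[R]_m => x 0 j).
Proof.
have dc x : differentiable (fun x : 'rV[R]_m => x 0 j) x by exact: differentiable_coord.
case: n => [|n] /=; first by move=> x _; exact/differentiable_continuous.
split => // v; rewrite (_ : 'D_v _ = cst (v 0 j)); first exact: Cn_cst.
apply/funext => x.
have := @derive_mx R _ 1 m id x v (@derivable_id _ _ x v).
by rewrite derive_id => /matrixP/(_ 0 j); rewrite mxE.
Qed.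

Lemma CnV n A f : open A -> (forall x, A x -> f x != 0) -> Cn n A f ->
  Cn n A (fun x => (f x)^-1).
Proof.
move=> oA f0; elim: n => [|n IH].
  by move=> H x Ax; apply: continuousV; [exact: f0|exact: H].
move=> F; have [df Df] := F; split => [x Ax|v].
  by apply: differentiableV; [exact: df|exact: f0].
apply: (@Cn_ext _ _ (fun x => (f x)^-1 * (f x)^-1 * ((-1) * 'D_v f x))) => //.
  move=> x Ax; rewrite deriveV; [|exact: f0|exact/diff_derivable/df].
  by rewrite scaleNr mulN1r mulrN -[_ *: _]/(_ * _) expr2 invfM.
have FV := IH (CnW F).
by apply: CnM => //; apply: CnM => //; [exact: Cn_cst|exact: Df].
Qed.

Lemma Cn_det n p A (F : 'rV[R]_m -> 'M[R]_p) : open A ->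
  (forall i j, Cn n A (fun x => F x i j)) -> Cn n A (fun x => \det (F x)).
Proof.
move=> oA H; rewrite /determinant; apply: Cn_sum => // s _; apply: CnM => //.
  exact: Cn_cst.
by apply: Cn_prod.
Qed.

Lemma Cn_invmx n p A (F : 'rV[R]_m -> 'M[R]_p) : open A ->
  (forall x, A x -> F x \in unitmx) ->
  (forall i j, Cn n A (fun x => F x i j)) ->
  forall i j, Cn n A (fun x => invmx (F x) i j).
Proof.
move=> oA U H i j.
apply: (@Cn_ext _ _ (fun x => (\det (F x))^-1 * cofactor (F x) j i)) => //.
  by move=> x Ax; rewrite /invmx U // !mxE.
apply: CnM => //.
  apply: CnV => //; last exact: Cn_det.
  by move=> x Ax; move: (U x Ax); rewrite unitmxE unitfE.
apply: CnM => //; first exact: Cn_cst.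
apply: Cn_det => // k l; apply: (Cn_ext oA _ (H (lift j k) (lift i l))) => x _.
by rewrite !mxE.
Qed.

End SmoothFunctions.

Section VectorFunctions.
Context {R : realType} {m : nat}.

Lemma differentiable_rowP p (f : 'rV[R]_m -> 'rV[R]_p) x :
  differentiable f x <-> forall j, differentiable (fun y => f y 0 j) x.
Proof.
split => [df j|H].
  exact: (differentiable_comp df (differentiable_coord _ _ _)).
rewrite (_ : f = \sum_(j < p) (fun y => f y 0 j *: delta_mx 0 j)).
  by apply: differentiable_sum => j; exact: differentiableZl.
apply/funext => y; rewrite fct_sumE [LHS]row_sum_delta.
by apply: eq_bigr.
Qed.

Lemma derive_row p (f : 'rV[R]_m -> 'rV[R]_p) x v j : differentiable f x ->
  'D_v f x 0 j = 'D_v (fun y => f y 0 j) x.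
Proof. by move=> df; rewrite derive_mx ?mxE //; exact: diff_derivable. Qed.

Lemma Cn_onP p n A (f : 'rV[R]_m -> 'rV[R]_p) : open A ->
  Cn_on n A f <-> forall j, Cn n A (fun y => f y 0 j).
Proof.
move=> oA; elim: n f => [|n IH] f /=.
  split => [H j x Ax|H x Ax].
    by have /continuous_mxP := H x Ax.
  by apply/continuous_mxP => i j; rewrite !ord1; exact: H.
split => [[df Df] j|H].
  have dfj x : A x -> differentiable (fun y => f y 0 j) x.
    by move=> Ax; have /differentiable_rowP := df x Ax.
  split => // v; have /IH/(_ j) := Df v; apply: Cn_ext => // x Ax.
  by rewrite derive_row //; exact: df.
have df x : A x -> differentiable f x.
  by move=> Ax; apply/differentiable_rowP => j; have [d _] := H j; exact: d.
split => // v; apply/IH => j; have [_ /(_ v)] := H j; apply: Cn_ext => // x Ax.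
by rewrite derive_row //; exact: df.
Qed.

Lemma smooth_onP p A (f : 'rV[R]_m -> 'rV[R]_p) : open A ->
  smooth_on A f <-> forall j, smooth A (fun y => f y 0 j).
Proof.
move=> oA; split => [H j n|H n]; first by have /(Cn_onP n f oA) := H n.
by apply/Cn_onP => // j; exact: H.
Qed.

(** The chain rule in coordinates writes a derivative of the composite as a sum of products, to
    which the induction applies with [g] replaced by its partial derivatives. *)
Lemma Cn_comp p n A (B : set 'rV[R]_p) (f : 'rV[R]_m -> 'rV[R]_p) g :
  open A -> open B -> f @` A `<=` B ->
  (forall j, Cn n A (fun y => f y 0 j)) -> Cn n B g -> Cn n A (g \o f).
Proof.
move=> oA oB fAB; elim: n g => [|n IH] g.
  move=> Hf Hg x Ax; apply: (@continuous_comp _ _ _ f g).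
    by apply/continuous_mxP => i j; rewrite !ord1; exact: Hf.
  by apply: Hg; apply: fAB; exists x.
move=> Hf Hg; have [dg Dg] := Hg.
have df x : A x -> differentiable f x.
  by move=> Ax; apply/differentiable_rowP => j; have [d _] := Hf j; exact: d.
have dgf x : A x -> differentiable g (f x) by move=> Ax; apply/dg/fAB; exists x.
split => [x Ax|v]; first by apply: differentiable_comp; [exact: df|exact: dgf].
apply: (@Cn_ext _ _ _ _ (fun x => \sum_j 'D_v (fun y => f y 0 j) x *
                              ('D_(delta_mx 0 j) g \o f) x)) => //.
  move=> x Ax; have Dx := df x Ax; have Gx := dgf x Ax.
  rewrite deriveE; last exact: differentiable_comp.
  rewrite diff_comp //= -(deriveE v Dx); set w := 'D_v f x.
  rewrite [in RHS](row_sum_delta w) linear_sum; apply: eq_bigr => j _.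
  by rewrite linearZ /= -derive_row // -/w deriveE.
apply: Cn_sum => // j _; apply: CnM => //; first by have [_] := Hf j; exact.
by apply: IH; [move=> k; exact/CnW/Hf|exact: Dg].
Qed.

End VectorFunctions.

(** * The inverse function theorem *)

Section InverseFunction.
Context {R : realType} {n : nat}.
Implicit Types (x y v : 'rV[R]_n) (f : 'rV[R]_n -> 'rV[R]_n).

Lemma mulmx_norm p q (v : 'rV[R]_p) (M : 'M[R]_(p, q)) :
  `|v *m M| <= p%:R * `|M| * `|v|.
Proof.
apply: mx_norm_le; first by rewrite !mulr_ge0 ?ler0n.
move=> i j; rewrite mxE; apply: le_trans (ler_norm_sum _ _ _) _.
have -> : p%:R * `|M| * `|v| = \sum_(k < p) `|M| * `|v|.
  by rewrite sumr_const card_ord -mulrA mulr_natl.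
apply: ler_sum => k _; rewrite normrM mulrC.
by apply: ler_pM => //; exact: mx_entry_norm.
Qed.

Lemma mulmxr_continuous p q (M : 'M[R]_(p, q)) :
  continuous (mulmxr M : 'rV[R]_p -> 'rV[R]_q).
Proof.
move=> x; apply/continuous_mxP => i j.
rewrite (_ : (fun y : 'rV[R]_p => _) = (fun y : 'rV[R]_p => \sum_k y i k * M k j)).
  apply: continuous_at_sum => k _; apply: continuousM; last exact: cst_continuous.
  exact: coord_continuous.
by apply/funext => y; rewrite mxE.
Qed.

Lemma near0_norm_lt {V : normedModType R} (e : R) : 0 < e ->
  \forall v \near (0 : V), `|v| < e.
Proof.
move=> e0; apply/nbhs_ballP; exists e => //= v.
by rewrite -ball_normE /= sub0r normrN.
Qed.

Lemma is_derive_line {V W : normedModType R} (f : V -> W) (y w : V) (t : R) d :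
  is_derive (y + t *: w) w f d -> is_derive t 1 (fun s : R => f (y + s *: w)) d.
Proof.
move=> [Df fd].
have E : (fun a : R => a^-1 *: (((fun s : R => f (y + s *: w)) \o shift t) (a *: 1)
    - f (y + t *: w))) =
    (fun a : R => a^-1 *: ((f \o shift (y + t *: w)) (a *: w) - f (y + t *: w))).
  apply/funext => a; congr (_ *: (f _ - _)).
  by rewrite /= -[a *: 1]/(a * 1) mulr1 scalerDl addrCA.
by apply: DeriveDef; [rewrite /derivable E|rewrite /derive E].
Qed.

(** The transposed Jacobian: vectors are rows, so the differential is right multiplication by this
    matrix. *)
Definition partials f x : 'M[R]_n :=
  \matrix_(i, j) 'D_(delta_mx 0 i) (fun y => f y 0 j) x.

Lemma derive_partials f x v : differentiable f x -> 'D_v f x = v *m partials f x.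
Proof.
move=> df; rewrite deriveE // {1}[v]row_sum_delta linear_sum.
apply/rowP => j; rewrite summxE mxE; apply: eq_bigr => i _.
by rewrite linearZ mxE [in RHS]mxE -derive_row // deriveE.
Qed.

Section Local.
Variables (A : set 'rV[R]_n) (f : 'rV[R]_n -> 'rV[R]_n) (x0 : 'rV[R]_n).
Hypotheses (oA : open A) (Ax0 : A x0) (sf : smooth_on A f).
Hypothesis inj_df : forall v, 'd f x0 v = 0 -> v = 0.

Let df x : A x -> differentiable f x.
Proof. by have [d _] := sf 1%N; exact: d. Qed.

Let sJ i j : smooth A (fun x => partials f x i j).
Proof.
move=> k; have /(smooth_onP f oA)/(_ j k.+1)[_ /(_ (delta_mx 0 i))] := sf.
by apply: Cn_ext => // x _; rewrite mxE.
Qed.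

Let K := invmx (partials f x0).

Let unitJ0 : partials f x0 \in unitmx.
Proof.
rewrite -row_free_unit -kermx_eq0; apply/rowV0P => v /sub_kermxP vJ.
by apply: inj_df; rewrite -deriveE ?derive_partials //; exact: df.
Qed.

(** [f] normalized to have identity derivative at [x0]. The difference [h] from the identity then
    has small derivative [E] near [x0] and is a contraction there. *)
Let G x := f x *m K.
Let h x := x - G x.

Let E x := 1%:M - partials f x *m K.

Let dh x : A x -> differentiable h x /\ forall v, 'D_v h x = v *m E x.
Proof.
move=> Ax; have dfx := df Ax.
pose L : {linear 'rV[R]_n -> 'rV[R]_n} := mulmxr K.
have cL : continuous L by exact: mulmxr_continuous.
have dL y : differentiable L y by exact/linear_differentiable.
have dG : differentiable G x by exact: (differentiable_comp dfx (dL _)).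
split=> [|v]; first by apply: differentiableB.
rewrite deriveB; [|exact: derivable_id|exact: diff_derivable].
have DG : 'D_v G x = 'd f x v *m K.
  rewrite (deriveE v dG).
  have e1 : 'd (L \o f) x v = 'd L (f x) ('d f x v).
    exact: (congr1 (@^~ v) (diff_comp dfx (dL (f x)))).
  have e2 : 'd L (f x) ('d f x v) = 'd f x v *m K.
    exact: (congr1 (@^~ ('d f x v)) (diff_lin (f x) cL)).
  exact: etrans e1 e2.
by rewrite derive_id DG -(deriveE v dfx) derive_partials // /E mulmxBr mulmx1 mulmxA.
Qed.

Let ball_exists : exists2 r : R, 0 < r & forall x, `|x - x0| <= r ->
  [/\ A x, partials f x \in unitmx & n%:R * `|E x| <= 2^-1].
Proof.
have cJ : {for x0, continuous (partials f)}.
  by apply/continuous_mxP => i j; exact: Cn_continuous (sJ i j 0%N) Ax0.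
have E0 : E x0 = 0 by rewrite /E mulmxV // subrr.
have cE : {for x0, continuous E}.
  apply/continuous_mxP => i j.
  rewrite (_ : (fun y => E y i j) =
    (fun y => (1%:M : 'M[R]_n) i j - \sum_k partials f y i k * K k j)); last first.
    by apply/funext => y; rewrite !mxE.
  apply: continuousB; first exact: cst_continuous.
  apply: continuous_at_sum => k _; apply: continuousM; last exact: cst_continuous.
  by move/continuous_mxP: cJ.
have cd : {for x0, continuous (fun x => \det (partials f x))}.
  by apply: (@Cn_continuous _ _ 0 A) => //; apply: Cn_det => // i j; exact: sJ.
have C0 : 0 < n%:R * 2 + 1 :> R by rewrite ltr_wpDl // mulr_ge0.
have nE : \forall x \near x0, `|E x0 - E x| < (n%:R * 2 + 1)^-1.
  by move/cvgrPdist_lt: cE; apply; rewrite invr_gt0.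
have nd : \forall x \near x0, \det (partials f x) != 0.
  apply: (cvgr_neq0 _ cd); rewrite -unitfE -unitmxE //.
have nA : \forall x \near x0, A x by exact: open_nbhs_nbhs.
have : \forall x \near x0, [/\ A x, partials f x \in unitmx & n%:R * `|E x| <= 2^-1].
  near=> x; split; first by near: x.
    by rewrite unitmxE unitfE; near: x.
  have : `|E x0 - E x| < (n%:R * 2 + 1)^-1 by near: x.
  rewrite E0 sub0r normrN => Ex.
  (* The bound on [E] is chosen so that n / (2n + 1) <= 1/2; the factor n is the one lost in
     [mulmx_norm]. *)
  apply: (@le_trans _ _ (n%:R * (n%:R * 2 + 1)^-1)); first by rewrite ler_wpM2l // ltW.
  by rewrite ler_pdivrMr // mulrDr mulrCA mulVf ?pnatr_eq0 // !mulr1 lerDl invr_ge0.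
move/nbhs_ballP => [e /= e0 He]; exists (e / 2) => [|x xe]; first by rewrite divr_gt0.
apply: He; rewrite -ball_normE /= distrC; apply: le_lt_trans xe _.
by rewrite ltr_pdivrMr // ltr_pMr // ltr1n.
Unshelve. all: by end_near. Qed.

(** The mean value theorem is applied to each coordinate along the segment from [y] to [x], which
    stays in the convex ball. *)
Let lipschitz_h r : (forall x, `|x - x0| <= r ->
    [/\ A x, partials f x \in unitmx & n%:R * `|E x| <= 2^-1]) ->
  forall x y, `|x - x0| <= r -> `|y - x0| <= r -> `|h x - h y| <= 2^-1 * `|x - y|.
Proof.
move=> Hr x y xr yr; apply: mx_norm_le => [|i j]; first by rewrite mulr_ge0 // invr_ge0.
rewrite {i}ord1; pose z (t : R) := y + t *: (x - y).
have zr (t : R) : 0 <= t <= 1 -> `|z t - x0| <= r.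
  move=> /andP[t0 t1].
  have -> : z t - x0 = t *: (x - x0) + (1 - t) *: (y - x0).
    rewrite /z !scalerBr scalerBl !scale1r scalerBl; apply/rowP => k; rewrite !mxE; ring.
  apply: le_trans (ler_normD _ _) _; rewrite !normrZ !ger0_norm ?subr_ge0 //.
  by apply: (@le_trans _ _ (t * r + (1 - t) * r)); [apply: lerD; rewrite ler_wpM2l ?subr_ge0|rewrite -mulrDl addrC subrK mul1r].
have dz (t : R) : 0 <= t <= 1 -> is_derive t 1 (fun s : R => h (z s) 0 j) (((x - y) *m E (z t)) 0 j).
  move=> /zr /Hr[Az _ _]; have [dhz Dhz] := dh Az.
  apply: (is_derive_line (f := fun u => h u 0 j)); apply: DeriveDef.
    by have /differentiable_rowP/(_ j)/diff_derivable := dhz; exact.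
  by rewrite -derive_row // Dhz.
have [||c cI] := @MVT_segment R (fun s => h (z s) 0 j) (fun t => ((x - y) *m E (z t)) 0 j) 0 1 ler01.
- by move=> t; rewrite in_itv /= => /andP[t0 t1]; apply: dz; rewrite !ltW.
- apply: derivable_within_continuous => t; rewrite in_itv /= => tI.
  by have [] := dz t tI.
rewrite subr0 mulr1 /z scale1r scale0r addr0 [y + _]addrC subrK => e.
have -> : (h x - h y) 0 j = h x 0 j - h y 0 j by rewrite [LHS]mxE [X in _ + X]mxE.
rewrite e.
apply: le_trans (mx_entry_norm _ _ _) _; apply: le_trans (mulmx_norm _ _) _.
rewrite in_itv /= in cI.
by apply: ler_wpM2r => //; have [_ _] := Hr _ (zr c cI).
Qed.

(** Surjectivity onto a small ball comes from minimizing the distance to the target over a compact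
    ball, instead of iterating a contraction to a fixed point. *)
Lemma inverse_function_at : exists O (g : 'rV[R]_n -> 'rV[R]_n),
  [/\ open O, O x0, O `<=` A, open (f @` O) & (forall x, O x -> g (f x) = x) /\
    smooth_on (f @` O) g].
Proof.
have [r r0 Hr] := ball_exists; have lip := lipschitz_h Hr.
have unitK : K \in unitmx by rewrite unitmx_inv.
pose O : set 'rV[R]_n := [set x | `|x - x0| < r].
have OE : O = ball x0 r.
  by rewrite -ball_normE; apply/seteqP; split => x /=; rewrite distrC.
have oO : open O by rewrite OE; exact: ball_open.
have OA : O `<=` A by move=> x /ltW /Hr[].
have Ox0 : O x0 by rewrite /O /= subrr normr0.
have expand x y : O x -> O y -> `|x - y| <= 2 * `|G x - G y|.
  move=> /ltW xr /ltW yr; have := lip x y xr yr.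
  have -> : x - y = (h x - h y) + (G x - G y) by rewrite /h; apply/rowP => k; rewrite !mxE; ring.
  set a := h x - h y; set b := G x - G y => H.
  have := ler_normD a b; lra.
have onto c rho y : 0 < rho -> (forall x, `|x - c| <= rho -> O x) ->
    `|y - G c| < rho / 4 -> exists2 x, `|x - c| <= rho & G x = y.
  move=> rho0 cO yc.
  pose D : set 'rV[R]_n := [set x | `|x - c| <= rho].
  have DE : D = closed_ball c rho.
    by rewrite closed_ballE //; apply/seteqP; split => x; rewrite /D /closed_ball_ /= distrC.
  have compD : compact D.
    apply: bounded_closed_compact; last by rewrite DE; exact: closed_ball_closed.
    exists (rho + `|c|); split; first by rewrite num_real.
    move=> M HM x xD; apply: ltW; apply: le_lt_trans HM.
    by rewrite -(subrK c x); apply: le_trans (ler_normD _ _) _; rewrite lerD2r.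
  have cG : {within D, continuous (fun x => `|G x - y|)}.
    apply: continuous_in_subspaceT => x; rewrite inE => /cO /OA Ax.
    have cGx : {for x, continuous G}.
      apply: (@continuous_comp _ _ _ f (mulmxr K)); last exact: mulmxr_continuous.
      exact/differentiable_continuous/df.
    apply: continuous_comp; last exact: norm_continuous.
    by apply: continuousB => //; exact: cst_continuous.
  have D0 : D !=set0 by exists c; rewrite /D /= subrr normr0 ltW.
  have [x xD xmin] := EVT_min_rV D0 compD cG.
  move: xD; rewrite inE => xD; exists x => //; apply/eqP; rewrite -subr_eq0; apply/negPn/negP => nz.
  (* One step of the fixed-point iteration stays in the ball and at least halves the distance to
     [y], which contradicts minimality. *)
  pose x' := x + (y - G x).
  have x'D : D x'.
    rewrite /D /= (_ : x' - c = (y - G c) + (h x - h c)); last first.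
      by rewrite /h /x'; apply/rowP => k; rewrite !mxE; ring.
    have := ler_normD (y - G c) (h x - h c).
    have cc : `|c - c| <= rho by rewrite subrr normr0 ltW.
    by have := lip x c (ltW (cO _ xD)) (ltW (cO _ cc)); move: xD; rewrite /D /=; lra.
  have := xmin x'; rewrite inE => /(_ x'D).
  have -> : G x' - y = h x - h x'.
    by rewrite /h /x'; apply/rowP => k; rewrite !mxE; ring.
  have := lip x x' (ltW (cO _ xD)) (ltW (cO _ x'D)).
  have -> : x - x' = G x - y by rewrite /x' opprD addrA subrr add0r opprB.
  have : 0 < `|G x - y| by rewrite normr_gt0.
  lra.
pose g y := xget x0 [set x | O x /\ f x = y].
have gf x : O x -> g (f x) = x.
  move=> Ox; have [Og fg] : O (g (f x)) /\ f (g (f x)) = f x.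
    exact: (@xgetPex _ x0 [set z | O z /\ f z = f x]) (ex_intro _ x (conj Ox erefl)).
  apply/eqP; rewrite -subr_eq0 -normr_eq0 eq_le normr_ge0 andbT.
  by apply: le_trans (expand _ _ Og Ox) _; rewrite /G fg subrr normr0 mulr0.
have nearfO x e : O x -> 0 < e ->
    \forall k \near (0 : 'rV[R]_n), exists2 x', O x' /\ `|x' - x| < e & f x' = k + f x.
  (* [rho] keeps the closed ball around [x] both inside [O] and within distance [e]. *)
  move=> Ox e0; pose rho := Num.min (e / 2) ((r - `|x - x0|) / 2).
  have rx : 0 < r - `|x - x0| by rewrite subr_gt0.
  have rho0 : 0 < rho by rewrite lt_min !divr_gt0.
  have C0 : 0 < n%:R * `|K| + 1 by rewrite ltr_wpDl // mulr_ge0.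
  have rho4 : 0 < rho / 4 / (n%:R * `|K| + 1) by rewrite !divr_gt0.
  near=> k.
  have kK : `|(k + f x) *m K - G x| < rho / 4.
    rewrite mulmxDl addrK; apply: le_lt_trans (mulmx_norm _ _) _.
    apply: (@le_lt_trans _ _ ((n%:R * `|K| + 1) * `|k|)).
      by rewrite ler_wpM2r // lerDl.
    rewrite mulrC -ltr_pdivlMr //.
  have [|x' x'x Gx'] := onto x rho ((k + f x) *m K) rho0 _ kK.
    move=> z zx; rewrite /O /= -(subrK x z) -addrA.
    apply: le_lt_trans (ler_normD _ _) _.
    have : rho <= (r - `|x - x0|) / 2 by rewrite ge_min lexx orbT.
    lra.
  have x'e : `|x' - x| < e.
    apply: le_lt_trans x'x _; rewrite /rho gt_min; apply/orP; left; lra.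
  exists x'; last first.
    by move/(congr1 (mulmx^~ (invmx K))): Gx'; rewrite /G !mulmxK.
  split=> //; rewrite /O /= -(subrK x x') -addrA.
  apply: le_lt_trans (ler_normD _ _) _.
  have : rho <= (r - `|x - x0|) / 2 by rewrite ge_min lexx orbT.
  lra.
have ofO : open (f @` O).
  rewrite openE => _ [x Ox <-]; suff : \forall y \near f x, (f @` O) y by [].
  rewrite (near_shift 0 (f x)) subr0; near=> k.
  have [x' [Ox' _] fx'] : exists2 x', O x' /\ `|x' - x| < 1 & f x' = k + f x.
    by near: k; exact: nearfO.
  by exists x'.
have dg x : O x -> differentiable g (f x) /\
    forall v, 'D_v g (f x) = v *m invmx (partials f x).
  move=> Ox; have Ax := OA _ Ox; have [_ uJ _] := Hr x (ltW Ox).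
  set J := partials f x in uJ *.
  pose L : {linear 'rV[R]_n -> 'rV[R]_n} := mulmxr (invmx J).
  have cL : continuous L by exact: mulmxr_continuous.
  have [|dgx Dgx] := @differentiable_eps _ _ _ g (f x) L cL.
    move=> e e0.
    pose C1 := n%:R * `|K| + 1; pose C2 := n%:R * `|invmx J| + 1.
    have C10 : 0 < C1 by rewrite ltr_wpDl // mulr_ge0.
    have C20 : 0 < C2 by rewrite ltr_wpDl // mulr_ge0.
    (* The factor 2 * [C1] bounds the displacement of the preimage by that of the image, and [C2]
       bounds the inverse Jacobian. *)
    pose e1 := e / (2 * C1 * C2).
    have e10 : 0 < e1 by rewrite divr_gt0 // !mulr_gt0.
    have /nbhs_ballP[del /= del0 Hdel] := differentiable_near (df Ax) e10.
    have dd : \forall k \near (0 : 'rV[R]_n),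
        exists2 x', O x' /\ `|x' - x| < del & f x' = k + f x by exact: nearfO.
    apply: filterS dd => k [x' [Ox' xx'] fx'].
    rewrite -fx' gf // gf //=.
    have /= Hx' : `|f ((x' - x) + x) - f x - 'd f x (x' - x)| <= e1 * `|x' - x|.
      by apply: Hdel; rewrite -ball_normE /= sub0r normrN.
    rewrite subrK fx' addrK -deriveE ?derive_partials -?/J in Hx'; [|exact: df..].
    have xk : `|x' - x| <= 2 * C1 * `|k|.
      apply: le_trans (expand _ _ Ox' Ox) _; rewrite -mulrA ler_wpM2l //.
      rewrite /G fx' mulmxDl addrK; apply: le_trans (mulmx_norm _ _) _.
      by rewrite ler_wpM2r // lerDl.
    have -> : x' - x - k *m invmx J = - ((k - (x' - x) *m J) *m invmx J).
      by rewrite mulmxBl mulmxK // opprB.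
    rewrite normrN; apply: le_trans (mulmx_norm _ _) _.
    apply: (@le_trans _ _ (C2 * (e1 * (2 * C1 * `|k|)))).
      apply: ler_pM => //; first by rewrite lerDl.
      by apply: le_trans Hx' _; rewrite ler_wpM2l // ltW.
    rewrite /e1 le_eqVlt; apply/orP; left; apply/eqP.
    by field; rewrite !gt_eqF.
  by split => // v; rewrite deriveE // Dgx.
(* Bootstrap: the derivative of [g] is the inverse Jacobian evaluated at [g], hence as regular as
   [g] is already known to be. *)
have sg k j : Cn k (f @` O) (fun y => g y 0 j).
  elim: k j => [|k IH] j.
    move=> _ [x Ox <-]; have [dgx _] := dg x Ox.
    by have /continuous_mxP := differentiable_continuous dgx; exact.
  split=> [_ [x Ox <-]|v].
    by have [/differentiable_rowP dgx _] := dg x Ox; exact: dgx.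
  apply: (@Cn_ext _ _ _ _ (fun y => \sum_i v 0 i * invmx (partials f (g y)) i j)) => //.
    move=> _ [x Ox <-]; have [dgx Dgx] := dg x Ox.
    by rewrite gf // -derive_row // Dgx mxE.
  apply: Cn_sum => // i _; apply: CnM => //; first exact: Cn_cst.
  apply: Cn_invmx => //.
    by move=> _ [x Ox <-]; rewrite gf //; have [] := Hr x (ltW Ox).
  move=> a b; apply: (@Cn_comp _ _ _ _ _ A g (fun x => partials f x a b)) => //.
    by move=> _ [_ [x Ox <-] <-]; rewrite gf //; exact: OA.
  exact: sJ.
exists O, g; split => //; split => //.
by apply/smooth_onP => // j k; exact: sg.
Unshelve. all: by end_near. Qed.

End Local.
End InverseFunction.

(** The dimensions are separate terms with an equation between them because those of [slice_map]
    agree only by arithmetic. *)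
Theorem inverse_function {R : realType} n p (A : set 'rV[R]_n)
    (f : 'rV[R]_n -> 'rV[R]_p) x0 :
  n = p -> open A -> A x0 -> smooth_on A f ->
  (forall v, 'd f x0 v = 0 -> v = 0) ->
  exists O (g : 'rV[R]_p -> 'rV[R]_n),
  [/\ open O, O x0, O `<=` A, open (f @` O) & (forall x, O x -> g (f x) = x) /\
    smooth_on (f @` O) g].
Proof. by move=> e; subst p; exact: inverse_function_at. Qed.

(** A smooth left inverse gives every clause at once: injectivity, injectivity of the differential
    by the chain rule, and openness onto the image, because the image of an open [O] is cut out by
    the preimage of [O] under [g]. *)
Lemma smooth_embedding_left_inverse {R : realType} n p (A : set 'rV[R]_n)
    (B B' : set 'rV[R]_p) (f : 'rV[R]_n -> 'rV[R]_p) (g : 'rV[R]_p -> 'rV[R]_n) :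
  open A -> open B' -> f @` A `<=` B -> f @` A `<=` B' ->
  smooth_on A f -> smooth_on B' g -> (forall x, A x -> g (f x) = x) ->
  smooth_embedding A B f.
Proof.
move=> oA oB' fB fB' sf sg gf.
have df x : A x -> differentiable f x by have [d _] := sf 1%N; exact: d.
have dg x : B' x -> differentiable g x by have [d _] := sg 1%N; exact: d.
split => //.
- by move=> x y; rewrite !inE => Ax Ay fxy; rewrite -(gf x) // fxy gf.
- move=> x Ax; have dfx := df x Ax; have dgx : differentiable g (f x).
    by apply/dg/fB'; exists x.
  have cid : continuous (idfun : 'rV[R]_n -> 'rV[R]_n) by move=> ?; exact: cvg_id.
  have e : 'd g (f x) \o 'd f x = id.
    rewrite -diff_comp //.
    have [|_ -> //] := @differentiable_eps _ _ _ (g \o f) x idfun cid.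
    move=> eps eps0; have nA : \forall h \near (0 : 'rV[R]_n), A (h + x).
      have : \forall y \near x, A y by exact: open_nbhs_nbhs.
      by rewrite (near_shift 0 x) subr0.
    apply: filterS nA => h Ah; rewrite /= !gf // addrK subrr normr0.
    by rewrite mulr_ge0 // ltW.
  by move=> u v uv; have := congr1 (fun F => F u) e; rewrite /= uv => <-; exact: (congr1 (fun F => F v) e).
- move=> O oO OA; exists (B' `&` g @^-1` O).
    rewrite openE => y [By Oy]; apply: filterI; first exact: open_nbhs_nbhs.
    have cg : {for y, continuous g} by exact/differentiable_continuous/dg.
    by apply: cg; exact: open_nbhs_nbhs.
  apply/seteqP; split => [_ [x Ox <-]|y [[By Oy] [x Ax fxy]]].
    split; last by exists x => //; exact: OA.
    split; last by rewrite /= gf //; exact: OA.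
    by apply: fB'; exists x => //; exact: OA.
  by exists x => //; move: Oy; rewrite /= -fxy gf.
Qed.

(** * Kraus operators and irreducibility *)

Section ConjugateTranspose.
Context {C : numClosedFieldType}.

Lemma adjmxM m n p (A : 'M[C]_(m, n)) (B : 'M[C]_(n, p)) :
  (A *m B)^t* = B^t* *m A^t*.
Proof. by rewrite trmx_mul map_mxM. Qed.

Lemma adjmxD m n (A B : 'M[C]_(m, n)) : (A + B)^t* = A^t* + B^t*.
Proof. by rewrite linearD /= map_mxD. Qed.

Lemma adjmxB m n (A B : 'M[C]_(m, n)) : (A - B)^t* = A^t* - B^t*.
Proof. by rewrite linearB /= map_mxB. Qed.

Lemma adjmxN m n (A : 'M[C]_(m, n)) : (- A)^t* = - A^t*.
Proof. by rewrite linearN /= map_mxN. Qed.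

Lemma adjmxZ m n (a : C) (A : 'M[C]_(m, n)) : (a *: A)^t* = a^* *: A^t*.
Proof. by rewrite linearZ /= map_mxZ. Qed.

Lemma adjmx0 m n : (0 : 'M[C]_(m, n))^t* = 0.
Proof. by rewrite trmx0 map_mx0. Qed.

Lemma adjmx_sum m n (I : finType) (F : I -> 'M[C]_(m, n)) :
  (\sum_i F i)^t* = \sum_i (F i)^t*.
Proof.
by apply: (big_morph (fun A : 'M[C]_(m, n) => A^t*)); [exact: adjmxD|exact: adjmx0].
Qed.

Lemma adjmx_scalar n (a : C) : (a%:M : 'M[C]_n)^t* = (a^*)%:M.
Proof. by rewrite tr_scalar_mx map_scalar_mx. Qed.

Lemma mxtrace_adj n (A : 'M[C]_n) : \tr (A^t*) = (\tr A)^*.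
Proof. by rewrite /mxtrace rmorph_sum; apply: eq_bigr => i _; rewrite !mxE. Qed.

Lemma unitarymxPl n (W : 'M[C]_n) : W \is unitarymx -> W^t* *m W = 1%:M.
Proof.
by move=> uW; rewrite -{2}[W]trmxCK; apply/unitarymxP; rewrite trmxC_unitary.
Qed.

(* The diagonal entries of Z rho Z^* are the values of rho on the rows of Z. *)
Lemma mxtrace_sandwich m n (rho : 'M[C]_n) (Z : 'M[C]_(m, n)) :
  \tr (rho *m (Z^t* *m Z)) =
  \sum_i (((row i Z)^t*)^t* *m rho *m (row i Z)^t*) 0 0.
Proof.
rewrite mulmxA mxtrace_mulC mulmxA /mxtrace; apply: eq_bigr => i _.
rewrite trmxCK -!row_mul !mxE; apply: eq_bigr => j _.
by rewrite !mxE.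
Qed.

End ConjugateTranspose.

Section KrausOperators.
Context {R : realType} {d k : nat}.
Local Notation C := R[i].
Implicit Types V : 'M[C]_(d * k, d).

Definition mixed V2 V1 (X : 'M[C]_d) : 'M[C]_d :=
  V2^t* *m (X *t (1%:M : 'M[C]_k)) *m V1.

Lemma tensmx1E (X : 'M[C]_d) r a s b :
  (X *t (1%:M : 'M[C]_k)) (mxtens_index (r, a)) (mxtens_index (s, b)) =
  X r s *+ (a == b).
Proof. by rewrite tensmxE [X in _ * X]mxE mulr_natr. Qed.

Lemma mulmx_tens1l p (X : 'M[C]_d) (M : 'M[C]_(d * k, p)) r a s :
  ((X *t (1%:M : 'M[C]_k)) *m M) (mxtens_index (r, a)) s =
  \sum_t X r t * M (mxtens_index (t, a)) s.
Proof.
rewrite mxE big_tens; apply: eq_bigr => t _; rewrite (bigD1 a) //= big1 ?addr0.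
  by rewrite tensmx1E eqxx.
by move=> b /negPf ba; rewrite tensmx1E eq_sym ba mul0r.
Qed.

Lemma kraus_tens1l (X : 'M[C]_d) V i :
  kraus ((X *t (1%:M : 'M[C]_k)) *m V) i = X *m kraus V i.
Proof.
apply/matrixP => r s; rewrite mxE mulmx_tens1l mxE.
by apply: eq_bigr => t _; rewrite mxE.
Qed.

Lemma kraus_mulr V (X : 'M[C]_d) i : kraus (V *m X) i = kraus V i *m X.
Proof.
by apply/matrixP => r s; rewrite !mxE; apply: eq_bigr => t _; rewrite mxE.
Qed.

Lemma krausZ (c : C) V i : kraus (c *: V) i = c *: kraus V i.
Proof. by apply/matrixP => r s; rewrite !mxE. Qed.

Lemma kraus_gauge (c : C) W V i :
  kraus (gauge c W V) i = c^* *: (W *m kraus V i *m W^t*).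
Proof. by rewrite /gauge krausZ kraus_mulr kraus_tens1l. Qed.

Lemma kraus_inj V1 V2 : (forall i, kraus V1 i = kraus V2 i) -> V1 = V2.
Proof.
move=> H; apply/matrixP => u s; case: (mxtens_indexP u) => r a.
by have /matrixP/(_ r s) := H a; rewrite !mxE.
Qed.

Lemma adj_kraus_sum V2 V1 :
  V2^t* *m V1 = \sum_i (kraus V2 i)^t* *m kraus V1 i.
Proof.
apply/matrixP => s t; rewrite mxE big_tens exchange_big summxE.
apply: eq_bigr => a _; rewrite mxE; apply: eq_bigr => r _.
by rewrite !mxE.
Qed.

Lemma mixedE V2 V1 X :
  mixed V2 V1 X = \sum_i (kraus V2 i)^t* *m X *m kraus V1 i.
Proof.
rewrite /mixed -mulmxA adj_kraus_sum; apply: eq_bigr => i _.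
by rewrite kraus_tens1l mulmxA.
Qed.

Lemma channelE V X : channel V X = mixed V V X. Proof. by []. Qed.

Lemma predualE V rho :
  predual V rho = \sum_i kraus V i *m rho *m (kraus V i)^t*.
Proof.
apply/matrixP => r s; rewrite mxE summxE; apply: eq_bigr => a _.
rewrite !mxE; apply: eq_bigr => t _; rewrite !mxE; congr (_ * _).
by apply: eq_bigr => u _; rewrite !mxE.
Qed.

Lemma predual_is_linear V : linear (predual V).
Proof.
move=> a X Y; rewrite !predualE scaler_sumr -big_split; apply: eq_bigr => i _.
by rewrite mulmxDr mulmxDl -scalemxAr -scalemxAl.
Qed.

HB.instance Definition _ V :=
  GRing.isLinear.Build C 'M[C]_d 'M[C]_d _ (predual V) (predual_is_linear V).

Lemma mixed_is_linear V2 V1 : linear (mixed V2 V1).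
Proof.
move=> a X Y; rewrite !mixedE scaler_sumr -big_split; apply: eq_bigr => i _.
by rewrite mulmxDr mulmxDl -scalemxAr -scalemxAl.
Qed.

HB.instance Definition _ V2 V1 :=
  GRing.isLinear.Build C 'M[C]_d 'M[C]_d _ (mixed V2 V1) (mixed_is_linear V2 V1).

Lemma adj_mixed V2 V1 X : (mixed V2 V1 X)^t* = mixed V1 V2 (X^t*).
Proof.
rewrite !mixedE adjmx_sum; apply: eq_bigr => i _.
by rewrite !adjmxM trmxCK mulmxA.
Qed.

Lemma adj_predual V X : (predual V X)^t* = predual V (X^t*).
Proof.
rewrite !predualE adjmx_sum; apply: eq_bigr => i _.
by rewrite !adjmxM trmxCK mulmxA.
Qed.

Lemma isometryE V : isometry V -> \sum_i (kraus V i)^t* *m kraus V i = 1%:M.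
Proof. by rewrite -adj_kraus_sum. Qed.

Lemma channel1 V : isometry V -> channel V 1%:M = 1%:M.
Proof.
move=> iV; rewrite channelE mixedE -[RHS](isometryE iV); apply: eq_bigr => i _.
by rewrite mulmx1.
Qed.

Lemma mxtrace_predual V X : isometry V -> \tr (predual V X) = \tr X.
Proof.
by move=> iV; have := predual_channel V X 1%:M; rewrite channel1 // !mulmx1.
Qed.

(** Faithfulness of the state: the trace is a sum of values of [rho] on the adjoint rows of [Z],
    each positive unless the row vanishes. *)
Lemma posdef_trace_eq0 m (rho : 'M[C]_d) (Z : 'M[C]_(m, d)) : posdef rho ->
  0 <= \tr (rho *m (Z^t* *m Z)) /\ (\tr (rho *m (Z^t* *m Z)) = 0 -> Z = 0).
Proof.
move=> prho; rewrite mxtrace_sandwich.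
have H i : 0 <= (((row i Z)^t*)^t* *m rho *m (row i Z)^t*) 0 0.
  have [->|/prho/ltW //] := eqVneq ((row i Z)^t*) 0; by rewrite mulmx0 mxE.
split => [|/eqP]; first exact: sumr_ge0.
rewrite psumr_eq0 // => /allP E; apply/row_matrixP => i; rewrite row0.
have /= := E i; rewrite mem_index_enum => /(_ isT).
have [e _|/prho] := eqVneq ((row i Z)^t*) 0; last by rewrite lt0r => /andP[/negPf ->].
by rewrite -[row i Z]trmxCK e trmx0 map_mx0.
Qed.

Lemma posdef_unit (rho : 'M[C]_d) : posdef rho -> rho \in unitmx.
Proof.
move=> prho; rewrite -row_free_unit -kermx_eq0; apply/rowV0P => v /sub_kermxP vr.
have [e|/prho] := eqVneq (v^t*) 0.
  by rewrite -[v]trmxCK e trmx0 map_mx0.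
by rewrite trmxCK vr mul0mx mxE ltxx.
Qed.

(* Z = (X (x) 1) V1 - l V2 X satisfies tr (rho Z^* Z) = (1 - |l|^2) tr (rho X^* X). *)
Lemma mixed_eigenvector V1 V2 rho X (l : C) :
  isometry V2 -> posdef rho -> predual V1 rho = rho ->
  mixed V2 V1 X = l *: X -> X != 0 -> 1 <= `|l| ->
  `|l| = 1 /\ forall i, X *m kraus V1 i = l *: (kraus V2 i *m X).
Proof.
move=> i2 prho srho eX X0 l1.
pose Z := (X *t (1%:M : 'M[C]_k)) *m V1 - l *: (V2 *m X).
have eX' : V2^t* *m ((X *t (1%:M : 'M[C]_k)) *m V1) = l *: X by rewrite mulmxA.
have eXa : ((X *t (1%:M : 'M[C]_k)) *m V1)^t* *m V2 = l^* *: X^t*.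
  by rewrite -{1}[V2]trmxCK -adjmxM eX' adjmxZ.
have ZZ : Z^t* *m Z = mixed V1 V1 (X^t* *m X) - (`|l| ^+ 2) *: (X^t* *m X).
  have -> : mixed V1 V1 (X^t* *m X) = ((X *t (1%:M : 'M[C]_k)) *m V1)^t* *m
      ((X *t (1%:M : 'M[C]_k)) *m V1).
    rewrite adj_kraus_sum mixedE; apply: eq_bigr => i _.
    by rewrite kraus_tens1l adjmxM !mulmxA.
  rewrite /Z; move: ((X *t _) *m V1) eX' eXa => Y eY eYa.
  rewrite adjmxB adjmxZ adjmxM mulmxBl !mulmxBr -!scalemxAl -!scalemxAr.
  rewrite [Y^t* *m (V2 *m X)]mulmxA eYa -[X^t* *m V2^t* *m Y]mulmxA eY.
  rewrite -[X^t* *m V2^t* *m _]mulmxA [V2^t* *m (V2 *m X)]mulmxA i2 mul1mx.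
  rewrite -scalemxAl -scalemxAr !scalerA normCK.
  by rewrite [l^* * l]mulrC subrr subr0.
have trZ : \tr (rho *m (Z^t* *m Z)) = (1 - `|l| ^+ 2) * \tr (rho *m (X^t* *m X)).
  rewrite ZZ mulmxBr -scalemxAr linearB linearZ /= -predual_channel srho.
  by rewrite mulrBl mul1r.
have [Zge0 Z0] := posdef_trace_eq0 Z prho.
have [Xge0 Xeq0] := posdef_trace_eq0 X prho.
have Xgt0 : 0 < \tr (rho *m (X^t* *m X)).
  by rewrite lt0r Xge0 andbT; apply: contraNneq X0 => /Xeq0 ->.
have l2 : `|l| = 1.
  apply/eqP; rewrite eq_le l1 andbT.
  move: Zge0; rewrite trZ pmulr_lge0 // subr_ge0 -[X in _ <= X](expr1n _ 2).
  by rewrite ler_pXn2r ?nnegrE.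
split => // i; have Zz : Z = 0 by apply: Z0; rewrite trZ l2 expr1n subrr mul0r.
have : kraus Z i = 0 by rewrite Zz; apply/matrixP => r s; rewrite !mxE.
have -> : kraus Z i = X *m kraus V1 i - l *: (kraus V2 i *m X).
  by rewrite -kraus_tens1l -kraus_mulr -krausZ; apply/matrixP => r s; rewrite !mxE.
by move/eqP; rewrite subr_eq0 => /eqP.
Qed.

End KrausOperators.

Section PositiveMatrices.
Context {R : realType} {d : nat}.
Local Notation C := R[i].
Implicit Types (A rho X : 'M[C]_d) (psi : 'cV[C]_d).

Definition sesq A (x y : 'cV[C]_d) : C := (x^t* *m A *m y) 0 0.

Lemma sesq_delta A i j : sesq A (delta_mx i 0) (delta_mx j 0) = A i j.
Proof.
rewrite /sesq trmx_delta map_delta_mx -rowE -colE !mxE.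
by [].
Qed.

Lemma sesqDvl A x y z : sesq A (x + y) z = sesq A x z + sesq A y z.
Proof. by rewrite /sesq adjmxD !mulmxDl mxE. Qed.

Lemma sesqDvr A x y z : sesq A x (y + z) = sesq A x y + sesq A x z.
Proof. by rewrite /sesq mulmxDr mxE. Qed.

Lemma sesqZvl A a x y : sesq A (a *: x) y = a^* * sesq A x y.
Proof. by rewrite /sesq adjmxZ -!scalemxAl mxE. Qed.

Lemma sesqZvr A a x y : sesq A x (a *: y) = a * sesq A x y.
Proof. by rewrite /sesq -scalemxAr mxE. Qed.

Lemma sesq_conj A x y : sesq (A^t*) x y = (sesq A y x)^*.
Proof.
have -> : sesq (A^t*) x y = ((y^t* *m A *m x)^t*) 0 0.
  by rewrite /sesq !adjmxM trmxCK mulmxA.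
by rewrite /sesq; move: (_ *m x) => M; rewrite !mxE.
Qed.

(** Polarization on basis vectors: the combinations with coefficients 1 and i separate the entries
    (i, j) and (j, i). *)
Lemma quad_eq0 A : (forall psi, sesq A psi psi = 0) -> A = 0.
Proof.
move=> H; have E c i j : c * A i j + c^* * A j i = 0.
  have H0 l : A l l = 0 by rewrite -sesq_delta H.
  have := H (delta_mx i 0 + c *: delta_mx j 0).
  rewrite sesqDvl !sesqDvr !sesqZvl !sesqZvr !sesq_delta !H0 !mulr0 addr0 add0r.
  by [].
apply/matrixP => i j; rewrite mxE.
have E1 := E 1 i j; have Ei := E 'i i j.
rewrite rmorph1 !mul1r in E1; rewrite conjCi mulNr -mulrBr in Ei.
move/eqP: Ei; rewrite mulf_eq0 (negPf (neq0Ci _)) /= subr_eq0 => /eqP Ei.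
move: E1; rewrite -Ei -mulr2n => /eqP; rewrite mulrn_eq0 /=.
by move/eqP.
Qed.

Lemma psd_hermitian rho : (forall psi, 0 <= sesq rho psi psi) -> rho^t* = rho.
Proof.
move=> H; apply/eqP; rewrite -subr_eq0; apply/eqP/quad_eq0 => psi.
rewrite /sesq mulmxBr mulmxBl [LHS]mxE [X in _ + X]mxE -!/(sesq _ _ _) sesq_conj.
by rewrite (CrealP (ger0_real (H psi))) subrr.
Qed.

Lemma posdef_ge0 rho psi : posdef rho -> 0 <= sesq rho psi psi.
Proof.
move=> prho; have [->|/prho/ltW //] := eqVneq psi 0.
by rewrite /sesq mulmx0 mxE.
Qed.

Lemma posdef_hermitian rho : posdef rho -> rho^t* = rho.
Proof. by move=> prho; apply: psd_hermitian => psi; exact: posdef_ge0. Qed.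

Lemma sesq1E psi : sesq 1%:M psi psi = \sum_i `|psi i 0| ^+ 2.
Proof.
by rewrite /sesq mulmx1 mxE; apply: eq_bigr => i _; rewrite !mxE normCKC.
Qed.

Lemma sesq1_ge0 psi : 0 <= sesq 1%:M psi psi.
Proof. by rewrite sesq1E sumr_ge0 // => i _; rewrite exprn_ge0. Qed.

Lemma sesq1_gt0 psi : psi != 0 -> 0 < sesq 1%:M psi psi.
Proof.
move=> p0; rewrite lt0r sesq1_ge0 andbT; apply: contra p0.
rewrite sesq1E psumr_eq0 => [/allP H|i _]; last by rewrite exprn_ge0.
apply/eqP/colP => i; rewrite mxE; have /= := H i.
by rewrite mem_index_enum expf_eq0 normr_eq0 => /(_ isT) /eqP.
Qed.

Lemma posdef_spectral rho : posdef rho -> exists P (s : 'rV[C]_d),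
  [/\ P \is unitarymx, forall i, 0 < s 0 i & rho = P^t* *m diag_mx s *m P].
Proof.
move=> prho; have hrho := posdef_hermitian prho.
have nrho : rho \is normalmx by apply/normalmxP; rewrite hrho.
have /orthomx_spectralP := nrho.
set P := spectralmx rho; set s := spectral_diag rho => e.
have uP : P \is unitarymx by exact: spectral_unitarymx.
rewrite invmx_unitary // in e; exists P, s; split => // i.
pose psi : 'cV[C]_d := P^t* *m delta_mx i 0.
have /unitarymxP PP := uP.
have psi0 : psi != 0.
  apply/eqP => /(congr1 (mulmx P)); rewrite mulmxA PP mul1mx mulmx0.
  by move/matrixP/(_ i 0); rewrite !mxE !eqxx => /eqP; rewrite oner_eq0.
have := prho _ psi0; rewrite -/(sesq _ _ _) e /sesq /psi adjmxM trmxCK !mulmxA.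
rewrite -[_ *m P *m P^t*]mulmxA PP mulmx1 -[_ *m P *m P^t*]mulmxA PP mulmx1.
by rewrite -/(sesq _ _ _) sesq_delta mxE eqxx mulr1n.
Qed.

Lemma posdef_factor rho : posdef rho -> exists Q : 'M[C]_d, rho = Q *m Q^t*.
Proof.
move=> /posdef_spectral[P [s [uP s0 ->]]].
pose D := diag_mx (\row_i sqrtC (s 0 i)) : 'M[C]_d.
have hD : D^t* = D.
  apply/matrixP => i j; rewrite !mxE rmorphMn /=; have [->|ij] := eqVneq j i.
    by rewrite !mulr1n; apply/CrealP/ger0_real; rewrite sqrtC_ge0 ltW.
  by rewrite !mulr0n.
have DD : D *m D = diag_mx s.
  by rewrite mulmx_diag; congr diag_mx; apply/rowP => i; rewrite !mxE -expr2 sqrtCK.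
exists (P^t* *m D); move: D hD DD => D hD DD.
by rewrite adjmxM trmxCK hD mulmxA -[_ *m D *m D]mulmxA DD.
Qed.

Lemma posdef_coercive rho : posdef rho ->
  exists2 e : C, 0 < e & forall psi, e * sesq 1%:M psi psi <= sesq rho psi psi.
Proof.
move=> /posdef_spectral[P [s [uP s0 ->]]].
have T0 : 0 < 1 + \sum_i (s 0 i)^-1.
  by rewrite ltr_pwDl // sumr_ge0 // => i _; rewrite invr_ge0 ltW.
(* A lower bound of all eigenvalues that needs no minimum; the summand 1 keeps it positive in
   dimension 0. *)
exists (1 + \sum_i (s 0 i)^-1)^-1 => [|psi]; first by rewrite invr_gt0.
pose phi := P *m psi.
have -> : sesq 1%:M psi psi = sesq 1%:M phi phi.
  by rewrite /sesq !mulmx1 /phi adjmxM mulmxA -[_ *m P]mulmxA unitarymxPl // mulmx1.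
have -> : sesq (P^t* *m diag_mx s *m P) psi psi = sesq (diag_mx s) phi phi.
  by rewrite /sesq /phi adjmxM !mulmxA.
have -> : sesq (diag_mx s) phi phi = \sum_i s 0 i * `|phi i 0| ^+ 2.
  rewrite /sesq mxE; apply: eq_bigr => i _; rewrite mul_mx_diag !mxE.
  by rewrite normCKC mulrCA mulrA.
rewrite sesq1E mulr_sumr; apply: ler_sum => i _; apply: ler_wpM2r.
  by rewrite exprn_ge0.
rewrite -[leRHS]invrK lef_pV2 ?posrE ?invr_gt0 //.
rewrite (bigD1 i) //= addrCA lerDl addr_ge0 //; apply: sumr_ge0 => j _.
by rewrite invr_ge0 ltW.
Qed.

Lemma sesq_bound X psi : `|sesq X psi psi| <=
  (\sum_i \sum_j `|X i j|) * sesq 1%:M psi psi.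
Proof.
set S := sesq 1%:M _ _; have S0 : 0 <= S by exact: sesq1_ge0.
have le_psi i : `|psi i 0| ^+ 2 <= S.
  rewrite /S sesq1E (bigD1 i) //= lerDl; apply: sumr_ge0 => j _.
  exact: exprn_ge0.
have -> : sesq X psi psi = \sum_i \sum_j (psi i 0)^* * X i j * psi j 0.
  rewrite /sesq mxE exchange_big; apply: eq_bigr => j _.
  by rewrite mxE mulr_suml; apply: eq_bigr => i _; rewrite !mxE.
apply: le_trans (ler_norm_sum _ _ _) _; rewrite mulr_suml; apply: ler_sum => i _.
apply: le_trans (ler_norm_sum _ _ _) _; rewrite mulr_suml; apply: ler_sum => j _.
rewrite !normrM norm_conjC mulrAC mulrC ler_wpM2l //.
rewrite -(@ler_pXn2r _ 2) ?nnegrE ?mulr_ge0 // exprMn [S ^+ 2]expr2.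
by apply: ler_pM => //; exact: exprn_ge0.
Qed.

End PositiveMatrices.

Section Irreducible.
Context {R : realType} {d k : nat}.
Local Notation C := R[i].
Implicit Types V : 'M[C]_(d * k, d).

Lemma sesqD (A B : 'M[C]_d) x y : sesq (A + B) x y = sesq A x y + sesq B x y.
Proof. by rewrite /sesq mulmxDr mulmxDl mxE. Qed.

Lemma sesqZ (a : C) (A : 'M[C]_d) x y : sesq (a *: A) x y = a * sesq A x y.
Proof. by rewrite /sesq -scalemxAr -scalemxAl mxE. Qed.

Lemma posdef_trace_gt0 (rho : 'M[C]_d) : (0 < d)%N -> posdef rho -> 0 < \tr rho.
Proof.
move=> d0 prho; rewrite /mxtrace.
have H i : 0 < rho i i.
  rewrite -sesq_delta; apply: prho; apply/eqP => /matrixP/(_ i 0).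
  by rewrite !mxE !eqxx => /eqP; rewrite oner_eq0.
by rewrite (bigD1 (Ordinal d0)) //= ltr_pwDl // sumr_ge0 // => i _; rewrite ltW.
Qed.

(** Uniqueness is assumed only among states. Since [rho] is positive definite, [rho + a *: X] is
    still positive for small [a]; after normalization it is a stationary state, hence [rho] itself,
    and [X] is a multiple of [rho]. *)
Lemma irreducible_fixed_hermitian V rho X : posdef rho ->
  stationary_states V = [set rho] ->
  X^t* = X -> predual V X = X -> X = \tr X *: rho.
Proof.
move=> prho sV hX fX.
have [[_ tr1] frho] : stationary_states V rho by rewrite sV.
have d0 : (0 < d)%N.
  by rewrite lt0n; apply: contra_eq_neq tr1; move=> d0; subst d; rewrite /mxtrace big_ord0 eq_sym oner_eq0.
have [e e0 He] := posdef_coercive prho.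
pose M := \sum_i \sum_j `|X i j|.
have M0 : 0 <= M by apply: sumr_ge0 => i _; apply: sumr_ge0.
(* With this value [a * M < e], so the coercivity of [rho] absorbs the perturbation; the 1 covers
   [M = 0]. *)
pose a := e / (M + 1).
have M1 : 0 < M + 1 by rewrite ltr_wpDl.
have a0 : 0 < a by rewrite divr_gt0.
have pX : posdef (rho + a *: X).
  move=> psi psi0; rewrite -/(sesq _ _ _) sesqD sesqZ.
  have S0 := sesq1_gt0 psi0.
  have rX : sesq X psi psi \is Num.real.
    by apply/CrealP; rewrite -sesq_conj hX.
  have := sesq_bound X psi; rewrite real_ler_norml // => /andP[H _].
  apply: (@lt_le_trans _ _ (e * sesq 1%:M psi psi - a * (M * sesq 1%:M psi psi))).
    rewrite mulrA -mulrBl mulr_gt0 // subr_gt0 /a mulrAC ltr_pdivrMr // ltr_pM2l //.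
    by rewrite ltrDl.
  by apply: lerD => //; rewrite -mulrN ler_wpM2l // ltW.
have t0 := posdef_trace_gt0 d0 pX.
set t := \tr _ in t0.
have : stationary_states V (t^-1 *: (rho + a *: X)).
  split; last by rewrite linearZ linearD linearZ /= frho fX.
  split; last by rewrite linearZ /= mulVf ?gt_eqF.
  move=> psi; rewrite -/(sesq _ _ _) sesqZ; apply: mulr_ge0.
    by rewrite invr_ge0 ltW.
  exact: posdef_ge0 pX.
rewrite sV => /(congr1 (fun Y => t *: Y)); rewrite scalerA mulfV ?gt_eqF // scale1r.
have -> : t = 1 + a * \tr X by rewrite /t linearD linearZ /= tr1.
rewrite scalerDl scale1r => /addrI; rewrite -scalerA => /scalerI; apply.
by rewrite gt_eqF.
Qed.

(** The predual commutes with the adjoint, so the Hermitian and anti-Hermitian parts of [X] are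
    fixed separately. *)
Lemma irreducible_fixed V rho X : posdef rho -> stationary_states V = [set rho] ->
  predual V X = X -> X = \tr X *: rho.
Proof.
move=> prho sV fX.
have fXa : predual V (X^t*) = X^t* by rewrite -adj_predual fX.
have H1 := @irreducible_fixed_hermitian V rho (X + X^t*) prho sV.
have H2 := @irreducible_fixed_hermitian V rho ('i *: (X - X^t*)) prho sV.
have {}H1 : X + X^t* = \tr (X + X^t*) *: rho.
  by apply: H1; [rewrite adjmxD trmxCK addrC|rewrite linearD /= fX fXa].
have {}H2 : 'i *: (X - X^t*) = \tr ('i *: (X - X^t*)) *: rho.
  apply: H2; last by rewrite linearZ linearB /= fX fXa.
  by rewrite adjmxZ adjmxB trmxCK conjCi scaleNr -scalerN opprB.
move: H2; rewrite [in RHS]linearZ /= -scalerA => /(scalerI (neq0Ci _)) H2.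
have : X + X = \tr (X + X) *: rho.
  have -> : X + X = (X + X^t*) + (X - X^t*) by rewrite addrACA subrr addr0.
  by rewrite [in LHS]H1 [in LHS]H2 -scalerDl -linearD.
rewrite linearD /= scalerDl => e.
by apply: (@scalerI _ _ (2 : C)); rewrite ?pnatr_eq0 // !scaler_nat !mulr2n.
Qed.

Lemma irreducible_dim V : irreducible V -> (0 < d)%N.
Proof.
move=> [rho _ sV]; have [[_ tr1] _] : stationary_states V rho by rewrite sV.
rewrite lt0n; apply: contra_eq_neq tr1; move=> d0; subst d.
by rewrite /mxtrace big_ord0 eq_sym oner_eq0.
Qed.

(** A fixed point of the channel is an eigenvector with eigenvalue 1, so it commutes with the Kraus
    operators. Then [X *m rho] is fixed by the predual, hence a multiple of [rho], and [rho] is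
    invertible. *)
Lemma irreducible_channel_fixed V X : isometry V -> irreducible V ->
  channel V X = X -> exists a, X = a%:M.
Proof.
move=> iV [rho prho sV] fX.
have [_ frho] : stationary_states V rho by rewrite sV.
have [->|X0] := eqVneq X 0; first by exists 0; rewrite raddf0.
have [||_ XK] := mixed_eigenvector iV prho frho (_ : mixed V V X = 1 *: X) X0.
- by rewrite scale1r.
- by rewrite normr1.
have : predual V (X *m rho) = X *m rho.
  rewrite -[in RHS]frho !predualE mulmx_sumr; apply: eq_bigr => i _.
  by have := XK i; rewrite scale1r !mulmxA => ->.
move=> /(irreducible_fixed prho sV); move: (\tr _) => a e; exists a.
move/(congr1 (mulmx^~ (invmx rho))): e; rewrite mulmxK ?posdef_unit // => ->.
by rewrite -scalemxAl mulmxV ?posdef_unit // scalemx1.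
Qed.

Lemma mixed_equiv V1 V2 X (l : C) :
  isometry V1 -> isometry V2 -> irreducible V1 ->
  mixed V2 V1 X = l *: X -> X != 0 -> 1 <= `|l| -> same_orbit V1 V2.
Proof.
move=> i1 i2 I1 eX X0 l1; have [rho prho sV] := I1.
have [_ frho] : stationary_states V1 rho by rewrite sV.
have [nl XK] := mixed_eigenvector i2 prho frho eX X0 l1.
have l0 : l != 0 by rewrite -normr_eq0 nl oner_eq0.
have [a Xa] : exists a, X^t* *m X = a%:M.
  apply: (irreducible_channel_fixed i1 I1).
  have -> : X^t* *m X = X^t* *m (\sum_i (kraus V2 i)^t* *m kraus V2 i) *m X.
    by rewrite isometryE // mulmx1.
  rewrite {1}isometryE // mulmx1 channelE mixedE mulmx_sumr mulmx_suml.
  apply: eq_bigr => i _.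
  transitivity ((X *m kraus V1 i)^t* *m (X *m kraus V1 i)).
    by rewrite adjmxM !mulmxA.
  rewrite XK adjmxZ -scalemxAl -scalemxAr scalerA mulrC -normCK nl expr1n scale1r.
  by rewrite adjmxM !mulmxA.
have a0 : 0 < a.
  have d0 := irreducible_dim I1.
  have ea : a = \sum_j `|X j (Ordinal d0)| ^+ 2.
    have := congr1 (fun M : 'M[C]_d => M (Ordinal d0) (Ordinal d0)) Xa.
    rewrite !mxE eqxx mulr1n => <-; apply: eq_bigr => j _.
    by rewrite !mxE normCKC.
  rewrite lt0r {2}ea sumr_ge0 => [|j _]; last exact: exprn_ge0.
  rewrite andbT; apply: contraNneq X0 => a0; apply/eqP.
  have [_] := posdef_trace_eq0 X prho; apply.
  by rewrite Xa a0 raddf0 mulmx0 mxtrace0.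
pose W := (sqrtC a)^-1 *: X.
have sa0 : sqrtC a != 0 by rewrite sqrtC_eq0 gt_eqF.
have WW : W^t* *m W = 1%:M.
  rewrite adjmxZ -scalemxAl -scalemxAr scalerA Xa.
  have /CrealP -> : (sqrtC a)^-1 \is Num.real.
    by apply: ger0_real; rewrite invr_ge0 sqrtC_ge0 ltW.
  by rewrite scale_scalar_mx -invfM -expr2 sqrtCK mulVf ?gt_eqF.
have WW' : W *m W^t* = 1%:M by apply: mulmx1C.
exists l, W; split => //; first exact/unitarymxP.
apply: kraus_inj => i; rewrite kraus_gauge.
have -> : W *m kraus V1 i = l *: (kraus V2 i *m W).
  by rewrite /W -scalemxAl XK -scalemxAr !scalerA mulrC.
rewrite -scalemxAl -mulmxA WW' mulmx1 scalerA mulrC -normCK nl expr1n.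
by rewrite scale1r.
Qed.

End Irreducible.

(** * Output equivalence and gauge orbits *)

Section UnitaryConjugation.
Context {C : numClosedFieldType} {d : nat}.
Implicit Types (A B W rho : 'M[C]_d).

Definition uconj W A := W *m A *m W^t*.

Lemma uconjM W A B : W \is unitarymx -> uconj W A *m uconj W B = uconj W (A *m B).
Proof.
move=> uW; rewrite /uconj !mulmxA; congr (_ *m _ *m _).
by rewrite -mulmxA (unitarymxPl uW) mulmx1.
Qed.

Lemma uconj_adj W A : (uconj W A)^t* = uconj W (A^t*).
Proof. by rewrite /uconj adjmxM adjmxM trmxCK mulmxA. Qed.

Lemma uconj_sum W (I : finType) (F : I -> 'M[C]_d) :
  uconj W (\sum_i F i) = \sum_i uconj W (F i).
Proof. by rewrite /uconj mulmx_sumr mulmx_suml. Qed.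

Lemma uconj1 W : W \is unitarymx -> uconj W 1%:M = 1%:M.
Proof. by move=> /unitarymxP WW; rewrite /uconj mulmx1. Qed.

Lemma uconj_trace W A : W \is unitarymx -> \tr (uconj W A) = \tr A.
Proof. by move=> uW; rewrite /uconj mxtrace_mulC mulmxA (unitarymxPl uW) mul1mx. Qed.

Lemma uconjK W A : W \is unitarymx -> uconj (W^t*) (uconj W A) = A.
Proof.
move=> uW; rewrite /uconj trmxCK !mulmxA (unitarymxPl uW) mul1mx.
by rewrite -mulmxA (unitarymxPl uW) mulmx1.
Qed.

Lemma uconj_phase_sandwich W (c : C) A rho B : `|c| = 1 -> W \is unitarymx ->
  (c *: uconj W A) *m uconj W rho *m (c *: uconj W B)^t* =
  uconj W (A *m rho *m B^t*).
Proof.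
move=> nc uW; rewrite adjmxZ uconj_adj -scalemxAr -!scalemxAl scalerA mulrC -normCK nc.
by rewrite expr1n scale1r !uconjM.
Qed.

Lemma uconj_phase_adj W (c : C) A B : `|c| = 1 -> W \is unitarymx ->
  (c *: uconj W A)^t* *m (c *: uconj W B) = uconj W (A^t* *m B).
Proof.
move=> nc uW; rewrite adjmxZ uconj_adj -scalemxAr -scalemxAl scalerA -normCK nc.
by rewrite expr1n scale1r uconjM.
Qed.

Lemma uconjB W A B : uconj W (A - B) = uconj W A - uconj W B.
Proof. by rewrite /uconj mulmxBr mulmxBl. Qed.

Lemma uconjZ W (a : C) A : uconj W (a *: A) = a *: uconj W A.
Proof. by rewrite /uconj -scalemxAr -scalemxAl. Qed.

Lemma uconj_commutator W A B (a b : C) : W \is unitarymx ->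
  b *: uconj W (A *m B - B *m A - a *: B) =
  uconj W A *m (b *: uconj W B) - (b *: uconj W B) *m uconj W A - a *: (b *: uconj W B).
Proof.
move=> uW; rewrite uconjB uconjB uconjZ -(uconjM A B uW) -(uconjM B A uW).
rewrite -scalemxAr -scalemxAl (scalerA a b) (mulrC a b) -(scalerA b a).
by rewrite scalerBr scalerBr.
Qed.

End UnitaryConjugation.

Section Gauge.
Context {R : realType} {d k : nat}.
Local Notation C := R[i].
Implicit Types V : 'M[C]_(d * k, d).

Lemma kraus_gauge_uconj (c : C) W V i :
  kraus (gauge c W V) i = c^* *: uconj W (kraus V i).
Proof. exact: kraus_gauge. Qed.

Lemma gauge_isometry (c : C) W V : `|c| = 1 -> W \is unitarymx ->
  isometry V -> isometry (gauge c W V).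
Proof.
move=> nc uW /isometryE iV; rewrite /isometry adj_kraus_sum -(uconj1 uW) -iV.
rewrite uconj_sum; apply: eq_bigr => i _; rewrite kraus_gauge_uconj.
by rewrite uconj_phase_adj ?norm_conjC.
Qed.

Lemma predual_gauge (c : C) W V rho : `|c| = 1 -> W \is unitarymx ->
  predual (gauge c W V) (uconj W rho) = uconj W (predual V rho).
Proof.
move=> nc uW; rewrite !predualE uconj_sum; apply: eq_bigr => i _.
by rewrite kraus_gauge_uconj uconj_phase_sandwich ?norm_conjC.
Qed.

Lemma sesq_conjugate (W A : 'M[C]_d) psi :
  sesq (uconj W A) psi psi = sesq A (W^t* *m psi) (W^t* *m psi).
Proof. by rewrite /sesq /uconj adjmxM trmxCK !mulmxA. Qed.

Lemma conjugate_state (W rho : 'M[C]_d) : W \is unitarymx ->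
  is_state rho -> is_state (uconj W rho).
Proof.
move=> uW [p t]; split => [psi|]; last by rewrite uconj_trace.
by rewrite -/(sesq _ _ _) sesq_conjugate; exact: p.
Qed.

Lemma conjugate_stationary (c : C) W V rho : `|c| = 1 -> W \is unitarymx ->
  stationary_states V rho -> stationary_states (gauge c W V) (uconj W rho).
Proof.
move=> nc uW [s f]; split; first exact: conjugate_state.
by rewrite predual_gauge // f.
Qed.

Lemma gaugeK (c : C) W V : `|c| = 1 -> W \is unitarymx ->
  gauge c^* (W^t*) (gauge c W V) = V.
Proof.
by move=> nc uW; rewrite gauge_gauge (unitarymxPl uW) mulrC -normCK nc expr1n gauge1.
Qed.

Lemma stationary_gauge (c : C) W V rho : `|c| = 1 -> W \is unitarymx ->
  stationary_states V = [set rho] ->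
  stationary_states (gauge c W V) = [set uconj W rho].
Proof.
move=> nc uW sV; apply/seteqP; split=> [s|_ ->].
  have uW' : W^t* \is unitarymx by rewrite trmxC_unitary.
  have nc' : `|c^*| = 1 by rewrite norm_conjC.
  move/(conjugate_stationary nc' uW'); rewrite gaugeK // sV => /= <-.
  by have := uconjK s uW'; rewrite trmxCK /= => ->.
by apply: conjugate_stationary => //; rewrite sV.
Qed.

Lemma gauge_irreducible (c : C) W V : `|c| = 1 -> W \is unitarymx ->
  irreducible V -> irreducible (gauge c W V).
Proof.
move=> nc uW [rho prho sV]; exists (uconj W rho); last exact: stationary_gauge.
move=> psi psi0; rewrite -/(sesq _ _ _) sesq_conjugate; apply: prho.
apply: contra_neq psi0 => e; have /unitarymxP WW := uW.
by rewrite -[psi]mul1mx -WW -mulmxA e mulmx0.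
Qed.

Lemma rho_ssE V rho : stationary_states V = [set rho] -> rho_ss V = rho.
Proof. by rewrite /rho_ss => ->; apply: (@xget_unique _ 0 [set rho]). Qed.

Lemma kraus_word_cons V i w : kraus_word V (i :: w) = kraus_word V w *m kraus V i.
Proof.
have H (A : 'M[C]_d) s : foldl (fun A i => kraus V i *m A) A s = kraus_word V s *m A.
  elim: s A => [|j s IH] A /=; first by rewrite mul1mx.
  rewrite IH -[kraus_word V (j :: s)]/(foldl (fun A i => kraus V i *m A) (kraus V j *m 1%:M) s).
  by rewrite IH mulmx1 mulmxA.
by rewrite -[LHS]/(foldl (fun A i => kraus V i *m A) (kraus V i *m 1%:M) w) H mulmx1.
Qed.

Lemma kraus_word_gauge (c : C) W V w : W \is unitarymx ->
  kraus_word (gauge c W V) w = (c^*) ^+ size w *: uconj W (kraus_word V w).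
Proof.
move=> uW; elim: w => [|i w IH].
  by rewrite expr0 scale1r uconj1.
rewrite !kraus_word_cons IH kraus_gauge_uconj.
move: (kraus V i) (kraus_word V w) (c^*) => A B b.
by rewrite -scalemxAl -scalemxAr scalerA -exprSr uconjM.
Qed.

Lemma rho_outE V n a b : rho_out V n a b =
  \tr (kraus_word V (enum_val a) *m rho_ss V *m (kraus_word V (enum_val b))^t*).
Proof.
rewrite mxE /mxtrace; apply: eq_bigr => r _; rewrite !mxE; apply: eq_bigr => s _.
rewrite !mxE mxtens_indexK; congr (_ * _); apply: eq_bigr => t _.
by rewrite !mxE mxtens_indexK.
Qed.

(** The stationary state is conjugated along with the Kraus words, and the phases cancel because
    both words of an entry have length [n]. *)
Lemma same_orbit_output V1 V2 : irreducible V1 -> same_orbit V1 V2 ->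
  output_equivalent V1 V2.
Proof.
move=> [rho prho sV] [c [W [nc uW ->]]] n; apply/matrixP => a b.
rewrite [RHS]rho_outE (rho_ssE (stationary_gauge nc uW sV)) rho_outE (rho_ssE sV).
rewrite !kraus_word_gauge // !size_tuple.
by rewrite uconj_phase_sandwich ?uconj_trace // normrX norm_conjC nc expr1n.
Qed.

End Gauge.

(** * Geometric decay of the powers of a matrix with spectrum in the open unit disc *)

Section Decay.
Context {R : realType}.
Local Notation C := R[i].

Definition decays n (M : 'M[C]_n) (v : 'rV[C]_n) := exists c q : C,
  [/\ 0 <= c, 0 <= q < 1 & forall t i, `|(iter t (mulmxr M) v) 0 i| <= c * q ^+ t].

(** The orbit of [v] satisfies a scalar recursion with ratio [l] and a source term that decays by
    hypothesis. *)
Lemma decays_step n (M : 'M[C]_n) (l : C) v : `|l| < 1 ->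
  decays M (v *m M - l *: v) -> decays M v.
Proof.
move=> l1 [c [q [c0 /andP[q0 q1] H]]].
(* A rate below 1 and strictly above both [q] and [|l|]; the strictness absorbs the factor t that
   appears when the two coincide. *)
pose p : C := 1 - (1 - q) * (1 - `|l|) / 2.
have l0 : 0 < 1 - `|l| by rewrite subr_gt0.
have q0' : 0 < 1 - q by rewrite subr_gt0.
have pl : p - `|l| = (1 - `|l|) * (1 + q) / 2 by rewrite /p; field.
have pq : p - q = (1 - q) * (1 + `|l|) / 2 by rewrite /p; field.
have pl0 : 0 < p - `|l| by rewrite pl !mulr_gt0 ?invr_gt0 // ltr_pwDl.
have pq0 : 0 < p - q by rewrite pq !mulr_gt0 ?invr_gt0 // ltr_pwDl.
have p1 : p < 1 by rewrite -subr_gt0 /p opprB addrC subrK !mulr_gt0 ?invr_gt0.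
have lep : q <= p by rewrite -subr_ge0 ltW.
have p0 : 0 <= p by exact: le_trans q0 lep.
(* The first summand starts the induction; the second makes [c' * (p - |l|) >= c], which is what the
   recursion needs. *)
pose c' := \sum_j `|v 0 j| + c / (p - `|l|).
have s0 : 0 <= \sum_j `|v 0 j| by apply: sumr_ge0.
have c'0 : 0 <= c' by rewrite addr_ge0 // divr_ge0 // ltW.
exists c', p; split => [//||t i]; first by rewrite p0.
have step s : iter s.+1 (mulmxr M) v = l *: iter s (mulmxr M) v +
    iter s (mulmxr M) (v *m M - l *: v).
  elim: s => [|s IH]; first by rewrite /= addrC subrK.
  by rewrite iterS [in LHS]IH /= mulmxDl -scalemxAl.
elim: t => [|t IH].
  rewrite expr0 mulr1 /=; apply: (@le_trans _ _ (\sum_j `|v 0 j|)).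
    by rewrite (bigD1 i) //= lerDl; apply: sumr_ge0.
  by rewrite lerDl divr_ge0 // ltW.
rewrite step mxE [X in `|X + _|]mxE; apply: le_trans (ler_normD _ _) _.
rewrite normrM; apply: (@le_trans _ _ (`|l| * (c' * p ^+ t) + c * p ^+ t)).
  apply: lerD; first by rewrite ler_wpM2l.
  apply: le_trans (H t i) _; rewrite ler_wpM2l //.
  by apply: lerXn2r; rewrite ?nnegrE.
rewrite exprS mulrCA !mulrA -mulrDl ler_wpM2r ?exprn_ge0 //.
rewrite -subr_ge0 [X in 0 <= X](_ : _ = c' * (p - `|l|) - c); last by ring.
rewrite /c' mulrDl divfK ?gt_eqF // addrK.
by apply: mulr_ge0 => //; exact: ltW.
Qed.

(** By Cayley-Hamilton the product of the factors M - z over the eigenvalues kills [v]. Removing the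
    factors one at a time with [decays_step] avoids Jordan forms. *)
Lemma decays_eigenvalue n (M : 'M[C]_n) :
  (forall l, eigenvalue M l -> `|l| < 1) -> forall v, decays M v.
Proof.
case: n M => [|n] M H v.
  exists 0, 0; split => //; first by rewrite lexx ltr01.
  by move=> t [].
have [rs cp] := closed_field_poly_normal (char_poly M).
have /monicP lc := char_poly_monic M; rewrite lc scale1r in cp.
have Hrs z : z \in rs -> `|z| < 1.
  by move=> zrs; apply: H; rewrite eigenvalue_root_char cp root_prod_XsubC.
have : v *m horner_mx M (\prod_(z <- rs) ('X - z%:P)) = 0.
  by rewrite -cp Cayley_Hamilton mulmx0.
elim: rs v {cp} Hrs => [|z rs IH] v Hrs.
  rewrite big_nil rmorph1 mulmx1 => ->; exists 0, 0; split => //.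
    by rewrite lexx ltr01.
  move=> t i; rewrite mul0r (_ : iter t _ 0 = 0) ?mxE ?normr0 //.
  by elim: t => //= t ->; rewrite mul0mx.
rewrite big_cons rmorphM /= mulmxA rmorphB /= horner_mx_X horner_mx_C => e.
apply: (@decays_step _ _ z); first by apply: Hrs; rewrite mem_head.
apply: IH; first by move=> y yrs; apply: Hrs; rewrite in_cons yrs orbT.
by rewrite -mul_mx_scalar -mulmxBr.
Qed.

Lemma decays_near n (M : 'M[C]_n) v (e : R) : decays M v -> 0 < e ->
  \forall t \near \oo, forall i, `|(iter t (mulmxr M) v) 0 i| <= e%:C.
Proof.
move=> [c [q [c0 /andP[q0 q1] H]]] e0.
have /complex_realP[c' ec] := ger0_real c0.
have /complex_realP[q' eq] := ger0_real q0.
rewrite ec eq in c0 q0 q1 H; move: c' q' c0 q0 q1 H {ec eq} => {}c {}q.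
rewrite !ler0c => c0 q0; rewrite -[1]/(1%:C) ltcR => q1 H.
have : (fun t => c * q ^+ t) @ \oo --> c * 0.
  by apply: cvgMr; apply: cvg_expr; rewrite ger0_norm.
rewrite mulr0 => /cvgrPdist_lt /(_ e e0); apply: filterS => t Ht i.
apply: le_trans (H t i) _; rewrite -rmorphXn -rmorphM lecR.
move: Ht; rewrite sub0r normrN ger0_norm; first exact: ltW.
by rewrite mulr_ge0 // exprn_ge0.
Qed.

End Decay.

Section OutputEquivalence.
Context {R : realType} {d k : nat}.
Local Notation C := R[i].
Implicit Types V : 'M[C]_(d * k, d).

Lemma mixed_iter V2 V1 n X : iter n (mixed V2 V1) X =
  \sum_(w : n.-tuple 'I_k) (kraus_word V2 w)^t* *m X *m kraus_word V1 w.
Proof.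
elim: n => [|n IH].
  rewrite (big_pred1 [tuple]) => [|w]; last exact/esym/eqP/tuple0.
  by rewrite /kraus_word /= adjmx_scalar rmorph1 mul1mx mulmx1.
rewrite iterS IH mixedE.
rewrite (reindex (fun p : 'I_k * n.-tuple 'I_k => cons_tuple p.1 p.2)) /=; last first.
  exists (fun w => (thead w, behead_tuple w)) => [[i w] _|w _] /=.
    by rewrite theadE; congr (_, _); exact: val_inj.
  by rewrite [RHS]tuple_eta; exact: val_inj.
rewrite -(pair_bigA _ (fun i (w : n.-tuple 'I_k) =>
  (kraus_word V2 (i :: w))^t* *m X *m kraus_word V1 (i :: w))) /=.
apply: eq_bigr => i _; rewrite mulmx_sumr mulmx_suml; apply: eq_bigr => w _.
rewrite !kraus_word_cons.
move: (kraus V2 i) (kraus V1 i) (kraus_word V2 w) (kraus_word V1 w) => A A' B B'.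
by rewrite adjmxM !mulmxA.
Qed.

(** A factor of the output state: with [rho_ss V = Q Q^*], this matrix times its adjoint is
    [rho_out V n]. The columns are the entries of a d x d matrix, so their number does not grow with
    [n]. *)
Definition word_mx V (Q : 'M[C]_d) n : 'M[C]_(#|{: n.-tuple 'I_k}|, d * d) :=
  \matrix_(w, x) (kraus_word V (enum_val w : n.-tuple 'I_k) *m Q) (mxtens_unindex x).1 (mxtens_unindex x).2.

Lemma rho_out_word_mx V Q n : rho_ss V = Q *m Q^t* ->
  rho_out V n = word_mx V Q n *m (word_mx V Q n)^t*.
Proof.
move=> e; apply/matrixP => a b; rewrite rho_outE e.
set Ka := kraus_word V (enum_val a); set Kb := kraus_word V (enum_val b).
rewrite mulmxA -mulmxA -adjmxM mxE big_tens /mxtrace; apply: eq_bigr => r _.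
rewrite mxE; apply: eq_bigr => s _; rewrite ![word_mx _ _ _ _ _]mxE.
rewrite [((word_mx _ _ _)^t*) _ _]mxE [((word_mx _ _ _)^T) _ _]mxE [word_mx _ _ _ _ _]mxE.
by rewrite mxtens_indexK /= -/Ka -/Kb [((Kb *m Q)^t*) _ _]mxE [((Kb *m Q)^T) _ _]mxE.
Qed.

(** The overlaps of two outputs are matrix entries of iterates of the mixed operator on matrix
    units, so they inherit its decay. *)
Lemma word_mx_adj V2 Q2 V1 Q1 n r a s b :
  ((word_mx V2 Q2 n)^t* *m word_mx V1 Q1 n) (mxtens_index (r, a)) (mxtens_index (s, b)) =
  (Q2^t* *m iter n (mixed V2 V1) (delta_mx r s) *m Q1) a b.
Proof.
rewrite mixed_iter mulmx_sumr mulmx_suml summxE mxE.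
rewrite [RHS](reindex (fun w : 'I_#|{: n.-tuple 'I_k}| => enum_val w)) /=; last first.
  by exists enum_rank => w _; [exact: enum_valK|exact: enum_rankK].
apply: eq_bigr => w _; rewrite [((word_mx _ _ _)^t*) _ _]mxE [((word_mx _ _ _)^T) _ _]mxE.
rewrite ![word_mx _ _ _ _ _]mxE !mxtens_indexK /=.
move: (kraus_word V2 _) (kraus_word V1 _) => A B.
rewrite !mulmxA -adjmxM -(mulmxA _ B) -mulmxA.
move: (A *m Q2) (B *m Q1) => {}A {}B.
rewrite mxE (bigD1 r) //= big1 => [|j jr]; last first.
  rewrite [(delta_mx r s *m B) j b]mxE big1 ?mulr0 // => i _.
  by rewrite mxE (negPf jr) mul0r.
rewrite addr0 [(delta_mx r s *m B) r b]mxE (bigD1 s) //= big1 => [|j js]; last first.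
  by rewrite mxE (negPf js) andbF mul0r.
by rewrite !mxE !eqxx mul1r addr0.
Qed.

Lemma mxtrace_adj_mul m n (M : 'M[C]_(m, n)) :
  \tr (M^t* *m M) = \sum_x \sum_y `|M x y| ^+ 2.
Proof.
rewrite exchange_big; apply: eq_bigr => y _; rewrite mxE; apply: eq_bigr => x _.
by rewrite !mxE normCKC.
Qed.

Lemma trace_rho_out V n : isometry V -> \tr (rho_ss V) = 1 -> \tr (rho_out V n) = 1.
Proof.
move=> iV t1.
have e : iter n (mixed V V) 1%:M = 1%:M.
  by elim: n => //= n ->; rewrite -channelE channel1.
rewrite -{}t1 -[in RHS](mulmx1 (rho_ss V)) -e mixed_iter mulmx_sumr linear_sum.
rewrite [RHS](reindex (fun w : 'I_#|{: n.-tuple 'I_k}| => enum_val w)) /=; last first.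
  by exists enum_rank => w _; [exact: enum_valK|exact: enum_rankK].
apply: eq_bigr => w _; rewrite rho_outE mulmx1 mulmxA.
by rewrite [RHS]mxtrace_mulC mulmxA.
Qed.

(** If the entries of [X] are small, the Hilbert-Schmidt norm of [G] is at most [D * c]. Each
    diagonal entry of [G] obeys the same bound, and [D] of them must add up to 1. *)
Lemma gram_trace_bound D (G X : 'M[C]_D) (c : C) : 0 <= c -> \tr G = 1 ->
  \tr (G^t* *m G) = \tr (X^t* *m X) -> (forall x y, `|X x y| <= c) ->
  1 <= D%:R * (D%:R * c).
Proof.
move=> c0 trG GX Xc.
have Gbound x : `|G x x| <= D%:R * c.
  have Dc0 : 0 <= D%:R * c by apply: mulr_ge0.
  rewrite -(@ler_pXn2r _ 2) ?nnegrE //.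
  apply: (@le_trans _ _ (\tr (G^t* *m G))).
    rewrite mxtrace_adj_mul (bigD1 x) //= (bigD1 x) //= -addrA lerDl addr_ge0 //.
      by apply: sumr_ge0 => y _; rewrite exprn_ge0.
    by apply: sumr_ge0 => y _; apply: sumr_ge0 => z _; rewrite exprn_ge0.
  rewrite GX mxtrace_adj_mul exprMn.
  apply: (@le_trans _ _ (\sum_(x < D) \sum_(y < D) c ^+ 2)).
    apply: ler_sum => y _; apply: ler_sum => z _.
    by apply: lerXn2r; rewrite ?nnegrE.
  have nn (p : nat) (z : C) : z *+ p *+ p = p%:R ^+ 2 * z.
    by rewrite expr2 -mulrA !mulr_natl.
  by rewrite !sumr_const !card_ord nn.
apply: (@le_trans _ _ `|\tr G|); first by rewrite trG normr1.
apply: le_trans (ler_norm_sum _ _ _) _.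
apply: (@le_trans _ _ (\sum_(x < D) D%:R * c)); first exact: ler_sum.
by rewrite sumr_const card_ord [leRHS]mulr_natl.
Qed.

Theorem output_equivalent_same_orbit V1 V2 :
  isometry V1 -> irreducible V1 -> isometry V2 -> irreducible V2 ->
  output_equivalent V1 V2 -> same_orbit V1 V2.
Proof.
move=> i1 I1 i2 I2 eqout; apply: contrapT => Nso.
have [rho1 p1 s1] := I1; have [rho2 p2 s2] := I2.
have [Q1 q1] := posdef_factor p1; have [Q2 q2] := posdef_factor p2.
have r1 := rho_ssE s1; have r2 := rho_ssE s2.
have tr1 : \tr rho1 = 1.
  by have [[_ ->]] : stationary_states V1 rho1 by rewrite s1.
have small l : eigenvalue (lin_mx (mixed V2 V1)) l -> `|l| < 1.
  move=> /eigenvalueP[v ve v0]; rewrite real_ltNge ?normr_real ?real1 //.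
  apply/negP => l1; apply: Nso.
  apply: (@mixed_equiv _ _ _ V1 V2 (vec_mx v) l) => //; last first.
    by apply: contra_neq v0 => e; rewrite -[v]vec_mxK e linear0.
  apply: (can_inj mxvecK); rewrite -mul_vec_lin vec_mxK ve linearZ /=.
  by rewrite vec_mxK.
pose B : C := (\sum_i \sum_a `|Q2 i a|) * (\sum_j \sum_b `|Q1 j b|).
have B0 : 0 <= B.
  by apply: mulr_ge0; apply: sumr_ge0 => i _; apply: sumr_ge0.
have /complex_realP[b eB] := ger0_real B0.
pose D : nat := (d * d)%N.
(* Chosen so that [D^2 * b * eta < 1], contradicting [gram_trace_bound] with entries bounded by
   [eta * b]. *)
pose eta : R := (D%:R * (D%:R * b) + 1)^-1.
have b0 : 0 <= b by rewrite eB ler0c in B0.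
have eta0 : 0 < eta by rewrite invr_gt0 ltr_wpDl // !mulr_ge0.
have itE n X : mxvec (iter n (mixed V2 V1) X) =
    iter n (mulmxr (lin_mx (mixed V2 V1))) (mxvec X).
  by elim: n => //= n <-; rewrite mul_vec_lin.
have dec : \forall n \near \oo, forall r s i j : 'I_d,
    `|iter n (mixed V2 V1) (delta_mx r s) i j| <= eta%:C.
  apply: filter_forall => r; apply: filter_forall => s.
  have := decays_near (decays_eigenvalue small (mxvec (delta_mx r s))) eta0.
  apply: filterS => n H i j; have := H (mxvec_index i j).
  by rewrite -itE mxvecE.
have [n _ /(_ n (leqnn n)) Hn] := dec.
set A1 := word_mx V1 Q1 n; set A2 := word_mx V2 Q2 n.
have o1 : rho_out V1 n = A1 *m A1^t* by apply: rho_out_word_mx; rewrite r1.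
have o2 : rho_out V2 n = A2 *m A2^t* by apply: rho_out_word_mx; rewrite r2.
have Cbound x y : `|(A2^t* *m A1) x y| <= eta%:C * B.
  case: (mxtens_indexP x) => r a; case: (mxtens_indexP y) => s c.
  rewrite word_mx_adj; move: (iter _ _ _) (Hn r s) => S HS.
  have -> : (Q2^t* *m S *m Q1) a c = \sum_j \sum_i (Q2 i a)^* * S i j * Q1 j c.
    rewrite mxE; apply: eq_bigr => j _; rewrite mxE mulr_suml.
    by apply: eq_bigr => i _; rewrite !mxE.
  apply: le_trans (ler_norm_sum _ _ _) _.
  rewrite /B mulrCA mulrA mulrC mulr_suml; apply: ler_sum => j _.
  apply: le_trans (ler_norm_sum _ _ _) _.
  apply: (@le_trans _ _ (\sum_i `|Q1 j c| * (`|Q2 i a| * eta%:C))).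
    apply: ler_sum => i _; rewrite !normrM norm_conjC mulrC ler_wpM2l //.
    by rewrite ler_wpM2l.
  rewrite -mulr_sumr -mulr_suml; apply: ler_pM => //.
  - by apply: mulr_ge0; [exact: sumr_ge0|rewrite ler0c ltW].
  - by rewrite (bigD1 c) //= lerDl sumr_ge0.
  - apply: ler_wpM2r; first by rewrite ler0c ltW.
    apply: ler_sum => i _.
    by rewrite (bigD1 a) //= lerDl sumr_ge0.
(* The Gram matrix has the nonzero spectrum of [rho_out V1 n] but the fixed size d^2, so the lower
   bound on the purity is uniform in [n]. *)
pose G := A1^t* *m A1.
have trG : \tr G = 1 by rewrite /G mxtrace_mulC -o1 trace_rho_out ?r1.
(* Equality of the outputs enters here: the trace of the square of the first output equals the trace
   of its product with the second. *)
have GC : \tr (G^t* *m G) = \tr ((A2^t* *m A1)^t* *m (A2^t* *m A1)).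
  rewrite /G !adjmxM !trmxCK.
  transitivity (\tr (rho_out V1 n *m rho_out V1 n)).
    by rewrite o1 mulmxA mxtrace_mulC !mulmxA.
  rewrite {2}(eqout n) o1 o2 [in RHS]mulmxA [RHS]mxtrace_mulC !mulmxA.
  by [].
have eB0 : 0 <= eta%:C * B by apply: mulr_ge0 B0; rewrite ler0c ltW.
have := gram_trace_bound eB0 trG GC Cbound.
rewrite eB -!(rmorph_nat (real_complex R)) -!rmorphM -[1]/(1%:C) lecR.
rewrite /eta -/D; have : 0 <= D%:R * (D%:R * b) by rewrite !mulr_ge0.
have -> : D%:R * (D%:R * ((D%:R * (D%:R * b) + 1)^-1 * b)) =
    D%:R * (D%:R * b) / (D%:R * (D%:R * b) + 1) by ring.
move: (D%:R * _) => E E0; rewrite ler_pdivlMr; last by rewrite ltr_wpDl.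
by rewrite mul1r gerDl ler10.
Qed.

End OutputEquivalence.

(** * Real coordinates *)

Section RealCoordinates.
Context {R : realType}.
Local Notation C := R[i].
Local Notation reC := (@complex.Re R).
Local Notation imC := (@complex.Im R).

Lemma ReCD (x y : C) : reC (x + y) = reC x + reC y.
Proof. by case: x y => ? ? []. Qed.

Lemma ImCD (x y : C) : imC (x + y) = imC x + imC y.
Proof. by case: x y => ? ? []. Qed.

Lemma ReCN (x : C) : reC (- x) = - reC x.
Proof. by case: x. Qed.

Lemma ImCN (x : C) : imC (- x) = - imC x.
Proof. by case: x. Qed.

Lemma ReCM (x y : C) : reC (x * y) = reC x * reC y - imC x * imC y.
Proof. by case: x y => ? ? []. Qed.

Lemma ImCM (x y : C) : imC (x * y) = reC x * imC y + imC x * reC y.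
Proof. by case: x y => ? ? []. Qed.

Lemma ReC_sum (I : Type) (r : seq I) (P : pred I) (F : I -> C) :
  reC (\sum_(i <- r | P i) F i) = \sum_(i <- r | P i) reC (F i).
Proof. exact: (big_morph reC ReCD). Qed.

Lemma ImC_sum (I : Type) (r : seq I) (P : pred I) (F : I -> C) :
  imC (\sum_(i <- r | P i) F i) = \sum_(i <- r | P i) imC (F i).
Proof. exact: (big_morph imC ImCD). Qed.

Lemma conjCE (x : C) : x^* = (reC x +i* - imC x)%C.
Proof. by case: x. Qed.

Lemma complex_eqP (x y : C) : reC x = reC y -> imC x = imC y -> x = y.
Proof. by case: x y => ? ? [] ? ? /= -> ->. Qed.

Section Encoding.
Context {p q : nat}.

Definition rz (A : 'M[C]_(p, q)) : 'rV[R]_(p * q + p * q) :=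
  row_mx (mxvec (map_mx reC A)) (mxvec (map_mx imC A)).

Definition cz (v : 'rV[R]_(p * q + p * q)) : 'M[C]_(p, q) :=
  \matrix_(i, j) (lsubmx v 0 (mxvec_index i j) +i* rsubmx v 0 (mxvec_index i j))%C.

Lemma rzK : cancel rz cz.
Proof.
move=> A; apply/matrixP => i j; rewrite mxE row_mxKl row_mxKr !mxvecE !mxE.
by case: (A i j).
Qed.

Lemma czK : cancel cz rz.
Proof.
move=> v; rewrite /rz -[RHS]hsubmxK; congr row_mx; apply/rowP => i;
  by case/mxvec_indexP: i => i j; rewrite mxvecE !mxE.
Qed.

Lemma rzD A B : rz (A + B) = rz A + rz B.
Proof.
rewrite /rz add_row_mx -!linearD /=; congr row_mx; congr mxvec;
  by apply/matrixP => i j; rewrite !mxE ?ReCD ?ImCD.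
Qed.

Lemma czD u v : cz (u + v) = cz u + cz v.
Proof. by rewrite -[u + v](_ : rz (cz u + cz v) = _) ?rzK // rzD !czK. Qed.

Lemma rzZ a A : rz (a%:C *: A) = a *: rz A.
Proof.
rewrite /rz scale_row_mx -!linearZ /=; congr row_mx; congr mxvec;
  by apply/matrixP => i j; rewrite !mxE ?ReCM ?ImCM /= ?mul0r ?subr0 ?addr0.
Qed.

Lemma czZ a v : cz (a *: v) = a%:C *: cz v.
Proof. by rewrite -[a *: v](_ : rz (a%:C *: cz v) = _) ?rzK // rzZ !czK. Qed.

Lemma rz0 : rz 0 = 0.
Proof. by rewrite -[0 in LHS](scale0r (0 : 'M[C]_(p, q))) -[0 in LHS]/(0%:C) rzZ scale0r. Qed.

Lemma cz0 : cz 0 = 0.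
Proof. by rewrite -rz0 rzK. Qed.

Lemma rz_inj A : rz A = 0 -> A = 0.
Proof. by move=> e; rewrite -[A]rzK e cz0. Qed.

(** The Euclidean inner product of the real coordinates, by [rz_dot]; orthogonality of slices refers
    to it. *)
Definition rdot (A B : 'M[C]_(p, q)) : R := reC (\tr (A^t* *m B)).

Lemma rdotE A B : rdot A B = \sum_i \sum_j (reC (A i j) * reC (B i j) + imC (A i j) * imC (B i j)).
Proof.
rewrite /rdot /mxtrace ReC_sum exchange_big; apply: eq_bigr => j _.
rewrite mxE ReC_sum; apply: eq_bigr => i _.
by rewrite !mxE conjCE ReCM /= mulNr opprK.
Qed.

Lemma rz_dot A B : (rz A *m (rz B)^T) 0 0 = rdot A B.
Proof.
rewrite /rz tr_row_mx mul_row_col mxE rdotE.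
have H (X Y : 'M[R]_(p, q)) : (mxvec X *m (mxvec Y)^T) 0 0 = \sum_i \sum_j X i j * Y i j.
  rewrite mxE (reindex _ (curry_mxvec_bij _ _)) /= pair_bigA /=.
  by apply: eq_bigr => -[i j] _ /=; rewrite mxE !mxvecE.
rewrite !H -big_split; apply: eq_bigr => i _; rewrite -big_split.
by apply: eq_bigr => j _; rewrite !mxE.
Qed.

Lemma rdot_eq0 A : rdot A A = 0 -> A = 0.
Proof.
rewrite rdotE => /eqP; rewrite psumr_eq0 => [/allP H|i _]; last first.
  by apply: sumr_ge0 => j _; rewrite addr_ge0 // -expr2 sqr_ge0.
apply/matrixP => i j; have /= := H i; rewrite mem_index_enum => /(_ isT).
rewrite psumr_eq0 => [/allP Hi|l _]; last by rewrite addr_ge0 // -expr2 sqr_ge0.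
have /= := Hi j; rewrite mem_index_enum -!expr2 paddr_eq0 ?sqr_ge0 // => /(_ isT).
rewrite !expf_eq0 /= => /andP[/eqP r0 /eqP i0].
by rewrite mxE; apply: complex_eqP.
Qed.

Lemma rdotC A B : rdot A B = rdot B A.
Proof.
by rewrite !rdotE; apply: eq_bigr => i _; apply: eq_bigr => j _; rewrite mulrC [imC _ * _]mulrC.
Qed.

End Encoding.

Section SmoothComplex.
Context {n : nat}.
Implicit Types (A : set 'rV[R]_n) (f g : 'rV[R]_n -> C).

Definition csmooth A f :=
  smooth A (fun x => reC (f x)) /\ smooth A (fun x => imC (f x)).

Lemma csmooth_cst A c : csmooth A (cst c).
Proof. by split => t; exact: Cn_cst. Qed.

Lemma csmoothD A f g : open A -> csmooth A f -> csmooth A g ->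
  csmooth A (fun x => f x + g x).
Proof.
move=> oA [f1 f2] [g1 g2]; split => t.
  by under eq_fun do rewrite ReCD; apply: CnD.
by under eq_fun do rewrite ImCD; apply: CnD.
Qed.

Lemma csmoothM A f g : open A -> csmooth A f -> csmooth A g ->
  csmooth A (fun x => f x * g x).
Proof.
move=> oA [f1 f2] [g1 g2]; split => t.
  under eq_fun do rewrite ReCM -mulN1r; apply: CnD => //; first exact: CnM.
  by apply: CnM => //; [exact: Cn_cst|exact: CnM].
by under eq_fun do rewrite ImCM; apply: CnD => //; exact: CnM.
Qed.

Lemma csmooth_conj A f : open A -> csmooth A f -> csmooth A (fun x => (f x)^*).
Proof.
move=> oA [f1 f2]; split => t.
  by under eq_fun do rewrite conjCE /=; exact: f1.
under eq_fun do rewrite conjCE /= -mulN1r; apply: CnM => //; exact: Cn_cst.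
Qed.

Lemma csmooth_sum A (I : Type) (r : seq I) (F : I -> 'rV[R]_n -> C) : open A ->
  (forall i, csmooth A (F i)) -> csmooth A (fun x => \sum_(i <- r) F i x).
Proof.
move=> oA H; split => t.
  by under eq_fun do rewrite ReC_sum; apply: Cn_sum => // i _; have [] := H i.
by under eq_fun do rewrite ImC_sum; apply: Cn_sum => // i _; have [] := H i.
Qed.

Definition msmooth p q A (F : 'rV[R]_n -> 'M[C]_(p, q)) :=
  forall i j, csmooth A (fun x => F x i j).

Lemma msmooth_cst p q A (M : 'M[C]_(p, q)) : msmooth A (cst M).
Proof. by move=> i j; exact: csmooth_cst. Qed.

Lemma msmoothD p q A (F G : 'rV[R]_n -> 'M[C]_(p, q)) : open A ->
  msmooth A F -> msmooth A G -> msmooth A (fun x => F x + G x).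
Proof.
by move=> oA sF sG i j; under eq_fun do rewrite mxE; exact: csmoothD.
Qed.

Lemma msmoothM p q r A (F : 'rV[R]_n -> 'M[C]_(p, q)) (G : 'rV[R]_n -> 'M[C]_(q, r)) :
  open A -> msmooth A F -> msmooth A G -> msmooth A (fun x => F x *m G x).
Proof.
move=> oA sF sG i j; under eq_fun do rewrite mxE.
by apply: csmooth_sum => // l; exact: csmoothM.
Qed.

Lemma msmoothZ p q A f (F : 'rV[R]_n -> 'M[C]_(p, q)) : open A ->
  csmooth A f -> msmooth A F -> msmooth A (fun x => f x *: F x).
Proof.
by move=> oA sf sF i j; under eq_fun do rewrite mxE; exact: csmoothM.
Qed.

Lemma msmooth_adj p q A (F : 'rV[R]_n -> 'M[C]_(p, q)) : open A ->
  msmooth A F -> msmooth A (fun x => (F x)^t*).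
Proof.
by move=> oA sF i j; under eq_fun do rewrite !mxE; exact: csmooth_conj.
Qed.

Lemma msmooth_tens1 d k A (F : 'rV[R]_n -> 'M[C]_d) : open A ->
  msmooth A F -> msmooth A (fun x => F x *t (1%:M : 'M[C]_k)).
Proof.
move=> oA sF u v; case: (mxtens_indexP u) => r a; case: (mxtens_indexP v) => s b.
under eq_fun do rewrite tensmxE.
by apply: csmoothM => //; exact: csmooth_cst.
Qed.

Lemma smooth_rz p q A (F : 'rV[R]_n -> 'M[C]_(p, q)) j :
  msmooth A F -> smooth A (fun x => rz (F x) 0 j).
Proof.
move=> sF; rewrite -[j]splitK; case: (fintype.split j) => l /=.
  under eq_fun do rewrite row_mxEl; case/mxvec_indexP: l => a b.
  by under eq_fun do rewrite mxvecE mxE; have [] := sF a b.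
under eq_fun do rewrite row_mxEr; case/mxvec_indexP: l => a b.
by under eq_fun do rewrite mxvecE mxE; have [] := sF a b.
Qed.

Lemma msmooth_cz p q A (f : 'rV[R]_n -> 'rV[R]_(p * q + p * q)) :
  (forall j, smooth A (fun x => f x 0 j)) -> msmooth A (fun x => cz (f x)).
Proof.
move=> sf i j; split; under eq_fun do rewrite mxE /=; under eq_fun do rewrite mxE; exact: sf.
Qed.

Lemma smooth_mulmx p q A (f : 'rV[R]_n -> 'rV[R]_p) (M : 'M[R]_(p, q)) j : open A ->
  (forall j, smooth A (fun x => f x 0 j)) -> smooth A (fun x => (f x *m M) 0 j).
Proof.
move=> oA sf t; under eq_fun do rewrite mxE.
apply: Cn_sum => // l _; apply: CnM => //; [exact: sf|exact: Cn_cst].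
Qed.

End SmoothComplex.

(** * Derivatives at 0 of curves of complex matrices *)

Section ComplexDerivative.

Definition cderive (f : R -> C) (f' : C) :=
  is_derive (0 : R) 1 (fun t => reC (f t)) (reC f') /\
  is_derive (0 : R) 1 (fun t => imC (f t)) (imC f').

Lemma is_derive_val (f : R -> R) a b : a = b -> is_derive (0 : R) 1 f a -> is_derive (0 : R) 1 f b.
Proof. by move=> ->. Qed.

Lemma cderive_cst c : cderive (cst c) 0.
Proof. by split; exact: is_derive_cst. Qed.

Lemma cderiveD f g f' g' : cderive f f' -> cderive g g' ->
  cderive (fun t => f t + g t) (f' + g').
Proof.
move=> [f1 f2] [g1 g2]; split.
  by under eq_fun do rewrite ReCD; rewrite ReCD; exact: is_deriveD.
by under eq_fun do rewrite ImCD; rewrite ImCD; exact: is_deriveD.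
Qed.

Lemma cderiveM f g f' g' : cderive f f' -> cderive g g' ->
  cderive (fun t => f t * g t) (f' * g 0 + f 0 * g').
Proof.
move=> [f1 f2] [g1 g2]; split.
  under eq_fun do rewrite ReCM.
  apply: is_derive_val (is_deriveB (is_deriveM f1 g1) (is_deriveM f2 g2)).
  by rewrite ReCD !ReCM /GRing.scale /=; ring.
under eq_fun do rewrite ImCM.
apply: is_derive_val (is_deriveD (is_deriveM f1 g2) (is_deriveM f2 g1)).
by rewrite ImCD !ImCM /GRing.scale /=; ring.
Qed.

Lemma cderive_conj f f' : cderive f f' -> cderive (fun t => (f t)^*) (f'^*).
Proof.
move=> [f1 f2]; split; first by under eq_fun do rewrite conjCE /=; rewrite conjCE.
by under eq_fun do rewrite conjCE /=; rewrite conjCE /=; exact: is_deriveN.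
Qed.

Lemma cderive_sum (I : Type) (r : seq I) (F : I -> R -> C) (F' : I -> C) :
  (forall i, cderive (F i) (F' i)) ->
  cderive (fun t => \sum_(i <- r) F i t) (\sum_(i <- r) F' i).
Proof.
move=> H; elim: r => [|i r IH].
  by rewrite big_nil; under eq_fun do rewrite big_nil; exact: cderive_cst.
by rewrite big_cons; under eq_fun do rewrite big_cons; exact: cderiveD.
Qed.

Lemma cderive_affine (a b : C) : cderive (fun t => a + t%:C * b) b.
Proof.
have H (x y : R) : is_derive (0 : R) 1 (fun t => x + t * y) y.
  have H1 : is_derive (0 : R) (1 : R) (cst x) (0 : R) by exact: is_derive_cst.
  have H2 : is_derive (0 : R) (1 : R) (cst y) (0 : R) by exact: is_derive_cst.
  have H3 : is_derive (0 : R) (1 : R) (id : R -> R) (1 : R) by exact: is_derive_id.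
  apply: is_derive_val (is_deriveD H1 (is_deriveM H3 H2)).
  by rewrite /GRing.scale /= mulr0 !add0r mulr1.
split.
  by under eq_fun do rewrite ReCD ReCM /= mul0r subr0; exact: H.
by under eq_fun do rewrite ImCD ImCM /= mul0r addr0; exact: H.
Qed.

Definition mderive p q (F : R -> 'M[C]_(p, q)) (F' : 'M[C]_(p, q)) :=
  forall i j, cderive (fun t => F t i j) (F' i j).

Lemma mderive_cst p q (M : 'M[C]_(p, q)) : mderive (cst M) 0.
Proof. by move=> i j; rewrite mxE; exact: cderive_cst. Qed.

Lemma mderiveD p q (F G : R -> 'M[C]_(p, q)) F' G' : mderive F F' -> mderive G G' ->
  mderive (fun t => F t + G t) (F' + G').
Proof.
by move=> dF dG i j; rewrite mxE; under eq_fun do rewrite mxE; exact: cderiveD.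
Qed.

Lemma mderiveM p q r (F : R -> 'M[C]_(p, q)) (G : R -> 'M[C]_(q, r)) F' G' :
  mderive F F' -> mderive G G' ->
  mderive (fun t => F t *m G t) (F' *m G 0 + F 0 *m G').
Proof.
move=> dF dG i j; rewrite !mxE -big_split; under eq_fun do rewrite mxE.
by apply: cderive_sum => l; exact: cderiveM.
Qed.

Lemma mderiveZ p q (f : R -> C) (F : R -> 'M[C]_(p, q)) f' F' : cderive f f' ->
  mderive F F' -> mderive (fun t => f t *: F t) (f' *: F 0 + f 0 *: F').
Proof.
by move=> df dF i j; rewrite !mxE; under eq_fun do rewrite mxE; exact: cderiveM.
Qed.

Lemma mderive_adj p q (F : R -> 'M[C]_(p, q)) F' : mderive F F' ->
  mderive (fun t => (F t)^t*) (F'^t*).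
Proof.
by move=> dF i j; rewrite !mxE; under eq_fun do rewrite !mxE; exact: cderive_conj.
Qed.

Lemma mderive_tens1 d k (F : R -> 'M[C]_d) F' : mderive F F' ->
  mderive (fun t => F t *t (1%:M : 'M[C]_k)) (F' *t 1%:M).
Proof.
move=> dF u v; case: (mxtens_indexP u) => r a; case: (mxtens_indexP v) => s b.
have := cderiveM (dF r s) (cderive_cst ((1%:M : 'M[C]_k) a b)).
by rewrite mulr0 addr0 tensmxE; under [in X in _ -> X]eq_fun do rewrite tensmxE.
Qed.

Lemma mderive_affine p q (M X : 'M[C]_(p, q)) : mderive (fun t => M + t%:C *: X) X.
Proof.
by move=> i j; under eq_fun do rewrite !mxE; exact: cderive_affine.
Qed.

End ComplexDerivative.

End RealCoordinates.

Section ComplexTopology.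
Context {R : realType}.
Local Notation C := R[i].
Local Notation reC := (@complex.Re R).
Local Notation imC := (@complex.Im R).

Lemma normC_lt (z : C) (e : R) : `|reC z| < e -> `|imC z| < e -> `|z| < (e *+ 2)%:C.
Proof.
move=> re im; have e0 : 0 < e by exact: le_lt_trans re.
rewrite normc_def ltcR -(ltr_pXn2r (_ : 0 < 2)%N) ?nnegrE ?sqrtr_ge0 ?mulrn_wge0 ?ltW //.
rewrite sqr_sqrtr ?addr_ge0 ?sqr_ge0 // -[reC z ^+ 2]real_normK ?num_real //.
rewrite -[imC z ^+ 2]real_normK ?num_real //.
have h1 : `|reC z| ^+ 2 < e ^+ 2 by rewrite ltr_pXn2r ?nnegrE // ltW.
have h2 : `|imC z| ^+ 2 < e ^+ 2 by rewrite ltr_pXn2r ?nnegrE // ltW.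
have h3 : 0 < e ^+ 2 by rewrite exprn_gt0.
have -> : (e *+ 2) ^+ 2 = 4 * e ^+ 2 by rewrite -mulr_natl; ring.
lra.
Qed.

Lemma normC_ge (z : C) (e : R) : `|z| < e%:C -> `|reC z| < e /\ `|imC z| < e.
Proof.
rewrite normc_def ltcR => H.
have H1 : `|reC z| <= Num.sqrt (reC z ^+ 2 + imC z ^+ 2).
  by rewrite -sqrtr_sqr ler_wsqrtr // lerDl sqr_ge0.
have H2 : `|imC z| <= Num.sqrt (reC z ^+ 2 + imC z ^+ 2).
  by rewrite -sqrtr_sqr ler_wsqrtr // lerDr sqr_ge0.
by split; [exact: le_lt_trans H1 H|exact: le_lt_trans H2 H].
Qed.

Lemma nbhs_complexP (z : C) (U : set C) : nbhs z U <->
  exists2 e : R, 0 < e & forall z', `|reC z' - reC z| < e -> `|imC z' - imC z| < e -> U z'.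
Proof.
split.
  move=> /nbhs_ballP[e /= e0 H]; have /complex_realP[e' ee] := gtr0_real e0.
  rewrite ee in e0 H; rewrite ltcR in e0.
  exists (e' / 2); first by rewrite divr_gt0.
  move=> z' re im; apply: H; suff : `|z - z'| < e'%:C by [].
  have -> : e' = (e' / 2) *+ 2 by rewrite -mulr_natl mulrC divfK.
  apply: normC_lt; first by rewrite ReCD ReCN distrC.
  by rewrite ImCD ImCN distrC.
move=> [e e0 H]; apply/nbhs_ballP; exists e%:C => /=; first by rewrite ltcR.
move=> z' /=; rewrite -[ball _ _ _]/(is_true (`|z - z'| < e%:C)) => /normC_ge.
by rewrite ReCD ReCN ImCD ImCN distrC [X in _ /\ is_true (X < _)]distrC => -[]; exact: H.
Qed.

(** The bridge between the product topology of complex matrices, which [Virr] carries, and the norm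
    of real coordinates, in which the analysis is done. *)
Lemma nbhs_rzP p q (M : 'M[C]_(p, q)) (U : set 'M[C]_(p, q)) : nbhs M U <->
  exists2 e : R, 0 < e & forall M', `|rz M' - rz M| < e -> U M'.
Proof.
split.
  move=> [P MP PU].
  have /choice[f Hf] : forall ij : 'I_p * 'I_q, exists e : R, 0 < e /\
      forall z', `|reC z' - reC (M ij.1 ij.2)| < e -> `|imC z' - imC (M ij.1 ij.2)| < e ->
        P ij.1 ij.2 z'.
    by move=> [i j]; have /nbhs_complexP[e e0 H] := MP i j; exists e.
  (* Again a positive lower bound of finitely many radii, valid also for empty matrices. *)
  pose e := (1 + \sum_ij (f ij)^-1)^-1.
  have e0 : 0 < e.
    rewrite invr_gt0 ltr_pwDl // sumr_ge0 // => ij _.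
    by have [f0 _] := Hf ij; rewrite invr_ge0 ltW.
  exists e => // M' MM'; apply: PU => i j; have [f0 H] := Hf (i, j).
  have ef : e <= f (i, j).
    rewrite -[leRHS]invrK lef_pV2 ?posrE ?invr_gt0 //; last first.
      by rewrite -invr_gt0.
    rewrite (bigD1 (i, j)) //= addrCA lerDl addr_ge0 // sumr_ge0 // => ij _.
    by have [f0' _] := Hf ij; rewrite invr_ge0 ltW.
  have entry (l : 'I_(p * q + p * q)) : `|(rz M' - rz M) 0 l| < f (i, j).
    by apply: lt_le_trans ef; apply: le_lt_trans MM'; exact: mx_entry_norm.
  apply: H.
    have := entry (lshift _ (mxvec_index i j)).
    by rewrite mxE [X in _ + X]mxE !row_mxEl !mxvecE !mxE.
  have := entry (rshift _ (mxvec_index i j)).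
  by rewrite mxE [X in _ + X]mxE !row_mxEr !mxvecE !mxE.
move=> [e e0 H].
exists (fun i j => [set z | `|reC z - reC (M i j)| < e /\ `|imC z - imC (M i j)| < e]).
  by move=> i j; apply/nbhs_complexP; exists e.
move=> M' HM; apply: H; apply: mx_norm_lt => // i l; rewrite {i}ord1 -[l]splitK.
case: (fintype.split l) => {}l /=; case/mxvec_indexP: l => i j; have [re im] := HM i j.
  by rewrite mxE [X in _ + X]mxE !row_mxEl !mxvecE !mxE.
by rewrite mxE [X in _ + X]mxE !row_mxEr !mxvecE !mxE.
Qed.

End ComplexTopology.

Section VirrTopology.
Context {R : realType} {d k : nat}.
Local Notation C := R[i].
Implicit Types V : Virr R d k.

Definition vz V := rz (val V).

Lemma open_VirrP (U : set (Virr R d k)) : open U <->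
  forall V, U V -> exists2 e : R, 0 < e & forall V', `|vz V' - vz V| < e -> U V'.
Proof.
split.
  move=> [A oA <-] V AV.
  have /nbhs_rzP[e e0 H] : nbhs (val V) A by exact: open_nbhs_nbhs.
  by exists e => // V' VV'; exact: H.
move=> H; pose A : set 'M[C]_(d * k, d) := \bigcup_(V in U)
  interior [set M | exists2 e : R, 0 < e & [/\ `|rz M - vz V| < e &
    forall V', `|vz V' - vz V| < e -> U V']].
exists A; first by apply: bigcup_open => V _; exact: open_interior.
apply/seteqP; split => [V [V0 UV0 /interior_subset[e e0 [Ve]]]|V UV]; first exact.
exists V => //; have [e e0 He] := H V UV; apply/nbhs_rzP; exists e => // M MV.
by exists e.
Qed.

Lemma open_PirrP (U : set (Pirr R d k)) : open U <->
  forall V, U (\pi_(Pirr R d k) V) ->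
    exists2 e : R, 0 < e & forall V', `|vz V' - vz V| < e -> U (\pi_(Pirr R d k) V').
Proof.
have -> : open U = open (\pi_(Pirr R d k) @^-1` U) by [].
exact: open_VirrP.
Qed.

Lemma Virr_isometry V : isometry (val V).
Proof. by case: V => M /= /set_mem[]. Qed.

Lemma Virr_irreducible V : irreducible (val V).
Proof. by case: V => M /= /set_mem[]. Qed.

Definition mkVirr (M : 'M[C]_(d * k, d)) (iM : isometry M) (IM : irreducible M) :
  Virr R d k := exist _ M (mem_set (conj iM IM)).

Lemma out_gauge_equiv V1 V2 : out_equiv V1 V2 = gauge_equiv V1 V2.
Proof.
apply/asboolP/asboolP => [|so].
  by apply: output_equivalent_same_orbit; exact: Virr_isometry || exact: Virr_irreducible.
by apply: same_orbit_output => //; exact: Virr_irreducible.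
Qed.

Lemma eq_PirrP V1 V2 :
  \pi_(Pirr R d k) V1 = \pi_(Pirr R d k) V2 <-> same_orbit (val V1) (val V2).
Proof.
split=> [/eqquotP e|so]; last first.
  apply/eqquotP; have : out_equiv V1 V2 by rewrite out_gauge_equiv; apply/asboolP.
  exact.
by have : out_equiv V1 V2 by []; rewrite out_gauge_equiv => /asboolP.
Qed.

Lemma eq_VirrGP V1 V2 :
  \pi_(Virr_mod_G R d k) V1 = \pi_(Virr_mod_G R d k) V2 <-> same_orbit (val V1) (val V2).
Proof.
by split=> [/eqquotP/asboolP//|so]; apply/eqquotP/asboolP.
Qed.

Lemma Pirr_surj (p : Pirr R d k) : exists V, p = \pi_(Pirr R d k) V.
Proof. by exists (generic_quotient.repr p); rewrite reprK. Qed.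

Lemma Pirr_homeo : exists h : Pirr R d k -> Virr_mod_G R d k,
     homeomorphism h /\
     forall V : Virr R d k, h (\pi_(Pirr R d k) V) = \pi_(Virr_mod_G R d k) V.
Proof.
pose h (p : Pirr R d k) : Virr_mod_G R d k := \pi_(Virr_mod_G R d k) (generic_quotient.repr p).
pose g (p : Virr_mod_G R d k) : Pirr R d k := \pi_(Pirr R d k) (generic_quotient.repr p).
have hpi V : h (\pi_(Pirr R d k) V) = \pi_(Virr_mod_G R d k) V.
  by apply/eq_VirrGP/eq_PirrP; rewrite reprK.
have gpi V : g (\pi_(Virr_mod_G R d k) V) = \pi_(Pirr R d k) V.
  by apply/eq_PirrP/eq_VirrGP; rewrite reprK.
exists h; split => //; split.
  apply/quotient_continuous; rewrite (_ : _ \o _ = \pi_(Virr_mod_G R d k)).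
    exact: pi_continuous.
  exact/funext.
exists g; split.
- by move=> p; rewrite -[p]reprK hpi gpi.
- by move=> p; rewrite -[p]reprK gpi hpi.
- apply/quotient_continuous; rewrite (_ : _ \o _ = \pi_(Pirr R d k)).
    exact: pi_continuous.
  exact/funext.
Qed.

End VirrTopology.

(** * Slices of the gauge action *)

Section HermitianCoordinates.
Context {R : realType} {d : nat}.
Local Notation C := R[i].
Local Notation reC := (@complex.Re R).
Local Notation imC := (@complex.Im R).

(** A linear bijection from all real d x d matrices to the Hermitian ones: the symmetric part
    becomes the real part, the antisymmetric part the imaginary one. Hermitian matrices thus have
    d^2 free coordinates. *)
Definition herm (M : 'M[R]_d) : 'M[C]_d :=
  \matrix_(i, j) ((M i j + M j i) / 2 +i* ((M i j - M j i) / 2))%C.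

Definition hmx (S : 'M[C]_d) : 'M[R]_d := \matrix_(i, j) (reC (S i j) + imC (S i j)).

Lemma herm_adj M : (herm M)^t* = herm M.
Proof.
apply/matrixP => i j; rewrite !mxE conjCE; congr (_ +i* _)%C => /=; ring.
Qed.

Lemma hmxK S : S^t* = S -> herm (hmx S) = S.
Proof.
move=> hS; apply/matrixP => i j; have /matrixP/(_ i j) := hS.
rewrite !mxE conjCE => e.
have e1 : reC (S j i) = reC (S i j) by rewrite -e.
have e2 : - imC (S j i) = imC (S i j) by rewrite -e.
by apply: complex_eqP => /=; rewrite e1 -e2; field.
Qed.

Lemma hermK M : hmx (herm M) = M.
Proof. by apply/matrixP => i j; rewrite !mxE /=; field. Qed.

Lemma herm_linear : forall a M M', herm (a *: M + M') = a%:C *: herm M + herm M'.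
Proof.
move=> a M M'; apply/matrixP => i j; rewrite !mxE; apply: complex_eqP.
  by rewrite ReCD ReCM /= mul0r subr0; field.
by rewrite ImCD ImCM /= mul0r addr0; field.
Qed.

Lemma herm0 : herm 0 = 0.
Proof. by apply/matrixP => i j; rewrite !mxE addr0 subrr mul0r. Qed.

Lemma herm_eq0 M : herm M = 0 -> M = 0.
Proof.
by move=> e; rewrite -[M]hermK e; apply/matrixP => i j; rewrite !mxE /= addr0.
Qed.

Lemma hmx_eq0 S : S^t* = S -> hmx S = 0 -> S = 0.
Proof. by move=> hS e; rewrite -[S]hmxK // e herm0. Qed.

Lemma trace_herm M : \tr (herm M) = (\tr M)%:C.
Proof.
rewrite /mxtrace rmorph_sum; apply: eq_bigr => i _; rewrite mxE subrr mul0r.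
by congr (_ +i* _)%C; field.
Qed.

End HermitianCoordinates.

Section Slice.
Context {R : realType} {d k : nat}.
Local Notation C := R[i].
Local Notation N := (d * k * d + d * k * d)%N.
Local Notation reC := (@complex.Re R).
Implicit Types (V X : 'M[C]_(d * k, d)) (A S : 'M[C]_d) (m : 'rV[R]_(d * d)).

(** For skew-Hermitian [A], the derivative at s = 0 of the gauge action of the pair (exp(i t s),
    exp(s A)) on [X]. *)
Definition infact A (t : R) X : 'M[C]_(d * k, d) :=
  (A *t (1%:M : 'M[C]_k)) *m X - X *m A - ('i * t%:C) *: X.

Definition nor V m := rz (V *m herm (vec_mx m)).

(** The Lie algebra of U(1) x PU(d) has dimension d^2. Scalar matrices [A] act trivially, so the
    trace of the Hermitian parameter is free to record the phase [t], and d^2 parameters describe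
    the tangent space of the orbit without redundancy. *)
Definition tau V m :=
  rz (infact ('i *: herm (vec_mx m)) (\tr (vec_mx m)) V).

Lemma tens1D A A' : (A + A') *t (1%:M : 'M[C]_k) = A *t 1%:M + A' *t 1%:M.
Proof.
by apply/matrixP => u v; rewrite !mxE mulrDl.
Qed.

Lemma tens1Z (a : C) A : (a *: A) *t (1%:M : 'M[C]_k) = a *: (A *t 1%:M).
Proof.
by apply/matrixP => u v; rewrite !mxE mulrA.
Qed.

Lemma infactD A A' t t' X : infact (A + A') (t + t') X = infact A t X + infact A' t' X.
Proof.
rewrite /infact tens1D rmorphD mulrDr scalerDl mulmxDl mulmxDr !opprD.
move: (_ *m X) (_ *m X) (X *m _) (X *m _) (_ *: X) (_ *: X) => a b c e f g.
by apply/matrixP => i j; rewrite !mxE; ring.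
Qed.

Lemma infactZ (a : R) A t X : infact (a%:C *: A) (a * t) X = a%:C *: infact A t X.
Proof.
rewrite /infact tens1Z -scalemxAl -scalemxAr rmorphM mulrCA.
by rewrite !scalerBr scalerA.
Qed.

Lemma nor_is_linear V : linear (nor V).
Proof.
move=> a x y; rewrite /nor linearP herm_linear mulmxDr -scalemxAr rzD.
by rewrite rzZ.
Qed.

HB.instance Definition _ V := GRing.isLinear.Build R 'rV[R]_(d * d) 'rV[R]_N _ (nor V) (nor_is_linear V).

Lemma tau_is_linear V : linear (tau V).
Proof.
move=> a x y; rewrite /tau !linearP herm_linear scalerDr scalerA mulrC -scalerA.
by rewrite infactD infactZ rzD rzZ.
Qed.

HB.instance Definition _ V := GRing.isLinear.Build R 'rV[R]_(d * d) 'rV[R]_N _ (tau V) (tau_is_linear V).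

Definition Nor V : 'M[R]_(d * d, N) := lin1_mx (nor V).
Definition Tau V : 'M[R]_(d * d, N) := lin1_mx (tau V).

Lemma mulNor V m : m *m Nor V = nor V m.
Proof. exact: mul_rV_lin1. Qed.

Lemma mulTau V m : m *m Tau V = tau V m.
Proof. exact: mul_rV_lin1. Qed.

Lemma mulNorT V (v : 'rV[R]_N) : v *m (Nor V)^T = 0 <->
  forall S, S^t* = S -> rdot (cz v) (V *m S) = 0.
Proof.
have E m : (v *m (Nor V)^T *m m^T) 0 0 = rdot (cz v) (V *m herm (vec_mx m)).
  by rewrite -mulmxA -trmx_mul mulNor -rz_dot czK.
split => [e S hS|H].
  have := E (mxvec (hmx S)); rewrite e mul0mx mxE mxvecK hmxK //.
apply/rowP => j; have := E (delta_mx 0 j).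
by rewrite H ?herm_adj // trmx_delta -colE => e; rewrite [RHS]mxE -[RHS]e [RHS]mxE.
Qed.

Lemma mulTauT V (v : 'rV[R]_N) : v *m (Tau V)^T = 0 <->
  forall m, rdot (cz v) (cz (tau V m)) = 0.
Proof.
have E m : (v *m (Tau V)^T *m m^T) 0 0 = rdot (cz v) (cz (tau V m)).
  by rewrite -mulmxA -trmx_mul mulTau -rz_dot !czK.
split => [e m|H]; first by rewrite -E e mul0mx mxE.
apply/rowP => j; have := E (delta_mx 0 j).
by rewrite H // trmx_delta -colE => e; rewrite [RHS]mxE -[RHS]e [RHS]mxE.
Qed.

Section AtIsometry.
Variable V : 'M[C]_(d * k, d).
Hypotheses (iV : isometry V) (IV : irreducible V).

Lemma channel_adj A : (channel V A)^t* = channel V (A^t*).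
Proof. exact: adj_mixed. Qed.

Lemma adj_infact A t :
  V^t* *m infact A t V = channel V A - A - ('i * t%:C)%:M.
Proof.
rewrite /infact !mulmxBr [V^t* *m (_ *m A)]mulmxA iV mul1mx -scalemxAr iV.
by rewrite mulmxA scalemx1.
Qed.

Lemma skew_adj_infact A t : A^t* = - A ->
  (V^t* *m infact A t V)^t* = - (V^t* *m infact A t V).
Proof.
move=> sA; have et : (t%:C)^* = t%:C by rewrite conjCE /= oppr0.
rewrite adj_infact !adjmxB channel_adj sA adjmx_scalar.
rewrite [channel V (- A)](linearN (mixed V V)) rmorphM /= conjCi et mulNr.
rewrite -[mixed V V A]/(channel V A) [(- _)%:M]raddfN /=.
move: (channel V A) (_%:M) => X Y; apply/matrixP => i j; rewrite !mxE; ring.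
Qed.

Lemma skew_herm m : ('i *: herm (vec_mx m) : 'M[C]_d)^t* = - ('i *: herm (vec_mx m)).
Proof. by rewrite adjmxZ herm_adj conjCi scaleNr. Qed.

Lemma reC_trace_skew_herm (K S : 'M[C]_d) : K^t* = - K -> S^t* = S -> reC (\tr (K *m S)) = 0.
Proof.
move=> hK hS; have e : (\tr (K *m S))^* = - \tr (K *m S).
  by rewrite -mxtrace_adj adjmxM hK hS mulmxN linearN /= mxtrace_mulC.
have : reC ((\tr (K *m S))^*) = reC (- \tr (K *m S)) by rewrite e.
rewrite conjCE ReCN /=; lra.
Qed.

(* The action is infinitesimally free: an element of the isotropy algebra is a
   fixed point of the channel up to an imaginary constant, which vanishes after
   pairing with the stationary state. *)
Lemma infact_eq0 A t : A^t* = - A -> infact A t V = 0 ->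
  t = 0 /\ exists a, A = a%:M.
Proof.
move=> sA e; have [rho prho sV] := IV.
have [[_ tr1] frho] : stationary_states V rho by rewrite sV.
have := adj_infact A t; rewrite e mulmx0 => /esym e1.
have e2 : channel V A = A + ('i * t%:C)%:M.
  by apply/eqP; rewrite -subr_eq0 opprD addrA e1.
have : \tr (rho *m channel V A) = \tr (rho *m A) by rewrite -predual_channel frho.
rewrite e2 mulmxDr linearD /= mul_mx_scalar linearZ /= tr1 mulr1.
rewrite -[X in _ = X]addr0 => /addrI /eqP.
rewrite mulf_eq0 (negPf (neq0Ci _)) /= => /eqP tC.
have t0 : t = 0 by apply: (@complexI R).
split => //; apply: (irreducible_channel_fixed iV IV).
by rewrite e2 tC mulr0 raddf0 addr0.
Qed.

Lemma tau_eq0 m : tau V m = 0 -> m = 0.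
Proof.
move=> /rz_inj /(infact_eq0 (skew_herm m))[t0 [a Aa]].
have d0 : (0 < d)%N by exact: irreducible_dim IV.
have : \tr ('i *: herm (vec_mx m)) = 0 by rewrite linearZ /= trace_herm t0 mulr0.
rewrite Aa mxtrace_scalar => /eqP; rewrite mulrn_eq0 -leqn0 leqNgt d0 /= => /eqP a0.
move: Aa; rewrite a0 raddf0 => /eqP; rewrite scaler_eq0 (negPf (neq0Ci _)) /=.
by move=> /eqP/herm_eq0 e; rewrite -[m]vec_mxK e linear0.
Qed.

(** The product of [V^*] with an orbit direction is skew-Hermitian, since the action preserves
    isometries, and its pairing with a Hermitian matrix has no real part. *)
Lemma rdot_nor_tau S m : S^t* = S -> rdot (V *m S) (cz (tau V m)) = 0.
Proof.
move=> hS; rewrite /tau rzK /rdot adjmxM hS -mulmxA mxtrace_mulC.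
by rewrite reC_trace_skew_herm // skew_adj_infact // skew_herm.
Qed.

Lemma tangent_row_free : row_free (col_mx (Nor V) (Tau V)).
Proof.
rewrite -kermx_eq0; apply/rowV0P => u /sub_kermxP.
rewrite -[u]hsubmxK mul_row_col mulNor mulTau.
set a := lsubmx u; set b := rsubmx u => e.
pose S := herm (vec_mx a).
have hS : S^t* = S by exact: herm_adj.
have VS : V *m S = 0.
  have e0 : V *m S + cz (tau V b) = 0.
    by rewrite -[V *m S]rzK -czD -/(nor V a) e cz0.
  apply: rdot_eq0; have := rdot_nor_tau b hS; rewrite rdotC.
  have -> : cz (tau V b) = - (V *m S) by apply/eqP; rewrite -addr_eq0 addrC e0.
  by rewrite /rdot adjmxN mulNmx linearN ReCN => /eqP; rewrite oppr_eq0 => /eqP.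
have a0 : a = 0.
  have : S = 0 by rewrite -[S]mul1mx -iV -mulmxA VS mulmx0.
  by move/herm_eq0 => e0; rewrite -[a]vec_mxK e0 linear0.
have b0 : b = 0 by apply: tau_eq0; rewrite -e a0 linear0 add0r.
by rewrite a0 b0 row_mx0.
Qed.

(** Independent of [V], so that all charts have the same dimension. The truncated subtraction is
    exact as soon as an irreducible isometry exists. *)
Definition slice_dim := (N - (d * d + d * d))%N.

Lemma slice_dimE : (slice_dim + (d * d + d * d) = N)%N.
Proof.
rewrite /slice_dim subnK //.
have /eqP <- := tangent_row_free; exact: rank_leq_col.
Qed.

Lemma slice_basis : exists B : 'M[R]_(slice_dim, N), row_free B /\
  forall v : 'rV[R]_N, (v <= B)%MS <-> v *m (Nor V)^T = 0 /\ v *m (Tau V)^T = 0.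
Proof.
pose L := kermx (col_mx (Nor V) (Tau V))^T.
have rL : \rank L = slice_dim.
  by rewrite mxrank_ker mxrank_tr; have /eqP -> := tangent_row_free.
have HL (v : 'rV[R]_N) : (v <= L)%MS <-> v *m (Nor V)^T = 0 /\ v *m (Tau V)^T = 0.
  split=> [/sub_kermxP|[e1 e2]].
    rewrite tr_col_mx mul_mx_row -[0]row_mx0 => /eq_row_mx; exact.
  by apply/sub_kermxP; rewrite tr_col_mx mul_mx_row e1 e2 row_mx0.
(* Stated with the rank as the dimension, so that the equation [rL] can be rewritten in the type of
   [B]. *)
have : exists B : 'M[R]_(\rank L, N), row_free B /\
    forall v : 'rV[R]_N, (v <= B)%MS <-> v *m (Nor V)^T = 0 /\ v *m (Tau V)^T = 0.
  exists (row_base L); split; first exact: row_base_free.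
  by move=> v; rewrite eq_row_base.
by rewrite rL.
Qed.

End AtIsometry.
End Slice.

Section MatrixGroup.
Context {R : realType} {m : nat}.

(* Closed under products and right inverses; the group law is that of the
   action x |-> x *m M, which is contravariant. *)
Record mxgroup := MxGroup {
  mxg_seq : seq 'M[R]_m;
  mxg1 : 1%:M \in mxg_seq;
  mxgM : forall M M', M \in mxg_seq -> M' \in mxg_seq -> M *m M' \in mxg_seq;
  mxgV : forall M, M \in mxg_seq -> exists2 M', M' \in mxg_seq & M *m M' = 1%:M }.

Variable H : mxgroup.

Definition mxgroup_type := seq_sub (mxg_seq H).
HB.instance Definition _ := Finite.on mxgroup_type.

Definition mxgroup_one : mxgroup_type := SeqSub (mxg1 H).
Definition mxgroup_mul (g h : mxgroup_type) : mxgroup_type :=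
  SeqSub (mxgM (valP h) (valP g)).

Lemma mxgroup_inv_subproof (g : mxgroup_type) : invmx (val g) \in mxg_seq H.
Proof.
have [M' M'H e] := mxgV (valP g).
have /mulmx1_unit[gU _] := e.
by rewrite -[invmx _]mulmx1 -e mulmxA mulVmx // mul1mx.
Qed.

Definition mxgroup_inv (g : mxgroup_type) : mxgroup_type :=
  SeqSub (mxgroup_inv_subproof g).

Lemma mxgroup_mulA : associative mxgroup_mul.
Proof. by move=> g h l; apply: val_inj; rewrite /= mulmxA. Qed.

Lemma mxgroup_mul1 : left_id mxgroup_one mxgroup_mul.
Proof. by move=> g; apply: val_inj; rewrite /= mulmx1. Qed.

Lemma mxgroup_mulV : left_inverse mxgroup_one mxgroup_inv mxgroup_mul.
Proof.
move=> g; apply: val_inj => /=; have [M' M'H e] := mxgV (valP g).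
by have /mulmx1_unit[gU _] := e; rewrite mulmxV.
Qed.

HB.instance Definition _ := Finite_isGroup.Build mxgroup_type
  mxgroup_mulA mxgroup_mul1 mxgroup_mulV.

End MatrixGroup.

Lemma mulmx_inv_unique (F : comUnitRingType) n (A G T : 'M[F]_n) :
  A *m G = 1%:M -> G *m T = 1%:M -> T = A.
Proof. by move=> AG GT; rewrite -[T]mul1mx -AG -mulmxA GT mulmx1. Qed.

(** * The linear action of a stabilizer on the slice directions *)

Section Stabilizer.
Context {R : realType} {d k : nat}.
Local Notation C := R[i].
Local Notation N := (d * k * d + d * k * d)%N.
Implicit Types (V X : 'M[C]_(d * k, d)) (A S W : 'M[C]_d) (c : C).

Definition gact c W (v : 'rV[R]_N) : 'rV[R]_N := rz (gauge c W (cz v)).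

Lemma gauge_is_linear c W : linear (@gauge R d k c W).
Proof.
move=> a X Y; rewrite /gauge mulmxDr mulmxDl -scalemxAr -scalemxAl scalerDr.
by rewrite !scalerA mulrC.
Qed.

Lemma gact_is_linear c W : linear (gact c W).
Proof.
by move=> a u v; rewrite /gact czD czZ gauge_is_linear rzD rzZ.
Qed.

HB.instance Definition _ c W := GRing.isLinear.Build R 'rV[R]_N 'rV[R]_N _ (gact c W) (gact_is_linear c W).

Lemma gact_comp c1 c2 W1 W2 v : gact c2 W2 (gact c1 W1 v) = gact (c2 * c1) (W2 *m W1) v.
Proof. by rewrite /gact rzK gauge_gauge. Qed.

Lemma gact1 v : gact 1 1%:M v = v.
Proof. by rewrite /gact gauge1 czK. Qed.

Lemma gact_rz c W X : gact c W (rz X) = rz (gauge c W X).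
Proof. by rewrite /gact rzK. Qed.

Lemma cz_gact c W v : cz (gact c W v) = gauge c W (cz v).
Proof. exact: rzK. Qed.

Lemma gactK c W v : `|c| = 1 -> W \is unitarymx -> gact c^* (W^t*) (gact c W v) = v.
Proof. by move=> nc uW; rewrite /gact rzK gaugeK // czK. Qed.

Lemma gactKV c W v : `|c| = 1 -> W \is unitarymx -> gact c W (gact c^* (W^t*) v) = v.
Proof.
move=> nc uW; have nc' : `|c^*| = 1 by rewrite norm_conjC.
have uW' : W^t* \is unitarymx by rewrite trmxC_unitary.
by have := gactK v nc' uW'; rewrite conjCK trmxCK.
Qed.

Lemma rdot_gauge c W X Y : `|c| = 1 -> W \is unitarymx ->
  rdot (gauge c W X) (gauge c W Y) = rdot X Y.
Proof.
move=> nc uW; rewrite /rdot !adj_kraus_sum; congr complex.Re.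
rewrite -(uconj_trace (\sum_i (kraus X i)^t* *m kraus Y i) uW) uconj_sum.
congr (\tr _); apply: eq_bigr => i _.
rewrite (kraus_gauge_uconj c W X i) (kraus_gauge_uconj c W Y i).
by rewrite uconj_phase_adj ?norm_conjC.
Qed.

Lemma gauge_mulmx c W X S : W \is unitarymx ->
  gauge c W (X *m S) = gauge c W X *m uconj W S.
Proof.
move=> uW; apply: kraus_inj => i; rewrite kraus_mulr.
rewrite (kraus_gauge_uconj c W X i) (kraus_gauge_uconj c W (X *m S) i) kraus_mulr.
by rewrite -scalemxAl uconjM.
Qed.

Lemma gauge_infact c W A t X : W \is unitarymx ->
  gauge c W (infact A t X) = infact (uconj W A) t (gauge c W X).
Proof.
move=> uW; have krausB (Y Z : 'M[C]_(d * k, d)) i : kraus (Y - Z) i = kraus Y i - kraus Z i.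
  by apply/matrixP => r s; rewrite !mxE.
apply: kraus_inj => i; rewrite kraus_gauge_uconj /infact.
rewrite !krausB (krausZ _ X) (krausZ _ (gauge c W X)) !kraus_tens1l !kraus_mulr.
rewrite !kraus_gauge_uconj.
exact: uconj_commutator.
Qed.

Lemma uconj_herm W (M : 'M[R]_d) : W \is unitarymx ->
  exists M', uconj W (herm M) = herm M' /\ \tr M' = \tr M.
Proof.
move=> uW; exists (hmx (uconj W (herm M))).
have h : (uconj W (herm M))^t* = uconj W (herm M) by rewrite uconj_adj herm_adj.
rewrite hmxK //; split => //; apply: (@complexI R).
by rewrite -!trace_herm hmxK // uconj_trace.
Qed.

Lemma cz_tau V m : cz (tau V m) = infact ('i *: herm (vec_mx m)) (\tr (vec_mx m)) V.
Proof. exact: rzK. Qed.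

Definition stab V c W := [/\ `|c| = 1, W \is unitarymx & gauge c W V = V].

Lemma stabV V c W : stab V c W -> stab V c^* (W^t*).
Proof.
move=> [nc uW e]; split; [by rewrite norm_conjC|by rewrite trmxC_unitary|].
by rewrite -{1}e gaugeK.
Qed.

Lemma stabM V c1 c2 W1 W2 : stab V c1 W1 -> stab V c2 W2 -> stab V (c2 * c1) (W2 *m W1).
Proof.
move=> [nc1 uW1 e1] [nc2 uW2 e2]; split; last by rewrite -gauge_gauge e1 e2.
  by rewrite normrM nc1 nc2 mulr1.
exact: mul_unitarymx uW2 uW1.
Qed.

Lemma stab1 V : stab V 1 1%:M.
Proof.
split; rewrite ?normr1 ?gauge1 //.
by apply/unitarymxP; rewrite trmx1 map_mx1 mulmx1.
Qed.

Section AtIsometry.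
Variable V : 'M[C]_(d * k, d).
Hypotheses (iV : isometry V) (IV : irreducible V).
Variable B : 'M[R]_(@slice_dim d k, N).
Hypotheses (fB : row_free B) (HB : forall v : 'rV[R]_N, (v <= B)%MS <->
  v *m (Nor V)^T = 0 /\ v *m (Tau V)^T = 0).

Lemma stab_tau c W v : stab V c W ->
  v *m (Tau V)^T = 0 -> gact c W v *m (Tau V)^T = 0.
Proof.
move=> st e2; have [nc uW eV] := st.
have uW' : W^t* \is unitarymx by rewrite trmxC_unitary.
have [nc' _ eV'] := stabV st.
have gK X : gauge c W (gauge c^* (W^t*) X) = X.
  by have := gaugeK X nc' uW'; rewrite conjCK trmxCK.
apply/mulTauT => x; rewrite cz_gact -[cz (tau V x)]gK rdot_gauge //.
have [M' [eM' tM']] := uconj_herm (vec_mx x) uW'.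
have -> : gauge c^* (W^t*) (cz (tau V x)) = cz (tau V (mxvec M')).
  apply: etrans (congr1 (gauge c^* (W^t*)) (cz_tau V x)) _.
  apply: etrans (gauge_infact c^* _ _ _ uW') _.
  apply: etrans _ (esym (cz_tau V (mxvec M'))).
  by rewrite eV' (uconjZ (W^t*) 'i (herm (vec_mx x))) eM' mxvecK tM'.
exact: (proj1 (mulTauT V v)).
Qed.

(** A stabilizer acts orthogonally and preserves the orbit directions and the directions [V S],
    hence also their common orthogonal complement. *)
Lemma slice_invariant c W v : stab V c W -> (v <= B)%MS -> (gact c W v <= B)%MS.
Proof.
move=> st /HB[e1 e2]; apply/HB; have [nc uW eV] := st.
have uW' : W^t* \is unitarymx by rewrite trmxC_unitary.
have [nc' _ eV'] := stabV st.
have gK X : gauge c W (gauge c^* (W^t*) X) = X.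
  by have := gaugeK X nc' uW'; rewrite conjCK trmxCK.
split; last exact: stab_tau.
apply/mulNorT => S hS; rewrite cz_gact -[V *m S]gK rdot_gauge //.
rewrite gauge_mulmx // eV'; apply: (proj1 (mulNorT V v)) => //.
by rewrite uconj_adj hS.
Qed.

Definition gmx c W : 'M[R]_N := lin1_mx (gact c W).

Lemma mul_gmx c W v : v *m gmx c W = gact c W v.
Proof. exact: mul_rV_lin1. Qed.

(** The action preserves the Euclidean product, so its matrix is orthogonal and transposition is
    inversion. *)
Lemma gmx_tr c W : `|c| = 1 -> W \is unitarymx -> (gmx c W)^T = gmx c^* (W^t*).
Proof.
move=> nc uW.
have dotE (u v : 'rV[R]_N) : (u *m v^T) 0 0 = rdot (cz u) (cz v).
  by rewrite -rz_dot !czK.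
have GG : gmx c W *m (gmx c W)^T = 1%:M.
  have rowdot (M : 'M[R]_N) i j : (row i M *m (row j M)^T) 0 0 = (M *m M^T) i j.
    by rewrite !mxE; apply: eq_bigr => l _; rewrite !mxE.
  have gdot (u v : 'rV[R]_N) : (gact c W u *m (gact c W v)^T) 0 0 = (u *m v^T) 0 0.
    apply: etrans (dotE _ _) _; apply: etrans _ (esym (dotE _ _)).
    by rewrite -(rdot_gauge (cz u) (cz v) nc uW); congr rdot; exact: cz_gact.
  apply/matrixP => i j; apply: etrans (esym (rowdot _ i j)) _.
  rewrite (rowE i) (rowE j) mul_gmx mul_gmx gdot.
  by rewrite -[delta_mx 0 i]mulmx1 -[delta_mx 0 j]mulmx1 -!rowE rowdot trmx1 mulmx1.
have G'G : gmx c^* (W^t*) *m gmx c W = 1%:M.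
  by apply/row_matrixP => i; rewrite row_mul rowE !mul_gmx gactKV // rowE mulmx1.
exact: mulmx_inv_unique G'G GG.
Qed.

(** Because the inverse, which is the transpose, preserves the slice directions, the slice
    coordinates of the image depend linearly on the slice coordinates of [v] alone. *)
Lemma stab_matrix c W : stab V c W ->
  exists M, forall v, gact c W v *m B^T = v *m B^T *m M.
Proof.
move=> st; have [nc uW eV] := st.
have sub : (B *m (gmx c W)^T <= B)%MS.
  apply/row_subP => i; rewrite row_mul gmx_tr // mul_gmx.
  by apply: slice_invariant (stabV st) _; exact: row_sub.
have [D eD] := submxP sub; exists D^T => v.
by rewrite -mul_gmx -!mulmxA -[gmx c W]trmxK -!trmx_mul eD trmx_mul.
Qed.

(** The image of the stabilizer in the matrices; elements acting trivially on the slice are thereby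
    identified with the unit. *)
Definition isotropy : set 'M[R]_(@slice_dim d k) := [set M | exists c W,
  stab V c W /\ forall v, gact c W v *m B^T = v *m B^T *m M].

Lemma slice_coord_inj (M M' : 'M[R]_(@slice_dim d k)) :
  (forall v : 'rV[R]_N, v *m B^T *m M = v *m B^T *m M') -> M = M'.
Proof.
move=> H; have full : row_full B^T by rewrite /row_full mxrank_tr.
have [D eD] : exists D : 'M[R]_(_, N), D *m B^T = 1%:M by exact/row_fullP.
apply/row_matrixP => i; rewrite -[M]mul1mx -[M']mul1mx -eD -!mulmxA !row_mul.
by rewrite !mulmxA H.
Qed.

Lemma isotropy1 : isotropy 1%:M.
Proof.
by exists 1, 1%:M; split=> [|v]; [exact: stab1|rewrite gact1 mulmx1].
Qed.

Lemma isotropyM M M' : isotropy M -> isotropy M' -> isotropy (M *m M').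
Proof.
move=> [c [W [st e]]] [c' [W' [st' e']]]; exists (c' * c), (W' *m W).
split=> [|v]; first exact: stabM.
by rewrite -gact_comp e' e mulmxA.
Qed.

Lemma isotropyV M : isotropy M -> exists2 M', isotropy M' & M *m M' = 1%:M.
Proof.
move=> [c [W [st e]]]; have [M' e'] := stab_matrix (stabV st).
exists M'; first by exists c^*, (W^t*); split => //; exact: stabV.
have [nc uW _] := st.
apply: slice_coord_inj => v; rewrite mulmx1 mulmxA -e -e'.
by rewrite gactK.
Qed.

Lemma stab_kraus c W i : stab V c W -> W *m kraus V i = c *: (kraus V i *m W).
Proof.
move=> [nc uW e]; have /(congr1 (fun X => kraus X i)) := e.
rewrite kraus_gauge => {2}<-; rewrite -scalemxAl scalerA -normCK nc expr1n scale1r.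
by rewrite -mulmxA unitarymxPl // mulmx1.
Qed.

Lemma stab_unique c W W' X : stab V c W -> stab V c W' -> gauge c W X = gauge c W' X.
Proof.
move=> st st'; have [nc uW e] := st; have [_ uW' e'] := st'.
have d0 := irreducible_dim IV.
have comm i : W^t* *m W' *m kraus V i = kraus V i *m (W^t* *m W').
  have h : W^t* *m kraus V i = c^* *: (kraus V i *m W^t*).
    exact: stab_kraus (stabV st).
  rewrite -mulmxA (stab_kraus i st') -scalemxAr mulmxA h -scalemxAl scalerA.
  by rewrite -normCK nc expr1n scale1r mulmxA.
have [a ea] : exists a, W^t* *m W' = a%:M.
  apply: (irreducible_channel_fixed iV IV); rewrite channelE mixedE.
  rewrite -[RHS]mul1mx -(isometryE iV) mulmx_suml; apply: eq_bigr => i _.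
  by rewrite -!mulmxA -comm !mulmxA.
have eW : W' = a *: W.
  have /unitarymxP WW := uW.
  by rewrite -[W']mul1mx -WW -mulmxA ea mul_mx_scalar.
have na : a * a^* = 1.
  have /unitarymxP := uW'; rewrite eW adjmxZ -scalemxAl -scalemxAr scalerA.
  have /unitarymxP -> := uW; rewrite scalemx1 => /matrixP/(_ (Ordinal d0) (Ordinal d0)).
  by rewrite !mxE eqxx.
apply: kraus_inj => i; rewrite !kraus_gauge eW adjmxZ; congr (_ *: _).
by rewrite -!scalemxAl -scalemxAr scalerA na scale1r.
Qed.

Lemma isotropy_finite : finite_set isotropy.
Proof.
have [rs cp] := closed_field_poly_normal (char_poly (lin_mx (mixed V V))).
have /monicP lc := char_poly_monic (lin_mx (mixed V V)); rewrite lc scale1r in cp.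
pose P c := [set M : 'M[R]_(@slice_dim d k) | exists W,
  stab V c W /\ forall v, gact c W v *m B^T = v *m B^T *m M].
(* Each phase determines at most one matrix, so [isotropy] lies in the image of the finite set of
   eigenvalues. Eigenvalues that are not phases of a stabilizer are sent to the default 0, which is
   harmless for an inclusion. *)
apply: (@sub_finite_set _ _ ((fun c => xget 0 (P c)) @` [set` rs])); last first.
  by apply: finite_image; exact: finite_seq.
move=> M [c [W [st e]]]; exists c.
  rewrite /= -root_prod_XsubC -cp -eigenvalue_root_char; apply/eigenvalueP.
  have [nc uW _] := st.
  exists (mxvec W); last first.
    have WU := unitarymx_unit uW; have d0 := irreducible_dim IV.
    apply/eqP => /(congr1 vec_mx); rewrite mxvecK linear0 => W0.
    have := unitarymxPl uW; rewrite W0 mulmx0 => /matrixP/(_ (Ordinal d0) (Ordinal d0)).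
    by rewrite !mxE eqxx => /eqP; rewrite eq_sym oner_eq0.
  rewrite mul_vec_lin -linearZ; congr mxvec.
  rewrite /= mixedE -[in RHS](mul1mx W) -(isometryE iV) mulmx_suml scaler_sumr.
  apply: eq_bigr => i _; rewrite -mulmxA (stab_kraus i st) -scalemxAr.
  by rewrite mulmxA.
apply: xget_unique; first by exists W.
move=> M' [W' [st' e']]; apply: slice_coord_inj => v; rewrite -e -e'.
by rewrite /gact (stab_unique (cz v) st st').
Qed.

Lemma isotropy_mxgroup : exists H : mxgroup, forall M, M \in mxg_seq H <-> isotropy M.
Proof.
have /finite_seqP[s es] := isotropy_finite.
have mem M : M \in s <-> isotropy M by rewrite es.
unshelve eexists (@MxGroup _ _ s _ _ _).
- by apply/mem; exact: isotropy1.
- by move=> M M' /mem HM /mem HM'; apply/mem; exact: isotropyM.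
- by move=> M /mem /isotropyV[M' HM' e]; exists M' => //; apply/mem.
- exact: mem.
Qed.

End AtIsometry.
End Stabilizer.

(** * Derivatives of curves and smoothness of maps in real row coordinates *)

Section RowDerivative.
Context {R : realType}.
Local Notation C := R[i].

Definition rderive p (f : R -> 'rV[R]_p) (f' : 'rV[R]_p) :=
  forall j, is_derive (0 : R) 1 (fun t => f t 0 j) (f' 0 j).

Lemma rderive_row_mx p q (f : R -> 'rV[R]_p) (g : R -> 'rV[R]_q) f' g' :
  rderive f f' -> rderive g g' -> rderive (fun t => row_mx (f t) (g t)) (row_mx f' g').
Proof.
move=> df dg j; rewrite -[j]splitK; case: (fintype.split j) => l /=.
  by rewrite row_mxEl; under eq_fun do rewrite row_mxEl; exact: df.
by rewrite row_mxEr; under eq_fun do rewrite row_mxEr; exact: dg.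
Qed.

Lemma rderive_rz p q (F : R -> 'M[C]_(p, q)) F' : mderive F F' ->
  rderive (fun t => rz (F t)) (rz F').
Proof.
move=> dF; apply: rderive_row_mx => j; case/mxvec_indexP: j => a b.
  by rewrite mxvecE mxE; under eq_fun do rewrite mxvecE mxE; have [] := dF a b.
by rewrite mxvecE mxE; under eq_fun do rewrite mxvecE mxE; have [] := dF a b.
Qed.

Lemma is_derive_sumr (I : Type) (r : seq I) (F : I -> R -> R) (F' : I -> R) :
  (forall i, is_derive (0 : R) 1 (F i) (F' i)) ->
  is_derive (0 : R) 1 (fun t => \sum_(i <- r) F i t) (\sum_(i <- r) F' i).
Proof.
move=> H; elim: r => [|i r IH].
  by rewrite big_nil; under eq_fun do rewrite big_nil; exact: is_derive_cst.
by rewrite big_cons; under eq_fun do rewrite big_cons; exact: is_deriveD.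
Qed.

Lemma is_derive_mulr (f : R -> R) f' c : is_derive (0 : R) 1 f f' ->
  is_derive (0 : R) 1 (fun t => f t * c) (f' * c).
Proof.
move=> df; have dc : is_derive (0 : R) (1 : R) (cst c) (0 : R) by exact: is_derive_cst.
apply: is_derive_val (is_deriveM df dc).
by rewrite /GRing.scale /= mulr0 add0r mulrC.
Qed.

Lemma rderive_mulmx p q (f : R -> 'rV[R]_p) f' (M : 'M[R]_(p, q)) : rderive f f' ->
  rderive (fun t => f t *m M) (f' *m M).
Proof.
move=> df j; rewrite mxE; under eq_fun do rewrite mxE.
by apply: is_derive_sumr => i; exact: is_derive_mulr.
Qed.

Lemma rderiveD p (f g : R -> 'rV[R]_p) f' g' : rderive f f' -> rderive g g' ->
  rderive (fun t => f t + g t) (f' + g').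
Proof.
by move=> df dg j; rewrite mxE; under eq_fun do rewrite mxE; exact: is_deriveD.
Qed.

Lemma rderive_cst p (v : 'rV[R]_p) : rderive (cst v) 0.
Proof. by move=> j; rewrite mxE; exact: is_derive_cst. Qed.

Lemma rderive_hmx d (F : R -> 'M[C]_d) F' : mderive F F' ->
  rderive (fun t => mxvec (hmx (F t))) (mxvec (hmx F')).
Proof.
move=> dF j; case/mxvec_indexP: j => a b; rewrite mxvecE mxE.
by under eq_fun do rewrite mxvecE mxE; have [d1 d2] := dF a b; exact: is_deriveD.
Qed.

Lemma rderive_const (f : R -> R) f' : is_derive (0 : R) 1 f f' ->
  rderive (fun t => const_mx (f t) : 'rV[R]_1) (const_mx f').
Proof. by move=> df j; rewrite mxE; under eq_fun do rewrite mxE; exact: df. Qed.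

Lemma rderive_eq p (f : R -> 'rV[R]_p) a b : rderive f a -> rderive f b -> a = b.
Proof.
move=> da db; apply/rowP => j.
have /(@derive_val _ _ _ _ _ _ _) <- := da j.
by have /(@derive_val _ _ _ _ _ _ _) <- := db j.
Qed.

Lemma rderive_direction n p (f : 'rV[R]_n -> 'rV[R]_p) z u : differentiable f z ->
  rderive (fun t => f (z + t *: u)) ('d f z u).
Proof.
move=> df j; apply: (is_derive_line (f := fun y => f y 0 j)).
rewrite scale0r addr0 -deriveE // derive_row //; apply: derivableP.
by have /differentiable_rowP/(_ j)/diff_derivable := df; exact.
Qed.

Definition row_smooth n p (A : set 'rV[R]_n) (f : 'rV[R]_n -> 'rV[R]_p) :=
  forall j, smooth A (fun x => f x 0 j).

Lemma row_smooth_row_mx n p q A (f : 'rV[R]_n -> 'rV[R]_p) (g : 'rV[R]_n -> 'rV[R]_q) :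
  row_smooth A f -> row_smooth A g -> row_smooth A (fun x => row_mx (f x) (g x)).
Proof.
move=> sf sg j; rewrite -[j]splitK; case: (fintype.split j) => l /=.
  by under eq_fun do rewrite row_mxEl; exact: sf.
by under eq_fun do rewrite row_mxEr; exact: sg.
Qed.

Lemma row_smooth_lsubmx n p q A (f : 'rV[R]_n -> 'rV[R]_(p + q)) :
  row_smooth A f -> row_smooth A (fun x => lsubmx (f x)).
Proof. by move=> sf j; under eq_fun do rewrite mxE; exact: sf. Qed.

Lemma row_smooth_rsubmx n p q A (f : 'rV[R]_n -> 'rV[R]_(p + q)) :
  row_smooth A f -> row_smooth A (fun x => rsubmx (f x)).
Proof. by move=> sf j; under eq_fun do rewrite mxE; exact: sf. Qed.

Lemma row_smooth_id n (A : set 'rV[R]_n) : row_smooth A (fun x => x).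
Proof. by move=> j t; exact: Cn_coord. Qed.

Lemma row_smooth_cst n p (A : set 'rV[R]_n) (v : 'rV[R]_p) : row_smooth A (fun=> v).
Proof. by move=> j t; exact: Cn_cst. Qed.

Lemma row_smoothD n p A (f g : 'rV[R]_n -> 'rV[R]_p) : open A ->
  row_smooth A f -> row_smooth A g -> row_smooth A (fun x => f x + g x).
Proof.
by move=> oA sf sg j t; under eq_fun do rewrite mxE; apply: CnD => //; [exact: sf|exact: sg].
Qed.

Lemma row_smooth_mulmx n p q A (f : 'rV[R]_n -> 'rV[R]_p) (M : 'M[R]_(p, q)) : open A ->
  row_smooth A f -> row_smooth A (fun x => f x *m M).
Proof. by move=> oA sf j; exact: smooth_mulmx. Qed.

Lemma row_smooth_rz n p q A (F : 'rV[R]_n -> 'M[C]_(p, q)) :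
  msmooth A F -> row_smooth A (fun x => rz (F x)).
Proof. by move=> sF j; exact: smooth_rz. Qed.

Lemma row_smooth_hmx n d A (F : 'rV[R]_n -> 'M[C]_d) : open A ->
  msmooth A F -> row_smooth A (fun x => mxvec (hmx (F x))).
Proof.
move=> oA sF j t; case/mxvec_indexP: j => a b; under eq_fun do rewrite mxvecE mxE.
by have [s1 s2] := sF a b; exact: CnD.
Qed.

Lemma row_smooth_const n A (f : 'rV[R]_n -> R) : smooth A f ->
  row_smooth A (fun x => const_mx (f x) : 'rV[R]_1).
Proof. by move=> sf j; under eq_fun do rewrite mxE; exact: sf. Qed.

Lemma msmooth_gauge n d k A (c : 'rV[R]_n -> C) (W : 'rV[R]_n -> 'M[C]_d)
    (V : 'rV[R]_n -> 'M[C]_(d * k, d)) : open A ->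
  csmooth A c -> msmooth A W -> msmooth A V ->
  msmooth A (fun x => gauge (c x) (W x) (V x)).
Proof.
move=> oA sc sW sV; apply: msmoothZ => //; first exact: csmooth_conj.
apply: msmoothM => //; last exact: msmooth_adj.
by apply: msmoothM => //; exact: msmooth_tens1.
Qed.

End RowDerivative.

(** * The slice map and the injectivity of its derivative *)

Section SliceMap.
Context {R : realType} {d k : nat}.
Local Notation C := R[i].
Local Notation N := (d * k * d + d * k * d)%N.
Local Notation Q := ((d * d + d * d) + (1 * 1 + 1 * 1))%N.
Local Notation sdim := (@slice_dim d k).

Definition zV (z : 'rV[R]_(N + Q)) : 'M[C]_(d * k, d) := cz (lsubmx z).
Definition gW (w : 'rV[R]_Q) : 'M[C]_d := cz (lsubmx w).
Definition gc (w : 'rV[R]_Q) : C := (cz (rsubmx w) : 'M[C]_(1, 1)) 0 0.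
(** Pairs (c, W) as points of R^Q; [c] is stored as a 1 x 1 matrix so that [rz] and [cz] apply to
    it, whence the shape 1 * 1 + 1 * 1. *)
Definition genc (c : C) (W : 'M[C]_d) : 'rV[R]_Q :=
  row_mx (rz W) (rz (const_mx c : 'M[C]_(1, 1))).

Lemma gW_enc c W : gW (genc c W) = W.
Proof. by rewrite /gW row_mxKl rzK. Qed.

Lemma gc_enc c W : gc (genc c W) = c.
Proof. by rewrite /gc row_mxKr rzK mxE. Qed.

Lemma genc_dec w : genc (gc w) (gW w) = w.
Proof.
rewrite /genc /gW czK -[RHS]hsubmxK; congr row_mx.
rewrite -[RHS]czK; congr rz; apply/matrixP => i j.
by rewrite [LHS]mxE /gc !ord1.
Qed.

(** There are d^2 equations for unitarity, one for the modulus of the phase and one fixing the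
    scalar ambiguity of [W]. Out of the 2 d^2 + 2 coordinates of a pair this leaves d^2, the
    dimension of U(1) x PU(d). *)
Definition unit_defect (W : 'M[C]_d) (c : C) : 'rV[R]_(d * d + (1 + 1)) :=
  row_mx (mxvec (hmx (W^t* *m W - 1%:M)))
    (row_mx (const_mx (complex.Re (c * c^*) - 1)) (const_mx (complex.Im (\tr W)))).

(* The coordinates of a neighbourhood of V: position along the slice, defect
   from isometry, and position along the orbit. *)
Definition slice_coord V (B : 'M[R]_(sdim, N)) (v : 'rV[R]_N) :
    'rV[R]_(sdim + (d * d + d * d)) :=
  row_mx ((v - rz V) *m B^T)
    (row_mx (mxvec (hmx ((cz v)^t* *m cz v - 1%:M))) (v *m (Tau V)^T)).

(** The first block is a local chart of the ambient space. The second is meant to determine the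
    group element: it vanishes when [g] is a normalized gauge element for which [g V'] has no orbit
    component. *)
Definition slice_map V (B : 'M[R]_(sdim, N)) (z : 'rV[R]_(N + Q)) :
    'rV[R]_((sdim + (d * d + d * d)) + ((d * d + (1 + 1)) + d * d)) :=
  row_mx (slice_coord V B (lsubmx z))
    (row_mx (unit_defect (gW (rsubmx z)) (gc (rsubmx z)))
      (rz (gauge (gc (rsubmx z)) (gW (rsubmx z)) (zV z)) *m (Tau V)^T)).

Lemma msmooth_gW n A (f : 'rV[R]_n -> 'rV[R]_Q) : row_smooth A f ->
  msmooth A (fun x => gW (f x)).
Proof. by move=> sf; apply: msmooth_cz; exact: row_smooth_lsubmx. Qed.

Lemma csmooth_gc n A (f : 'rV[R]_n -> 'rV[R]_Q) : row_smooth A f ->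
  csmooth A (fun x => gc (f x)).
Proof.
move=> sf; have sm : msmooth A (fun x => cz (rsubmx (f x)) : 'M[C]_(1, 1)).
  by apply: msmooth_cz; exact: row_smooth_rsubmx.
exact: sm.
Qed.

Lemma smooth_unit_defect n A (W : 'rV[R]_n -> 'M[C]_d) (c : 'rV[R]_n -> C) : open A ->
  msmooth A W -> csmooth A c -> row_smooth A (fun x => unit_defect (W x) (c x)).
Proof.
move=> oA sW sc; apply: row_smooth_row_mx; last apply: row_smooth_row_mx.
- apply: row_smooth_hmx => //; apply: msmoothD => //; last exact: msmooth_cst.
  by apply: msmoothM => //; exact: msmooth_adj.
- apply: row_smooth_const => t; apply: CnD => //; last exact: Cn_cst.
  by have [] := csmoothM oA sc (csmooth_conj oA sc).
- apply: row_smooth_const.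
  have [] : csmooth A (fun x => \tr (W x)).
    by apply: csmooth_sum => // i; exact: sW.
  by [].
Qed.

Lemma smooth_slice_coord V B n A (f : 'rV[R]_n -> 'rV[R]_N) : open A ->
  row_smooth A f -> row_smooth A (fun x => slice_coord V B (f x)).
Proof.
move=> oA sf; have sV : msmooth A (fun x => cz (f x)) by exact: msmooth_cz.
apply: row_smooth_row_mx; last apply: row_smooth_row_mx.
- by apply: row_smooth_mulmx => //; apply: row_smoothD => //; exact: row_smooth_cst.
- apply: row_smooth_hmx => //; apply: msmoothD => //; last exact: msmooth_cst.
  by apply: msmoothM => //; exact: msmooth_adj.
- exact: row_smooth_mulmx.
Qed.

Lemma smooth_slice_map V B : smooth_on setT (slice_map V B).
Proof.
apply/smooth_onP; first exact: openT.
have oT : open [set: 'rV[R]_(N + Q)] by exact: openT.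
have sl : row_smooth setT (fun z : 'rV[R]_(N + Q) => lsubmx z).
  by apply: row_smooth_lsubmx; exact: row_smooth_id.
have sr : row_smooth setT (fun z : 'rV[R]_(N + Q) => rsubmx z).
  by apply: row_smooth_rsubmx; exact: row_smooth_id.
apply: row_smooth_row_mx; first exact: smooth_slice_coord.
apply: row_smooth_row_mx.
  by apply: smooth_unit_defect => //; [exact: msmooth_gW|exact: csmooth_gc].
apply: row_smooth_mulmx => //; apply: row_smooth_rz; apply: msmooth_gauge => //.
- exact: csmooth_gc.
- exact: msmooth_gW.
- exact: msmooth_cz.
Qed.

Section AtIsometry.
Variable V : 'M[C]_(d * k, d).
Hypotheses (iV : isometry V) (IV : irreducible V).
Variable B : 'M[R]_(sdim, N).
Hypotheses (fB : row_free B) (HB : forall v : 'rV[R]_N, (v <= B)%MS <->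
  v *m (Nor V)^T = 0 /\ v *m (Tau V)^T = 0).

Definition base_point : 'rV[R]_(N + Q) := row_mx (rz V) (genc 1 1%:M).

Lemma mderive_val p q (F : R -> 'M[C]_(p, q)) a b : a = b -> mderive F a -> mderive F b.
Proof. by move=> ->. Qed.

Lemma slice_map_derive (u : 'rV[R]_(N + Q)) :
  let X := zV u in let O := gW (rsubmx u) in let g := gc (rsubmx u) in
  rderive (fun t => slice_map V B (base_point + t *: u))
    (row_mx (row_mx (rz X *m B^T) (row_mx (mxvec (hmx (X^t* *m V + V^t* *m X)))
        (rz X *m (Tau V)^T)))
      (row_mx (row_mx (mxvec (hmx (O^t* + O)))
          (row_mx (const_mx (complex.Re (g + g^*))) (const_mx (complex.Im (\tr O)))))
        (rz (g^* *: V + ((O *t 1%:M) *m V + X + V *m O^t*)) *m (Tau V)^T))).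
Proof.
move=> X O g.
have eL t : lsubmx (base_point + t *: u) = rz (V + t%:C *: X).
  rewrite linearD linearZ /= row_mxKl rzD rzZ; congr (_ + _ *: _).
  by rewrite /X /zV czK.
have eV t : zV (base_point + t *: u) = V + t%:C *: X.
  by rewrite /zV eL rzK.
have eW t : gW (rsubmx (base_point + t *: u)) = 1%:M + t%:C *: O.
  by rewrite /gW !linearD !linearZ /= row_mxKr row_mxKl czD rzK czZ.
have ec t : gc (rsubmx (base_point + t *: u)) = 1 + t%:C * g.
  rewrite /gc !linearD !linearZ /= row_mxKr row_mxKr czD rzK czZ.
  by rewrite [LHS]mxE [X in X + _]mxE [X in _ + X]mxE.
rewrite /slice_map /slice_coord.
under eq_fun do rewrite eL eV eW ec rzK.
have dV : mderive (fun t => V + t%:C *: X) X by exact: mderive_affine.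
have dW : mderive (fun t => 1%:M + t%:C *: O) O by exact: mderive_affine.
have dc : cderive (fun t => 1 + t%:C * g) g by exact: cderive_affine.
have z0 : (0 : R)%:C = 0 :> C by [].
apply: rderive_row_mx; first (apply: rderive_row_mx; last apply: rderive_row_mx).
- apply: rderive_mulmx; rewrite -[rz X]addr0.
  by apply: rderiveD; [exact: rderive_rz|exact: rderive_cst].
- apply: rderive_hmx; rewrite -[_ + _ *m X]addr0; apply: mderiveD; last exact: mderive_cst.
  have := mderiveM (mderive_adj dV) dV.
  by rewrite z0 !scale0r !addr0.
- by apply: rderive_mulmx; exact: rderive_rz.
apply: rderive_row_mx; first (apply: rderive_row_mx; last apply: rderive_row_mx).
- apply: rderive_hmx; rewrite -[_ + O]addr0; apply: mderiveD; last exact: mderive_cst.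
  have := mderiveM (mderive_adj dW) dW.
  by rewrite z0 !scale0r !addr0 mulmx1 trmx1 map_mx1 mul1mx.
- apply: rderive_const; rewrite -[complex.Re _]addr0; apply: is_deriveD.
    have [] := cderiveM dc (cderive_conj dc).
    by rewrite z0 mul0r addr0 rmorph1 mulr1 mul1r.
- apply: rderive_const.
  have [] : cderive (fun t => \tr (1%:M + t%:C *: O)) (\tr O) by exact: cderive_sum.
  by [].
apply: rderive_mulmx; apply: rderive_rz.
apply: mderive_val (mderiveZ (cderive_conj dc)
  (mderiveM (mderiveM (mderive_tens1 (k := k) dW) dV) (mderive_adj dW))).
rewrite z0 mul0r !scale0r !addr0 conjC1 scale1r trmx1 map_mx1 !mulmx1.
by rewrite tens11mx !mul1mx.
Qed.

Lemma rz_dot0 (p q : nat) (v : 'rV[R]_(p * q + p * q)) : (v *m v^T) 0 0 = 0 -> v = 0.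
Proof.
by rewrite -{1 2}[v]czK rz_dot => /rdot_eq0 e; rewrite -[v]czK e rz0.
Qed.

(** Infinitesimal isometries are orthogonal to the directions [V S], so [X] lies in the span of [B];
    its slice coordinates vanish, so it is also orthogonal to that span, hence to itself. *)
Lemma slice_tangent_inj X : rz X *m B^T = 0 -> X^t* *m V + V^t* *m X = 0 ->
  rz X *m (Tau V)^T = 0 -> X = 0.
Proof.
move=> e1 e2 e3; have XB : (rz X <= B)%MS.
  apply/HB; split => //; apply/mulNorT => S hS; rewrite rzK.
  have skew : (X^t* *m V)^t* = - (X^t* *m V).
    rewrite adjmxM trmxCK; apply/eqP; rewrite -addr_eq0 addrC; exact/eqP.
  by rewrite /rdot mulmxA reC_trace_skew_herm.
have [D eD] := submxP XB.
apply: rz_inj; apply: rz_dot0.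
by rewrite {2}eD trmx_mul mulmxA e1 mul0mx mxE.
Qed.

Lemma mxvec_eq0 p q (M : 'M[R]_(p, q)) : mxvec M = 0 -> M = 0.
Proof. by move=> e; rewrite -[M]mxvecK e linear0. Qed.

(** The tangent vector is a value of [tau] and is orthogonal to all values of [tau], hence 0;
    injectivity of [tau] concludes. *)
Lemma gauge_tangent_inj (O : 'M[C]_d) (g : C) :
  O^t* + O = 0 -> complex.Re (g + g^*) = 0 -> complex.Im (\tr O) = 0 ->
  rz (g^* *: V + ((O *t 1%:M) *m V + V *m O^t*)) *m (Tau V)^T = 0 ->
  O = 0 /\ g = 0.
Proof.
move=> hO hg hT hs.
have sO : O^t* = - O by apply/eqP; rewrite -addr_eq0; apply/eqP.
have d0 := irreducible_dim IV.
pose t := complex.Im g.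
have gE : g = 'i * t%:C.
  apply: complex_eqP; rewrite -complexiE /= ?mul0r ?mulr0 ?subr0 ?sub0r ?mul1r ?addr0 ?oppr0 ?add0r //.
  by move: hg; rewrite conjCE ReCD /=; lra.
have trO : \tr O = 0.
  apply: complex_eqP => //=.
  have : complex.Re ((\tr O)^*) = complex.Re (- \tr O).
    by rewrite -mxtrace_adj sO linearN.
  by rewrite conjCE ReCN /=; lra.
(* Adding a scalar does not change the infinitesimal action and gives [A] the trace i t, as the
   parametrization [tau] demands. *)
pose A := O + ('i * (t / d%:R)%:C)%:M.
pose S := - 'i *: A.
have AS : A = 'i *: S by rewrite /S scalerA mulrN -expr2 sqrCi opprK scale1r.
have et (x : R) : (x%:C)^* = x%:C by rewrite conjCE /= oppr0.
have hA : A^t* = - A.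
  rewrite /A adjmxD sO adjmx_scalar rmorphM /= conjCi et mulNr opprD.
  by rewrite [(- _)%:M]raddfN.
have hS : S^t* = S by rewrite /S adjmxZ hA rmorphN /= conjCi opprK scalerN scaleNr.
have trA : \tr A = 'i * t%:C.
  rewrite /A linearD /= trO add0r mxtrace_scalar -mulrnAr; congr (_ * _).
  rewrite -rmorphMn /= -[t / _ *+ _]mulr_natr divfK //.
  by rewrite pnatr_eq0 -lt0n.
pose M := hmx S.
have trM : \tr M = t.
  apply: (@complexI R); rewrite -trace_herm hmxK // /S linearZ /= trA mulrA mulNr.
  by rewrite -expr2 sqrCi opprK mul1r.
have eT : rz (g^* *: V + ((O *t 1%:M) *m V + V *m O^t*)) = tau V (mxvec M).
  rewrite /tau mxvecK hmxK // -AS trM; congr rz.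
  rewrite gE rmorphM /= conjCi et mulNr sO /infact /A tens1D mulmxDl mulmxDr.
  rewrite mulmxN scaleNr mul_mx_scalar.
  have -> : (('i * (t / d%:R)%:C)%:M *t (1%:M : 'M[C]_k)) *m V = ('i * (t / d%:R)%:C) *: V.
    by rewrite -[X in X *t _]scalemx1 tens1Z tens11mx -scalemxAl mul1mx.
  move: (_ *m V) (V *m O) (_ *: V) (_ *: V) => a b e f.
  by apply/matrixP => i j; rewrite !mxE; ring.
have tau0 : tau V (mxvec M) = 0.
  apply: rz_dot0; rewrite -{2}mulTau trmx_mul mulmxA -eT hs.
  by rewrite mul0mx mxE.
have M0 : M = 0 by apply: mxvec_eq0; exact: tau_eq0 tau0.
have A0 : A = 0 by rewrite AS -[S]hmxK // -/M M0 herm0 scaler0.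
have t0 : t = 0.
  by apply: (@complexI R); rewrite -trM M0 mxtrace0.
move: A0; rewrite /A gE t0 mul0r mulr0 raddf0 addr0 => ->.
by [].
Qed.

Lemma slice_map_immersion u : 'd (slice_map V B) base_point u = 0 -> u = 0.
Proof.
have df : differentiable (slice_map V B) base_point.
  by have [H _] := smooth_slice_map V B 1%N; exact: H.
move=> du; have := rderive_eq (rderive_direction u df) (slice_map_derive u).
rewrite du => /esym; set X := zV u; set O := gW _; set g := gc _.
rewrite -[RHS]row_mx0 => /eq_row_mx[].
rewrite -[in X in _ = X]row_mx0 => /eq_row_mx[e1].
rewrite -[in X in _ = X]row_mx0 => /eq_row_mx[e2 e3].
rewrite -[in X in _ = X]row_mx0 => /eq_row_mx[].
rewrite -[in X in _ = X]row_mx0 => /eq_row_mx[e4].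
rewrite -[in X in _ = X]row_mx0 => /eq_row_mx[e5 e6] e7.
have X0 : X = 0.
  apply: slice_tangent_inj => //; apply: hmx_eq0; last exact: mxvec_eq0.
  by rewrite adjmxD !adjmxM !trmxCK addrC.
have [eO eg] : O = 0 /\ g = 0.
  apply: gauge_tangent_inj.
  - apply: hmx_eq0; last exact: mxvec_eq0.
    by rewrite adjmxD trmxCK addrC.
  - by move/rowP/(_ 0): e5; rewrite !mxE.
  - by move/rowP/(_ 0): e6; rewrite !mxE.
  - by move: e7; rewrite X0 addr0.
have el : lsubmx u = 0 by rewrite -[lsubmx u]czK -/(zV u) -/X X0 rz0.
have er : rsubmx u = 0.
  rewrite -[rsubmx u]genc_dec -/O -/g eO eg /genc rz0.
  have -> : (const_mx 0 : 'M[C]_(1, 1)) = 0 by apply/matrixP => i j; rewrite !mxE.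
  by rewrite rz0 row_mx0.
by rewrite -[u]hsubmxK el er row_mx0.
Qed.

Lemma slice_map_dim :
  (N + Q = (sdim + (d * d + d * d)) + ((d * d + (1 + 1)) + d * d))%N.
Proof. by rewrite (slice_dimE iV IV); lia. Qed.

Lemma slice_map_inverse : exists O (g : 'rV[R]_((sdim + (d * d + d * d)) +
      ((d * d + (1 + 1)) + d * d)) -> 'rV[R]_(N + Q)),
  [/\ open O, O base_point, open (slice_map V B @` O),
      (forall z, O z -> g (slice_map V B z) = z) &
      smooth_on (slice_map V B @` O) g].
Proof.
have [] := @inverse_function R _ _ setT (slice_map V B) base_point slice_map_dim.
- exact: openT.
- by [].
- exact: smooth_slice_map.
- exact: slice_map_immersion.
by move=> O [g [oO Oz _ ofO [gf sg]]]; exists O, g.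
Qed.

End AtIsometry.
End SliceMap.

(** * Openness of irreducibility among the isometries *)

Section IrreducibleOpen.
Context {R : realType} {d k : nat}.
Local Notation C := R[i].
Local Notation N := (d * k * d + d * k * d)%N.
Implicit Types (V : 'M[C]_(d * k, d)) (X : 'M[C]_d).

(* Invertible exactly when X |-> (tr X, X - T_* X) is injective. *)
Definition stat_op V X : 'M[C]_d := X - predual V X + \tr X *: (d%:R^-1)%:M.

Lemma stat_op_is_linear V : linear (stat_op V).
Proof.
move=> a X Y; rewrite /stat_op !linearP /=.
move: (predual V X) (predual V Y) (\tr X) (\tr Y) (_%:M) => P Q x y M.
by apply/matrixP => i j; rewrite !mxE; ring.
Qed.

HB.instance Definition _ V :=
  GRing.isLinear.Build C 'M[C]_d 'M[C]_d _ (stat_op V) (stat_op_is_linear V).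

Definition stat_mx V : 'M[C]_(d * d) := lin_mx (stat_op V).

Lemma trace_maximally_mixed : (0 < d)%N -> \tr ((d%:R^-1)%:M : 'M[C]_d) = 1.
Proof.
by move=> d0; rewrite mxtrace_scalar -(mulr_natl (d%:R^-1 : C) d) mulfV // pnatr_eq0 -lt0n.
Qed.

Lemma trace_stat_op V X : (0 < d)%N -> isometry V -> \tr (stat_op V X) = \tr X.
Proof.
move=> d0 iV; rewrite /stat_op linearD linearB /= mxtrace_predual // subrr add0r.
by rewrite linearZ /= trace_maximally_mixed // mulr1.
Qed.

Lemma stat_mx_unit V : isometry V -> irreducible V -> stat_mx V \in unitmx.
Proof.
move=> iV IV; have d0 := irreducible_dim IV; have [rho prho sV] := IV.
rewrite -row_free_unit -kermx_eq0; apply/rowV0P => v /sub_kermxP e.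
have eX : stat_op V (vec_mx v) = 0.
  by apply: (can_inj mxvecK); rewrite -mul_vec_lin vec_mxK e linear0.
have trX : \tr (vec_mx v) = 0 by rewrite -(trace_stat_op (vec_mx v) d0 iV) eX mxtrace0.
have fX : predual V (vec_mx v) = vec_mx v.
  by move/eqP: eX; rewrite /stat_op trX scale0r addr0 subr_eq0 => /eqP.
have X0 := irreducible_fixed prho sV fX.
by rewrite trX scale0r in X0; rewrite -[v]vec_mxK X0 linear0.
Qed.

Lemma stat_mx_inj V X Y : stat_mx V \in unitmx -> stat_op V X = stat_op V Y -> X = Y.
Proof.
move=> uV e; apply: (can_inj mxvecK); apply: (can_inj (mulmxK uV)).
apply: etrans (mul_vec_lin (stat_op V) X) _.
by apply: etrans _ (esym (mul_vec_lin (stat_op V) Y)); rewrite /= e.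
Qed.

(** [stat_op] preserves traces, so a solution has trace 1 and the rest of the equation is
    stationarity; injectivity gives uniqueness. *)
Lemma stat_op_irreducible V rho : (0 < d)%N -> isometry V -> stat_mx V \in unitmx ->
  stat_op V rho = (d%:R^-1)%:M -> posdef rho -> irreducible V.
Proof.
move=> d0 iV uV e prho.
have injV X Y : stat_op V X = stat_op V Y -> X = Y by exact: stat_mx_inj.
have tr1 : \tr rho = 1.
  by rewrite -(trace_stat_op rho d0 iV) e trace_maximally_mixed.
have f : predual V rho = rho.
  move: e; rewrite /stat_op tr1 scale1r -[RHS]add0r => /addIr /eqP.
  by rewrite subr_eq0 => /eqP.
exists rho => //; apply/seteqP; split => [s [[_ ts] fs]|_ ->].
  by apply: injV; rewrite /stat_op ts fs tr1 f !subrr.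
split => //; split => // psi; exact: posdef_ge0.
Qed.

Lemma adj_stat_op V X : (stat_op V X)^t* = stat_op V (X^t*).
Proof.
rewrite /stat_op adjmxD adjmxB adj_predual adjmxZ mxtrace_adj adjmx_scalar.
congr (_ + _ *: _%:M); apply/CrealP/ger0_real.
by rewrite invr_ge0 ler0n.
Qed.

Lemma csmooth_prod n (A : set 'rV[R]_n) (I : Type) (r : seq I) (F : I -> 'rV[R]_n -> C) :
  open A -> (forall i, csmooth A (F i)) -> csmooth A (fun x => \prod_(i <- r) F i x).
Proof.
move=> oA H; elim: r => [|i r IH].
  rewrite (_ : (fun _ => _) = cst 1); first exact: csmooth_cst.
  by apply/funext => x; rewrite big_nil.
by under eq_fun do rewrite big_cons; exact: csmoothM.
Qed.

Lemma csmooth_det n p (A : set 'rV[R]_n) (F : 'rV[R]_n -> 'M[C]_p) : open A ->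
  msmooth A F -> csmooth A (fun x => \det (F x)).
Proof.
move=> oA sF; apply: csmooth_sum => // s; apply: csmoothM => //.
  exact: csmooth_cst.
by apply: csmooth_prod => // i; exact: sF.
Qed.

Lemma msmooth_adjugate n p (A : set 'rV[R]_n) (F : 'rV[R]_n -> 'M[C]_p) : open A ->
  msmooth A F -> msmooth A (fun x => \adj (F x)).
Proof.
move=> oA sF i j; under eq_fun do rewrite mxE.
apply: csmoothM => //; first exact: csmooth_cst.
by apply: csmooth_det => // a b; under eq_fun do rewrite !mxE; exact: sF.
Qed.

Lemma msmooth_stat_mx n (A : set 'rV[R]_n) (F : 'rV[R]_n -> 'M[C]_(d * k, d)) : open A ->
  msmooth A F -> msmooth A (fun x => stat_mx (F x)).
Proof.
move=> oA sF u v; case/mxvec_indexP: v => a b.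
pose E : 'M[C]_d := vec_mx (delta_mx 0 u).
have e x : stat_mx (F x) u (mxvec_index a b) =
    (E a b + (\tr E *: (d%:R^-1)%:M : 'M[C]_d) a b) + (-1) * predual (F x) E a b.
  rewrite [LHS]mxE /= mxvecE -/E /stat_op.
  move: (predual (F x) E) (\tr E *: _) => P M; rewrite !mxE; ring.
under eq_fun do rewrite e.
apply: csmoothD => //; first exact: csmooth_cst.
apply: csmoothM => //; first exact: csmooth_cst.
under eq_fun do rewrite mxE; apply: csmooth_sum => // l.
have sP : msmooth A (fun x => F x *m E *m (F x)^t*).
  apply: msmoothM => //; last exact: msmooth_adj.
  by apply: msmoothM => //; exact: msmooth_cst.
exact: sP.
Qed.

(* |det|^2 times the stationary state, a polynomial in the real coordinates. *)
Definition scaled_state V : 'M[C]_d := (\det (stat_mx V))^* *: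
  vec_mx (mxvec ((d%:R^-1)%:M : 'M[C]_d) *m \adj (stat_mx V)).

Lemma scaled_stateE V : stat_mx V \in unitmx ->
  stat_op V (scaled_state V) = (`|\det (stat_mx V)| ^+ 2) *: (d%:R^-1)%:M.
Proof.
move=> uV; rewrite /scaled_state linearZ normCKC -scalerA; congr (_ *: _).
apply: (can_inj mxvecK); rewrite linearZ -mul_vec_lin vec_mxK -/(stat_mx V).
by rewrite -mulmxA mul_adj_mx mul_mx_scalar.
Qed.

Lemma msmooth_scaled_state n (A : set 'rV[R]_n) (F : 'rV[R]_n -> 'M[C]_(d * k, d)) :
  open A -> msmooth A F -> msmooth A (fun x => scaled_state (F x)).
Proof.
move=> oA sF; have sS := msmooth_stat_mx oA sF.
apply: msmoothZ => //; first by apply: csmooth_conj => //; exact: csmooth_det.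
move=> a b; under eq_fun do rewrite mxE.
have sP : msmooth A (fun x => mxvec ((d%:R^-1)%:M : 'M[C]_d) *m \adj (stat_mx (F x))).
  by apply: msmoothM => //; [exact: msmooth_cst|exact: msmooth_adjugate].
exact: sP.
Qed.

Lemma posdefZ (a : C) (rho : 'M[C]_d) : 0 < a -> posdef rho -> posdef (a *: rho).
Proof.
by move=> a0 prho psi psi0; rewrite -/(sesq _ _ _) sesqZ mulr_gt0 //; exact: prho.
Qed.

Lemma posdef_perturbation (rho : 'M[C]_d) : posdef rho -> exists2 e : R, 0 < e &
  forall s : 'M[C]_d, s^t* = s -> (forall i j, `|s i j - rho i j| < e%:C) -> posdef s.
Proof.
move=> prho; have [e e0 He] := posdef_coercive prho.
have /complex_realP[e' ee] := gtr0_real e0.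
have e'0 : 0 < e' by rewrite -ltcR -ee.
have D0 : 0 < (d * d)%:R + 1 :> R by rewrite ltr_wpDl.
(* The d^2 entries of the perturbation then add up to less than the coercivity constant of [rho]. *)
exists (e' / ((d * d)%:R + 1)) => [|s hs close]; first by rewrite divr_gt0.
move=> psi psi0; rewrite -/(sesq _ _ _).
have S0 := sesq1_gt0 psi0; have hrho := posdef_hermitian prho.
have -> : sesq s psi psi = sesq rho psi psi + sesq (s - rho) psi psi.
  by rewrite -sesqD addrC subrK.
have rX : sesq (s - rho) psi psi \is Num.real.
  by apply/CrealP; rewrite -sesq_conj adjmxB hs hrho.
have := sesq_bound (s - rho) psi; rewrite real_ler_norml // => /andP[H _].
set T := \sum_i _ in H.
have TB : T <= (d * d)%:R%:C * (e' / ((d * d)%:R + 1))%:C.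
  apply: (@le_trans _ _ (\sum_(i < d) \sum_(j < d) (e' / ((d * d)%:R + 1))%:C)).
    apply: ler_sum => i _; apply: ler_sum => j _; rewrite !mxE.
    by apply: ltW; exact: close.
  by rewrite !sumr_const !card_ord -mulrnA rmorph_nat mulr_natl.
have Te : T < e.
  apply: le_lt_trans TB _; rewrite ee -rmorphM ltcR mulrCA gtr_pMr //.
  by rewrite ltr_pdivrMr // mul1r ltrDl.
apply: (@lt_le_trans _ _ (e * sesq 1%:M psi psi - T * sesq 1%:M psi psi)).
  by rewrite -mulrBl mulr_gt0 // subr_gt0.
by apply: lerD.
Qed.

(** Invertibility of [stat_mx] and positivity of [scaled_state] are open conditions that together
    imply irreducibility. The scaling makes the state a polynomial, hence continuous without any
    inverse matrix. *)
Lemma irreducible_open V : isometry V -> irreducible V -> exists2 e : R, 0 < e &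
  forall V', isometry V' -> `|rz V' - rz V| < e -> irreducible V'.
Proof.
move=> iV IV; have d0 := irreducible_dim IV; have uV := stat_mx_unit iV IV.
have oT : open [set: 'rV[R]_N] by exact: openT.
have sz : msmooth [set: 'rV[R]_N] (fun x => cz x : 'M[C]_(d * k, d)).
  by apply: msmooth_cz => j t; exact: Cn_coord.
have sdet := csmooth_det oT (msmooth_stat_mx oT sz).
have sst := msmooth_scaled_state oT sz.
have det_neq0 V' : stat_mx V' \in unitmx -> 0 < `|\det (stat_mx V')| ^+ 2.
  by move=> u; rewrite exprn_gt0 // normr_gt0 -unitfE -unitmxE.
have injV V' X Y : stat_mx V' \in unitmx -> stat_op V' X = stat_op V' Y -> X = Y.
  exact: stat_mx_inj.
have [rho prho sV] := IV.
have [[_ tr1] frho] : stationary_states V rho by rewrite sV.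
have e1 : scaled_state V = (`|\det (stat_mx V)| ^+ 2) *: rho.
  apply: (injV V) => //; rewrite scaled_stateE // linearZ /=; congr (_ *: _).
  by rewrite /stat_op frho subrr add0r tr1 scale1r.
have pV : posdef (scaled_state V) by rewrite e1; apply: posdefZ => //; exact: det_neq0.
have [e e0 He] := posdef_perturbation pV.
have cont (f : 'rV[R]_N -> C) : csmooth setT f -> forall x (e : R), 0 < e ->
    \forall y \near x, `|f y - f x| < e%:C.
  move=> [s1 s2] x e' e'0; have h0 : 0 < e' / 2 by rewrite divr_gt0.
  have c1 : {for x, continuous (fun x => complex.Re (f x))} by exact: Cn_continuous (s1 0%N) _.
  have c2 : {for x, continuous (fun x => complex.Im (f x))} by exact: Cn_continuous (s2 0%N) _.
  have n1 : \forall y \near x, `|complex.Re (f x) - complex.Re (f y)| < e' / 2.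
    by move/cvgrPdist_lt: c1; exact.
  have n2 : \forall y \near x, `|complex.Im (f x) - complex.Im (f y)| < e' / 2.
    by move/cvgrPdist_lt: c2; exact.
  near=> y; have -> : e' = (e' / 2) *+ 2 by rewrite -mulr_natl mulrC divfK.
  apply: normC_lt.
    by rewrite ReCD ReCN distrC; near: y.
  by rewrite ImCD ImCN distrC; near: y.
have near_ok : \forall v \near rz V, stat_mx (cz v) \in unitmx /\
    forall i j, `|scaled_state (cz v) i j - scaled_state (cz (rz V)) i j| < e%:C.
  have det0 : 0 < `|\det (stat_mx V)| by rewrite normr_gt0 -unitfE -unitmxE.
  (* [r] is the modulus of the determinant at [V]; a number at distance less than [r] from that
     determinant is not 0. *)
  have /complex_realP[r er] := gtr0_real det0.
  have r0 : 0 < r by rewrite -ltcR -er.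
  have nd : \forall v \near rz V,
      `|\det (stat_mx (cz v)) - \det (stat_mx (cz (rz V)))| < r%:C by exact: cont.
  have ns : \forall v \near rz V, forall i j,
      `|scaled_state (cz v) i j - scaled_state (cz (rz V)) i j| < e%:C.
    have H i j := cont _ (sst i j) (rz V) e e0.
    exact: filter_forall _ (fun i => filter_forall _ (H i)).
  near=> v; split; last by near: v.
  rewrite unitmxE unitfE; apply/eqP => dv0.
  have gen (a b : C) : a = 0 -> `|a - b| < r%:C -> r%:C = `|b| -> False.
    by move=> -> H eb; move: H; rewrite sub0r normrN eb ltxx.
  apply: (gen _ _ dv0 _ (esym er)).
  have eV : \det (stat_mx (cz (rz V))) = \det (stat_mx V) by congr (\det (stat_mx _)); exact: rzK.
  apply: etrans (congr1 (fun D => `|\det (stat_mx (cz v)) - D| < r%:C) (esym eV)) _.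
  by near: v.
move/nbhs_ballP: near_ok => [eps /= eps0 Heps]; exists eps => // V' iV' VV'.
have [u'] : stat_mx (cz (rz V')) \in unitmx /\
    forall i j, `|scaled_state (cz (rz V')) i j - scaled_state (cz (rz V)) i j| < e%:C.
  by apply: Heps; rewrite -ball_normE /= distrC.
rewrite !rzK in u' * => close.
have hs : (scaled_state V')^t* = scaled_state V'.
  apply: (injV V') => //; rewrite -adj_stat_op scaled_stateE // adjmxZ adjmx_scalar.
  congr (_ *: _%:M); apply/CrealP/ger0_real; first exact: ltW (det_neq0 _ u').
  by rewrite invr_ge0 ler0n.
have ps := He _ hs close.
have q0 := det_neq0 _ u'; have iq0 : 0 < (`|\det (stat_mx V')| ^+ 2)^-1 by rewrite invr_gt0.
apply: (stat_op_irreducible d0 iV' u' _ (posdefZ iq0 ps)).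
move: (scaled_stateE u') q0 {iq0}; move: (`|_| ^+ 2) => q E q0.
by rewrite linearZ /= E scalerA mulVf ?scale1r // gt_eqF.
Unshelve. all: by end_near. Qed.

End IrreducibleOpen.

Section GramMatrix.
Context {R : realType}.
Local Notation C := R[i].

Lemma gram_defectP p q (X : 'M[C]_(p, q)) :
  X^t* *m X = 1%:M <-> mxvec (hmx (X^t* *m X - 1%:M)) = 0.
Proof.
split=> [->|/mxvec_eq0 e].
  rewrite subrr (_ : hmx 0 = 0) ?linear0 //.
  by apply/matrixP => i j; rewrite !mxE /= addr0.
apply/eqP; rewrite -subr_eq0; apply/eqP; apply: hmx_eq0 => //.
by rewrite adjmxB adjmxM trmxCK adjmx_scalar conjC1.
Qed.

Lemma norm1_defectP (c : C) : `|c| = 1 <-> complex.Re (c * c^*) - 1 = 0.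
Proof.
rewrite -normCK; split=> [->|/eqP]; first by rewrite expr1n subrr.
rewrite subr_eq0 normc_def -rmorphXn /= sqrp_eq1 ?sqrtr_ge0 // => /eqP ->.
by [].
Qed.

Lemma gram_rz_le p q (X : 'M[C]_(p, q)) : X^t* *m X = 1%:M -> `|rz X| <= 1.
Proof.
move=> XX; apply: mx_norm_le => // i j; rewrite ord1.
have small a b : `|complex.Re (X a b)| <= 1 /\ `|complex.Im (X a b)| <= 1.
  have : `|X a b| <= 1.
    move/matrixP/(_ b b): XX; rewrite !mxE eqxx => e.
    have {}e : _ = 1 := e.
    rewrite -(@ler_pXn2r _ 2) ?nnegrE // expr1n -[leRHS]e (bigD1 a) //= !mxE -normCKC lerDl.
    by apply: sumr_ge0 => l _; rewrite !mxE mulrC mul_conjC_ge0.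
  rewrite normc_def -[1]/(1%:C) lecR => H; split; apply: le_trans H.
    by rewrite -sqrtr_sqr ler_wsqrtr // lerDl sqr_ge0.
  by rewrite -sqrtr_sqr ler_wsqrtr // lerDr sqr_ge0.
rewrite -[j]splitK; case: (fintype.split j) => l /=; case/mxvec_indexP: l => a b.
  by rewrite row_mxEl mxvecE mxE; have [] := small a b.
by rewrite row_mxEr mxvecE mxE; have [] := small a b.
Qed.

Lemma row_smooth_continuous n p (f : 'rV[R]_n -> 'rV[R]_p) :
  row_smooth setT f -> continuous f.
Proof.
move=> sf x; apply/continuous_mxP => i j; rewrite ord1.
exact: Cn_continuous (sf j 0%N) _.
Qed.

Lemma closed_zero_set n p (f : 'rV[R]_n -> 'rV[R]_p) :
  row_smooth setT f -> closed (f @^-1` [set 0]).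
Proof.
move=> sf; apply: closed_comp => [x _|]; first exact: row_smooth_continuous.
apply: accessible_closed_set1; apply: hausdorff_accessible; exact: norm_hausdorff.
Qed.

End GramMatrix.

(** * Compactness of the gauge group *)

Section GaugeGroupCompact.
Context {R : realType} {d : nat}.
Local Notation C := R[i].
Local Notation Q := ((d * d + d * d) + (1 * 1 + 1 * 1))%N.

Definition gauge_group : set 'rV[R]_Q := [set w | gW w \is unitarymx /\ `|gc w| = 1].

Lemma gauge_groupP (w : 'rV[R]_Q) : gauge_group w <->
  mxvec (hmx ((gW w)^t* *m gW w - 1%:M)) = 0 /\ complex.Re (gc w * (gc w)^*) - 1 = 0.
Proof.
split=> [[uW nc]|[/gram_defectP WW /norm1_defectP nc]]; split => //.
- by apply/gram_defectP; exact: unitarymxPl.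
- exact/norm1_defectP.
- by rewrite -trmxC_unitary; apply/unitarymxP; rewrite trmxCK.
Qed.

Lemma gauge_group_compact : compact gauge_group.
Proof.
apply: bounded_closed_compact.
  exists 1; split; first exact: num_real.
  move=> M M1 w [uW nc]; apply: ltW; apply: le_lt_trans M1.
  apply: mx_norm_le => // i j; rewrite ord1 -[w]genc_dec -[j]splitK.
  case: (fintype.split j) => l /=.
    rewrite row_mxEl; apply: le_trans (mx_entry_norm _ _ _) _.
    by apply: gram_rz_le; exact: unitarymxPl.
  rewrite row_mxEr; apply: le_trans (mx_entry_norm _ _ _) _.
  apply: gram_rz_le; apply/matrixP => a b.
  by rewrite !ord1 !mxE big_ord1 !mxE mulrC -normCK nc expr1n eqxx.
pose f (w : 'rV[R]_Q) : 'rV[R]_(d * d + 1) := row_mx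
  (mxvec (hmx ((gW w)^t* *m gW w - 1%:M))) (const_mx (complex.Re (gc w * (gc w)^*) - 1)).
have oT : open [set: 'rV[R]_Q] by exact: openT.
have sW : msmooth setT (fun w : 'rV[R]_Q => gW w) by apply: msmooth_gW; exact: row_smooth_id.
have sc : csmooth setT (fun w : 'rV[R]_Q => gc w) by apply: csmooth_gc; exact: row_smooth_id.
have sf : row_smooth setT f.
  apply: row_smooth_row_mx.
    apply: row_smooth_hmx => //; apply: msmoothD => //; last exact: msmooth_cst.
    by apply: msmoothM => //; exact: msmooth_adj.
  apply: row_smooth_const => t; apply: CnD => //; last exact: Cn_cst.
  by have [] := csmoothM oT sc (csmooth_conj oT sc).
have -> : gauge_group = f @^-1` [set 0]; last exact: closed_zero_set.
apply/seteqP; split => w.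
  move=> /gauge_groupP[e1 e2]; rewrite /f /= e1 e2 -[RHS]row_mx0; congr row_mx.
rewrite /f /= -[RHS]row_mx0 => /eq_row_mx[e1 e2]; apply/gauge_groupP; split => //.
by move/rowP/(_ 0): e2; rewrite !mxE.
Qed.

End GaugeGroupCompact.

(** * Orbifold charts from slices *)

Lemma near_ballP {R : realType} n (x : 'rV[R]_n) (P : set 'rV[R]_n) :
  (\forall y \near x, P y) <-> exists2 e : R, 0 < e & forall y, `|y - x| < e -> P y.
Proof.
split=> [/nbhs_ballP[e e0 H]|[e e0 H]].
  by exists e => // y yx; apply: H; rewrite -ball_normE /= distrC.
apply/nbhs_ballP; exists e => // y; rewrite -ball_normE /= distrC; exact: H.
Qed.

Lemma near0_ballP {R : realType} n (P : set 'rV[R]_n) :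
  (\forall y \near (0 : 'rV[R]_n), P y) <->
  exists2 e : R, 0 < e & forall y, `|y| < e -> P y.
Proof.
rewrite near_ballP; split=> -[e e0 H]; exists e => // y.
  by move=> yx; apply: H; rewrite subr0.
by rewrite subr0; exact: H.
Qed.

Lemma near_continuous {T U : topologicalType} (f : T -> U) (x : T) (P : set U) :
  {for x, continuous f} -> (\forall w \near f x, P w) -> \forall y \near x, P (f y).
Proof. by move=> cf nP; exact: cf. Qed.

Lemma smooth_comp {R : realType} n p q (A : set 'rV[R]_n) (B : set 'rV[R]_p)
    (f : 'rV[R]_n -> 'rV[R]_p) (g : 'rV[R]_p -> 'rV[R]_q) :
  open A -> open B -> f @` A `<=` B -> smooth_on A f -> smooth_on B g ->
  smooth_on A (g \o f).
Proof.
move=> oA oB fAB /(smooth_onP f oA) sf /(smooth_onP g oB) sg; apply/smooth_onP => // j t.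
by apply: (Cn_comp (g := fun y => g y 0 j) oA oB fAB) => [i|]; [exact: sf|exact: sg].
Qed.

Lemma smooth_on_subset {R : realType} n p (A B : set 'rV[R]_n) (f : 'rV[R]_n -> 'rV[R]_p) :
  open A -> open B -> A `<=` B -> smooth_on B f -> smooth_on A f.
Proof.
move=> oA oB AB /(smooth_onP f oB) sf; apply/smooth_onP => // j t.
exact: Cn_subset AB (sf j t).
Qed.

Lemma smooth_on_continuous {R : realType} n p (A : set 'rV[R]_n) (f : 'rV[R]_n -> 'rV[R]_p) x :
  smooth_on A f -> A x -> {for x, continuous f}.
Proof. by move=> /(_ 0%N); exact. Qed.

Lemma smooth_mulmxr {R : realType} n p (M : 'M[R]_(n, p)) (A : set 'rV[R]_n) : open A ->
  smooth_on A (fun x => x *m M).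
Proof.
move=> oA; apply/smooth_onP => // j.
by apply: (row_smooth_mulmx M oA) => //; exact: row_smooth_id.
Qed.

Section GermSlice.
Context {R : realType} {N Q m : nat}.
Variables (S : set 'rV[R]_N) (G : set 'rV[R]_Q) (e : 'rV[R]_Q).
Variable act : 'rV[R]_Q -> 'rV[R]_N -> 'rV[R]_N.

(* sigma parametrizes a slice through v; rho v' is the slice coordinate of the
   orbit of v', and gam v' moves v' to the slice. *)
Record germ_slice (v : 'rV[R]_N) (H : @mxgroup R m) (sigma : 'rV[R]_m -> 'rV[R]_N)
    (rho : 'rV[R]_N -> 'rV[R]_m) (gam : 'rV[R]_N -> 'rV[R]_Q) : Prop := GermSlice {
  gs_0 : sigma 0 = v;
  gs_in : \forall x \near (0 : 'rV[R]_m), S (sigma x);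
  gs_K : \forall x \near (0 : 'rV[R]_m), rho (sigma x) = x;
  gs_e : \forall x \near (0 : 'rV[R]_m), gam (sigma x) = e;
  gs_sigma : exists A : set 'rV[R]_m, [/\ open A, A 0 & smooth_on A sigma];
  gs_rho : exists A : set 'rV[R]_N, [/\ open A, A v & smooth_on A rho];
  gs_gam : exists A : set 'rV[R]_N, [/\ open A, A v & smooth_on A gam];
  gs_G : \forall w \near v, S w -> G (gam w);
  gs_move : \forall w \near v, S w -> sigma (rho w) = act (gam w) w;
  gs_inv : \forall g \near e & w \near v, S w -> G g -> rho (act g w) = rho w;
  gs_stab : forall g, G g -> act g v = v -> exists2 M, M \in mxg_seq H &
    \forall x \near (0 : 'rV[R]_m), act g (sigma x) = sigma (x *m M);
  gs_lift : forall M, M \in mxg_seq H -> exists2 g, G g &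
    \forall x \near (0 : 'rV[R]_m), act g (sigma x) = sigma (x *m M) }.

End GermSlice.

(** * The orbifold atlas of the orbit space of a compact group with slices *)

Section OrbitSpace.
Context {R : realType} {N Q m : nat} {X : topologicalType}.
Variables (S : set 'rV[R]_N) (G : set 'rV[R]_Q) (e : 'rV[R]_Q).
Variables (act : 'rV[R]_Q -> 'rV[R]_N -> 'rV[R]_N).
Variables (mul : 'rV[R]_Q -> 'rV[R]_Q -> 'rV[R]_Q) (inv : 'rV[R]_Q -> 'rV[R]_Q).
Variable pr : 'rV[R]_N -> X.
Hypothesis cG : compact G.
Hypotheses (GM : forall g h, G g -> G h -> G (mul g h)) (GV : forall g, G g -> G (inv g)).
Hypothesis actM : forall g h v, act g (act h v) = act (mul g h) v.
Hypothesis actK : forall g v, G g -> act (inv g) (act g v) = v.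
Hypothesis mulV : forall g, G g -> mul g (inv g) = e.
Hypothesis mulK : forall g, G g -> mul (mul (inv g) e) g = e.
Hypothesis mul_near : forall g h (P : set 'rV[R]_Q), nbhs (mul g h) P ->
  \forall g' \near g & h' \near h, P (mul g' h').
Hypothesis act_near : forall g v (P : set 'rV[R]_N), nbhs (act g v) P ->
  \forall g' \near g & v' \near v, P (act g' v').
Hypothesis act_smooth : forall g, smooth_on setT (act g).
Hypothesis S_act : forall g v, G g -> S v -> S (act g v).
Hypothesis prP : forall v w, S v -> S w -> pr v = pr w <-> exists2 g, G g & w = act g v.
Hypothesis pr_surj : forall p, exists2 v, S v & p = pr v.
Hypothesis pr_open : forall U : set X, open U <-> forall v, S v -> U (pr v) ->
  \forall w \near v, S w -> U (pr w).
Implicit Types (v w : 'rV[R]_N) (g h : 'rV[R]_Q).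

Lemma pr_act g v : G g -> S v -> pr (act g v) = pr v.
Proof.
by move=> Gg Sv; apply/esym/prP => //; [exact: S_act|exists g].
Qed.

Lemma act_near1 g v (P : set 'rV[R]_N) : nbhs (act g v) P -> \forall v' \near v, P (act g v').
Proof.
move=> /act_near[[A B] /= [nA nB] H]; apply: filterS nB => v' Bv'.
by apply: (H (g, v')); split => //=; exact: nbhs_singleton.
Qed.

Lemma pr_open_image (O : set 'rV[R]_N) : open O -> open (pr @` (O `&` S)).
Proof.
move=> oO; apply/pr_open => v Sv [w [Ow Sw] ewv].
have [g Gg ev] := (proj1 (prP Sv Sw)) (esym ewv).
have : \forall v' \near v, O (act g v').
  by apply: act_near1; rewrite -ev; exact: open_nbhs_nbhs.
apply: filterS => v' Ov' Sv'; exists (act g v'); last exact: pr_act.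
by split => //; exact: S_act.
Qed.

(* The germ conditions with one radius r for the slice coordinate and one
   neighbourhood O of v. *)
Record slice v (H : @mxgroup R m) (sigma : 'rV[R]_m -> 'rV[R]_N)
    (rho : 'rV[R]_N -> 'rV[R]_m) (gam : 'rV[R]_N -> 'rV[R]_Q) (O : set 'rV[R]_N) (r : R) : Prop := Slice {
  sl_r : 0 < r;
  sl_O : open O;
  sl_0 : sigma 0 = v;
  sl_in : forall x, `|x| < r -> [/\ S (sigma x), O (sigma x), rho (sigma x) = x & gam (sigma x) = e];
  sl_sigma : smooth_on [set x : 'rV[R]_m | `|x| < r] sigma;
  sl_rho : smooth_on O rho;
  sl_gam : smooth_on O gam;
  sl_move : forall w, O w -> S w -> G (gam w) /\ sigma (rho w) = act (gam w) w;
  sl_inv : \forall g \near e, forall w, O w -> S w -> G g -> rho (act g w) = rho w;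
  sl_orbit : forall x y g, `|x| < r -> `|y| < r -> G g -> act g (sigma x) = sigma y ->
    exists2 M, M \in mxg_seq H & y = x *m M;
  sl_lift : forall M x, M \in mxg_seq H -> `|x| < r -> `|x *m M| < r ->
    exists2 g, G g & act g (sigma x) = sigma (x *m M) }.

Lemma open_norm_lt n (r : R) : open [set x : 'rV[R]_n | `|x| < r].
Proof.
rewrite openE => x xr; apply/near_ballP; exists (r - `|x|); first by rewrite subr_gt0.
move=> y yx; rewrite /= -[y](subrK x); apply: le_lt_trans (ler_normD _ _) _.
by rewrite -ltrBrDr.
Qed.

Lemma near0_mulmxr n p (M : 'M[R]_(n, p)) (P : set 'rV[R]_p) :
  (\forall y \near (0 : 'rV[R]_p), P y) -> \forall x \near (0 : 'rV[R]_n), P (x *m M).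
Proof.
move=> nP; have := @mulmxr_continuous R n p M 0.
by rewrite /continuous_at /= mul0mx; apply.
Qed.

(** If [g] moves [v], elements near [g] carry no point near [v] to a point near [v]. If [g] fixes
    [v], a nearby g' is (g' g^-1) g, where [g] acts on the slice by a matrix and g' g^-1 is close to
    the unit and preserves [rho]. Compactness of the group makes the radius uniform. *)
Lemma germ_orbit v (H : @mxgroup R m) sigma rho gam : S v -> germ_slice S G e act v H sigma rho gam ->
  exists2 r : R, 0 < r & forall (x y : 'rV[R]_m) g, `|x| < r -> `|y| < r -> G g ->
    act g (sigma x) = sigma y -> exists2 M, M \in mxg_seq H & y = x *m M.
Proof.
move=> Sv [s0 sin sK se [A [oA A0 sA]] _ _ _ _ ginv gstab _].
have cs : {for (0 : 'rV[R]_m), continuous sigma} by exact: smooth_on_continuous sA A0.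
have csP (P : set 'rV[R]_N) : nbhs v P -> \forall x \near (0 : 'rV[R]_m), P (sigma x).
  by move=> nP; apply: cs; rewrite s0.
pose F := filter_prod (nbhs (0 : 'rV[R]_m)) (nbhs (0 : 'rV[R]_m)).
pose P (z : 'rV[R]_m * 'rV[R]_m) g := G g -> act g (sigma z.1) = sigma z.2 ->
  exists2 M, M \in mxg_seq H & z.2 = z.1 *m M.
have key : F (fun z => G `<=` P z).
  apply: (proj1 (compact_near_coveringP G) cG _ F P) => g Gg.
  have [gv|gv] := pselect (act g v = v); last first.
    have d0 : 0 < `|act g v - v| / 2 by rewrite divr_gt0 // normr_gt0 subr_eq0; exact/eqP.
    have n1 : \forall w \near act g v, `|w - act g v| < `|act g v - v| / 2.
      by apply/near_ballP; exists (`|act g v - v| / 2).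
    have n2 : \forall w \near v, `|w - v| < `|act g v - v| / 2.
      by apply/near_ballP; exists (`|act g v - v| / 2).
    have [[B D] /= [nB nD] HBD] := act_near n1.
    exists (B, [set z | D (sigma z.1) /\ `|sigma z.2 - v| < `|act g v - v| / 2]).
      split => //=; exists ([set x | D (sigma x)], [set x | `|sigma x - v| < `|act g v - v| / 2]).
        by split; [exact: (csP _ nD)|exact: (csP _ n2)].
      by move=> [x y] [].
    move=> [g' [x y]] /= [Bg' [Dx xr]] /= _ E; exfalso.
    have := HBD (g', sigma x) (conj Bg' Dx); rewrite /= E => H1.
    have : `|act g v - v| < `|act g v - v|.
      have eq1 : act g v - v = (act g v - sigma y) + (sigma y - v) by rewrite addrA subrK.
      rewrite {2}[`|act g v - v|]splitr {1}eq1.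
      apply: le_lt_trans (ler_normD _ _) _; apply: ltrD => //.
      by rewrite distrC.
    by rewrite ltxx.
  have [M HM nM] := gstab g Gg gv.
  have [[B D] /= [nB nD] HBD] := ginv.
  have nB' : \forall g' \near g, B (mul g' (inv g)).
    have := @mul_near g (inv g) B; rewrite mulV // => /(_ nB) [[B1 B2] /= [nB1 nB2] HB].
    by apply: filterS nB1 => g' Bg'; apply: (HB (g', inv g)); split => //; exact: nbhs_singleton.
  exists ([set g' | B (mul g' (inv g))], [set z | [/\ act g (sigma z.1) = sigma (z.1 *m M),
      S (sigma (z.1 *m M)) /\ D (sigma (z.1 *m M)), rho (sigma (z.1 *m M)) = z.1 *m M
      & rho (sigma z.2) = z.2]]).
    split => //=; exists ([set x | [/\ act g (sigma x) = sigma (x *m M),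
      S (sigma (x *m M)) /\ D (sigma (x *m M)) & rho (sigma (x *m M)) = x *m M]],
      [set y | rho (sigma y) = y]).
      split => //=; near=> x; split; [|split|]; near: x => //.
      - exact: (near0_mulmxr M sin).
      - exact: (near0_mulmxr M (csP _ nD)).
      - exact: (near0_mulmxr M sK).
    by move=> [x y] /= [[]].
  move=> [g' [x y]] /= [Bg' [e1 [e2 e3] e4 e5]] /= Gg' E; exists M => //.
  have := HBD (mul g' (inv g), sigma (x *m M)) (conj Bg' e3) e2 (GM Gg' (GV Gg)).
  by rewrite /= e4 -e1 -actM actK // E e5.
have [[B D] /= [/near0_ballP[r1 r10 H1] /near0_ballP[r2 r20 H2]] HBD] := key.
exists (Num.min r1 r2); first by rewrite lt_min r10.
move=> x y g; rewrite !lt_min => /andP[xr _] /andP[_ yr] Gg.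
exact: (HBD (x, y) (conj (H1 _ xr) (H2 _ yr)) g Gg Gg).
Unshelve. all: by end_near. Qed.

Lemma near_all_seq (T : Type) (F : set_system T) (I : eqType) (s : seq I) (P : I -> set T) :
  Filter F -> (forall i, i \in s -> F (P i)) -> F (fun x => forall i, i \in s -> P i x).
Proof.
move=> FF; elim: s => [|i s IH] H; first by near=> x.
have H1 := H i (mem_head i s).
have H2 : F (fun x => forall j, j \in s -> P j x).
  by apply: IH => j js; apply: H; rewrite inE js orbT.
apply: filterS2 H1 H2 => x Pi Ps j; rewrite inE => /orP[/eqP -> //|]; exact: Ps.
Unshelve. all: by end_near. Qed.

Lemma germ_slice_slice v H sigma rho gam : S v -> germ_slice S G e act v H sigma rho gam ->
  exists O r, slice v H sigma rho gam O r.
Proof.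
move=> Sv gs; have [r1 r10 orb] := germ_orbit Sv gs.
have [s0 sin sK se [A [oA A0 sA]] [A1 [oA1 A1v sA1]] [A2 [oA2 A2v sA2]] gG gmv ginv _ glift] := gs.
have [[B D] /= [nB nD] HBD] := ginv.
have nA1 : nbhs v A1 by exact: open_nbhs_nbhs.
have nA2 : nbhs v A2 by exact: open_nbhs_nbhs.
have nO : \forall w \near v, [/\ A1 w, A2 w, D w, S w -> G (gam w) & S w -> sigma (rho w) = act (gam w) w].
  by near=> w; split; near: w.
have /near_ballP[eO eO0 HO] := nO.
pose O := [set w | `|w - v| < eO].
have oO : open O.
  rewrite openE => w wO; apply/near_ballP; exists (eO - `|w - v|); first by rewrite subr_gt0.
  move=> y yw; rewrite /O /= -(subrKA w); apply: le_lt_trans (ler_normD _ _) _.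
  by rewrite -ltrBrDr.
have cs : {for (0 : 'rV[R]_m), continuous sigma} by exact: smooth_on_continuous sA A0.
have nO' : \forall x \near (0 : 'rV[R]_m), O (sigma x).
  by apply: cs; rewrite s0; apply/near_ballP; exists eO.
have nlift : \forall x \near (0 : 'rV[R]_m), forall M, M \in mxg_seq H ->
    exists2 g, G g & act g (sigma x) = sigma (x *m M).
  apply: near_all_seq => M /glift[g Gg]; apply: filterS => x ?; by exists g.
have nA : \forall x \near (0 : 'rV[R]_m), A x by exact: open_nbhs_nbhs.
have : \forall x \near (0 : 'rV[R]_m), [/\ A x, [/\ S (sigma x), O (sigma x), rho (sigma x) = x & gam (sigma x) = e]
    & forall M, M \in mxg_seq H -> exists2 g, G g & act g (sigma x) = sigma (x *m M)].
  by near=> x; split; [|split|]; near: x.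
move=> /near0_ballP[r2 r20 H2].
have OH w : O w -> _ := HO w.
exists O, (Num.min r1 r2); split => //.
- by rewrite lt_min r10.
- by move=> x; rewrite lt_min => /andP[_ /H2[]].
- apply: smooth_on_subset sA => //; first exact: open_norm_lt.
  by move=> x /=; rewrite lt_min => /andP[_ /H2[]].
- by apply: smooth_on_subset sA1 => // w /OH[].
- by apply: smooth_on_subset sA2 => // w /OH[].
- by move=> w /OH[_ _ _ h1 h2] Sw; split; [exact: h1|exact: h2].
- by apply: filterS nB => g Bg w /OH[_ _ Dw _ _] Sw Gg; exact: (HBD (g, w) (conj Bg Dw)).
- move=> x y g; rewrite !lt_min => /andP[xr _] /andP[yr _]; exact: orb.
- by move=> M x HM; rewrite !lt_min => /andP[_ /H2[_ _ h]] _; exact: h.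
Unshelve. all: by end_near. Qed.

Lemma slice_shrink v H sigma rho gam O r r' : slice v H sigma rho gam O r -> 0 < r' -> r' <= r ->
  slice v H sigma rho gam O r'.
Proof.
move=> [? ? ? hin sS ? ? ? ? horb hlift] r'0 rr'.
have le (x : 'rV[R]_m) : `|x| < r' -> `|x| < r by move=> xr; exact: lt_le_trans rr'.
split => //.
- by move=> x /le; exact: hin.
- apply: smooth_on_subset sS => //; exact: open_norm_lt.
- by move=> x y g /le xr /le yr; exact: horb.
- by move=> M x HM /le xr /le yr; exact: hlift.
Qed.

(** The sup norm need not be invariant under [H], so the ball is replaced by the points whose whole
    [H]-orbit lies in it. This set is open, invariant and star-shaped about 0, hence connected. *)
Definition slice_dom (H : @mxgroup R m) (r : R) : set 'rV[R]_m :=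
  [set x | forall M, M \in mxg_seq H -> `|x *m M| < r].

Definition slice_act (H : @mxgroup R m) (h : mxgroup_type H) (x : 'rV[R]_m) := x *m val h.

Definition slice_chart (H : @mxgroup R m) (sigma : 'rV[R]_m -> 'rV[R]_N) (r : R) : chart R m X :=
  @Chart R m X (slice_dom H r) (mxgroup_type H) (@slice_act H) (pr \o sigma).

Lemma slice_dom_norm H r x : slice_dom H r x -> `|x| < r.
Proof. by move=> /(_ 1%:M (mxg1 H)); rewrite mulmx1. Qed.

Lemma slice_dom_open H r : open (slice_dom H r).
Proof.
rewrite openE => x Ax; apply: near_all_seq => M HM.
have : \forall z \near x *m M, `|z| < r by apply: open_nbhs_nbhs; split; [exact: open_norm_lt|exact: Ax].
exact: (@mulmxr_continuous R m m M x).
Qed.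

Lemma slice_dom0 H r : 0 < r -> slice_dom H r 0.
Proof. by move=> r0 M _; rewrite mul0mx normr0. Qed.

Lemma slice_dom_act H r M x : M \in mxg_seq H -> slice_dom H r x -> slice_dom H r (x *m M).
Proof. by move=> HM Ax M' HM'; rewrite -mulmxA; apply: Ax; exact: mxgM. Qed.

Lemma slice_dom_connected H r : 0 < r -> connected (slice_dom H r).
Proof.
move=> r0; pose seg (x : 'rV[R]_m) := (fun t : R => t *: x) @` `[0, 1]%classic.
have -> : slice_dom H r = \bigcup_(x in slice_dom H r) seg x.
  apply/seteqP; split => [x Ax|y [x Ax [t /= t01 <-]] M HM].
    by exists x => //; exists 1; rewrite ?scale1r //= in_itv /= ler01 lexx.
  rewrite -scalemxAl normrZ; move: t01; rewrite in_itv /= => /andP[t0 t1].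
  apply: le_lt_trans (Ax M HM); rewrite ger0_norm //.
  by rewrite ler_piMl.
apply: bigcup_connected => [|x Ax].
  exists 0 => x Ax; exists 0; rewrite ?scale0r //= in_itv /= lexx ler01 //.
apply: connected_continuous_connected; first exact: segment_connected.
apply: continuous_subspaceT; exact: scalel_continuous.
Qed.

Lemma slice_chart_continuous v H sigma rho gam O r x : slice v H sigma rho gam O r ->
  `|x| < r -> {for x, continuous (pr \o sigma)}.
Proof.
move=> sl xr U; have [Sx _ _ _] := sl_in sl xr.
rewrite nbhs_simpl /= nbhsE => -[U' [oU' U'x] U'U].
have cs : {for x, continuous sigma} by exact: smooth_on_continuous (sl_sigma sl) xr.
have n1 : \forall y \near x, S (sigma y) -> U' (pr (sigma y)).
  exact: (near_continuous cs (proj1 (pr_open U') oU' _ Sx U'x)).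
have n2 : \forall y \near x, `|y| < r by apply: open_nbhs_nbhs; split => //; exact: open_norm_lt.
by apply: filterS2 n1 n2 => y U'y yr; apply: U'U; apply: U'y; have [] := sl_in sl yr.
Qed.

(** A point near [w] is first moved by the fixed [g] to the vicinity of [sigma x] and then by [gam]
    onto the slice; its slice coordinate is near [x], and neither motion changes the class. *)
Lemma slice_chart_open v H sigma rho gam O r (O' : set 'rV[R]_m) : slice v H sigma rho gam O r ->
  open O' -> O' `<=` [set x | `|x| < r] -> open ((pr \o sigma) @` O').
Proof.
move=> sl oO' O'r; apply/pr_open => w Sw [x O'x /= ex].
have [Sx Ox Kx _] := sl_in sl (O'r x O'x).
have [g Gg eg] := proj1 (prP Sw Sx) (esym ex).
have n0 : \forall w' \near sigma x, O w' /\ O' (rho w').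
  have n1 : \forall w' \near sigma x, O w' by apply: open_nbhs_nbhs; split => //; exact: sl_O sl.
  have n2 : \forall w' \near sigma x, O' (rho w').
    apply: (smooth_on_continuous (sl_rho sl) Ox).
    by rewrite Kx; exact: open_nbhs_nbhs.
  by near=> w'; split; near: w'.
rewrite eg in n0; apply: filterS (act_near1 n0) => w' [Ow' O'w'] Sw'.
have Sg : S (act g w') by exact: S_act.
have [Ggam eS] := sl_move sl Ow' Sg.
by exists (rho (act g w')) => //=; rewrite eS !pr_act.
Unshelve. all: by end_near. Qed.

Lemma slice_chart_effective H r (h : mxgroup_type H) : 0 < r ->
  (forall x, slice_dom H r x -> slice_act h x = x) -> h = 1%g.
Proof.
move=> r0 fix_h; apply: val_inj => /=; apply/row_matrixP => i; rewrite row1 rowE.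
pose x : 'rV[R]_m := delta_mx 0 i.
have nA : nbhs (0 *: x) (slice_dom H r).
  by rewrite scale0r; apply: open_nbhs_nbhs; split; [exact: slice_dom_open|exact: slice_dom0].
have : \forall t \near (0 : R), slice_dom H r (t *: x) by exact: (@scalel_continuous _ _ x 0).
move=> /nbhs_ballP[t /= t0 Ht].
have /fix_h : slice_dom H r ((t / 2) *: x).
  apply: Ht; rewrite -ball_normE /= sub0r normrN ger0_norm ?divr_ge0 ?ltW //.
  by rewrite ltr_pdivrMr // ltr_pMr // ltr1n.
rewrite /slice_act -scalemxAl => /(congr1 (fun y => (t / 2)^-1 *: y)).
by rewrite !scalerA mulVf ?scale1r // gt_eqF // divr_gt0.
Qed.

Lemma slice_chartP v H sigma rho gam O r : slice v H sigma rho gam O r ->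
  orbifold_chart (slice_chart H sigma r).
Proof.
move=> sl; have r0 := sl_r sl; have oA := @slice_dom_open H r.
have cphi : {within slice_dom H r, continuous (pr \o sigma)}.
  apply: continuous_in_subspaceT => x /set_mem/slice_dom_norm xr.
  exact: slice_chart_continuous sl xr.
split => /=.
- split => //; first exact: slice_dom_connected.
    by apply: (slice_chart_open sl) => // x /slice_dom_norm.
  by apply: connected_continuous_connected => //; exact: slice_dom_connected.
- split.
  + move=> h; split; first exact: smooth_mulmxr.
    by move=> _ [x Ax <-]; apply: slice_dom_act => //; exact: valP h.
  + by move=> x _; exact: mulmx1.
  + by move=> g h x _; exact: mulmxA.
  + by move=> h; exact: slice_chart_effective.
- split => // h x Ax /=.
  have Hh : val h \in mxg_seq H by exact: valP h.
  have [g Gg <-] := sl_lift sl Hh (slice_dom_norm Ax) (slice_dom_norm (slice_dom_act Hh Ax)).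
  by apply: pr_act => //; have [] := sl_in sl (slice_dom_norm Ax).
- move=> x y /slice_dom_norm xr /slice_dom_norm yr /= e'.
  have [Sx _ _ _] := sl_in sl xr; have [Sy _ _ _] := sl_in sl yr.
  have [g Gg eg] := proj1 (prP Sx Sy) e'.
  have [M HM ->] := sl_orbit sl xr yr Gg (esym eg).
  by exists (SeqSub HM).
- move=> O' oO' O'A _; apply: (slice_chart_open sl) => // x /O'A; exact: slice_dom_norm.
Qed.

(* The transition map is rho1 \o act g \o sigma0; rho0 \o act g^-1 \o sigma1
   inverts it on the left because gam1 is close to the unit near sigma1 x1. *)
Lemma slice_chart_embeds v0 H0 sigma0 rho0 gam0 O0 r0 v1 H1 sigma1 rho1 gam1 O1 r1 x1 :
  S v0 -> slice v0 H0 sigma0 rho0 gam0 O0 r0 -> slice v1 H1 sigma1 rho1 gam1 O1 r1 ->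
  slice_dom H1 r1 x1 -> pr (sigma1 x1) = pr v0 ->
  exists2 e0 : R, 0 < e0 & forall r, 0 < r -> r <= e0 ->
    embeds_in (slice_chart H0 sigma0 r) (slice_chart H1 sigma1 r1).
Proof.
move=> Sv sl0 sl1 A1x e01; have x1r := slice_dom_norm A1x.
have [Sx1 Ox1 Kx1 ex1] := sl_in sl1 x1r.
have [g Gg eg] := proj1 (prP Sv Sx1) (esym e01).
have s0 := sl_0 sl0; have z0 : `|0 : 'rV[R]_m| < r0 by rewrite normr0; exact: sl_r sl0.
have [_ Ov _ _] := sl_in sl0 z0; rewrite s0 in Ov.
have cs0 : {for (0 : 'rV[R]_m), continuous sigma0} by exact: smooth_on_continuous (sl_sigma sl0) z0.
have csP (P : set 'rV[R]_N) : nbhs v0 P -> \forall x \near (0 : 'rV[R]_m), P (sigma0 x).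
  by move=> nP; apply: cs0; rewrite s0.
have gP (P : set 'rV[R]_N) : nbhs (sigma1 x1) P ->
    \forall x \near (0 : 'rV[R]_m), P (act g (sigma0 x)).
  by move=> nP; apply: (csP (fun v => P (act g v))); apply: act_near1; rewrite -eg.
have c_rho1 := smooth_on_continuous (sl_rho sl1) Ox1.
have c_gam1 := smooth_on_continuous (sl_gam sl1) Ox1.
have n1 : \forall x \near (0 : 'rV[R]_m), O1 (act g (sigma0 x)).
  by apply: gP; apply: open_nbhs_nbhs; split => //; exact: sl_O sl1.
have n2 : \forall x \near (0 : 'rV[R]_m), slice_dom H1 r1 (rho1 (act g (sigma0 x))).
  apply: (gP (fun v => slice_dom H1 r1 (rho1 v))); apply: c_rho1; rewrite Kx1.
  by apply: open_nbhs_nbhs; split => //; exact: slice_dom_open.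
have n3 : \forall x \near (0 : 'rV[R]_m), forall w, O0 w -> S w ->
    G (mul (mul (inv g) (gam1 (act g (sigma0 x)))) g) ->
    rho0 (act (mul (mul (inv g) (gam1 (act g (sigma0 x)))) g) w) = rho0 w.
  have m1 : \forall u \near e, forall w, O0 w -> S w -> G (mul (mul (inv g) u) g) ->
      rho0 (act (mul (mul (inv g) u) g) w) = rho0 w.
    have m2 : \forall u \near mul (inv g) e, forall w, O0 w -> S w -> G (mul u g) ->
        rho0 (act (mul u g) w) = rho0 w.
      have := @mul_near (mul (inv g) e) g _; rewrite mulK // => /(_ _ (sl_inv sl0)).
      move=> [[A B] /= [nA nB] HAB]; apply: filterS nA => u Au w Ow Sw.
      by apply: (HAB (u, g)) => //; split => //; exact: nbhs_singleton.
    have [[A B] /= [nA nB] HAB] := mul_near m2.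
    by apply: filterS nB => u Bu; apply: (HAB (inv g, u)); split => //; exact: nbhs_singleton.
  apply: (gP (fun v => forall w, O0 w -> S w -> G (mul (mul (inv g) (gam1 v)) g) ->
    rho0 (act (mul (mul (inv g) (gam1 v)) g) w) = rho0 w)).
  by rewrite -ex1 in m1; exact: near_continuous c_gam1 m1.
have n4 : \forall x \near (0 : 'rV[R]_m), O0 (act (inv g) (sigma1 (rho1 (act g (sigma0 x))))).
  have m1 : \forall w \near sigma1 x1, O0 (act (inv g) w).
    apply: act_near1; rewrite eg actK //.
    by apply: open_nbhs_nbhs; split => //; exact: sl_O sl0.
  have m2 : \forall y \near x1, O0 (act (inv g) (sigma1 y)).
    exact: near_continuous (smooth_on_continuous (sl_sigma sl1) x1r) m1.
  apply: (gP (fun v => O0 (act (inv g) (sigma1 (rho1 v))))).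
  by rewrite -Kx1 in m2; exact: near_continuous c_rho1 m2.
have [e0 e00 He0] : exists2 e0 : R, 0 < e0 & forall x : 'rV[R]_m, `|x| < e0 ->
    [/\ `|x| < r0, O1 (act g (sigma0 x)), slice_dom H1 r1 (rho1 (act g (sigma0 x))),
      O0 (act (inv g) (sigma1 (rho1 (act g (sigma0 x))))) &
      forall w, O0 w -> S w -> G (mul (mul (inv g) (gam1 (act g (sigma0 x)))) g) ->
        rho0 (act (mul (mul (inv g) (gam1 (act g (sigma0 x)))) g) w) = rho0 w].
  have n0 : \forall x \near (0 : 'rV[R]_m), `|x| < r0.
    by apply: near0_norm_lt; exact: sl_r sl0.
  by apply/near0_ballP; near=> x; split; near: x.
exists e0 => // r rp re; pose lam x := rho1 (act g (sigma0 x)).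
pose lam' y := rho0 (act (inv g) (sigma1 y)).
have Ae x : slice_dom H0 r x -> `|x| < e0 by move=> /slice_dom_norm xr; exact: lt_le_trans re.
have move1 x : `|x| < e0 -> [/\ S (sigma0 x), G (gam1 (act g (sigma0 x))) &
    sigma1 (lam x) = act (gam1 (act g (sigma0 x))) (act g (sigma0 x))].
  move=> /He0[xr Oa _ _ _]; have [Sx _ _ _] := sl_in sl0 xr.
  by have [] := sl_move sl1 Oa (S_act Gg Sx).
exists lam; split; last first.
  move=> x /Ae xe /=; have [Sx Gx e1] := move1 x xe.
  by rewrite /lam in e1 *; rewrite e1 !pr_act //; exact: S_act.
pose B' := [set y | `|y| < r1 /\ O0 (act (inv g) (sigma1 y))].
have oB' : open B'.
  rewrite openE => y [yr Oy].
  have m1 : \forall z \near y, `|z| < r1.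
    by apply: open_nbhs_nbhs; split => //; exact: open_norm_lt.
  have m2 : \forall z \near y, O0 (act (inv g) (sigma1 z)).
    have m3 : \forall w \near sigma1 y, O0 (act (inv g) w).
      by apply: act_near1; apply: open_nbhs_nbhs; split => //; exact: sl_O sl0.
    exact: near_continuous (smooth_on_continuous (sl_sigma sl1) yr) m3.
  by near=> z; split; near: z.
have oA0 := @slice_dom_open H0 r.
apply: (@smooth_embedding_left_inverse R m m _ _ B' lam lam') => //.
- by move=> _ [x /Ae/He0[_ _ h _ _] <-].
- by move=> _ [x /Ae/He0[_ _ /slice_dom_norm h1 h2 _] <-].
- have sa : smooth_on (slice_dom H0 r) (act g \o sigma0).
    apply: (@smooth_comp R m N N _ setT) => //; first exact: openT.
    apply: smooth_on_subset (sl_sigma sl0) => //; first exact: open_norm_lt.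
    by move=> x /Ae/He0[].
  apply: (@smooth_comp R m N m _ O1) => //; first exact: sl_O sl1.
    by move=> _ [x /Ae/He0[_ h _ _ _] <-].
  exact: sl_rho sl1.
- have sa : smooth_on B' (act (inv g) \o sigma1).
    apply: (@smooth_comp R m N N _ setT) => //; first exact: openT.
    apply: smooth_on_subset (sl_sigma sl1) => //; first exact: open_norm_lt.
    by move=> y [].
  apply: (@smooth_comp R m N m _ O0) => //; first exact: sl_O sl0.
    by move=> _ [y [_ h] <-].
  exact: sl_rho sl0.
- move=> x /Ae xe; have [Sx Gx e1] := move1 x xe.
  have [xr _ _ _ h] := He0 x xe; have [_ Ox Kx _] := sl_in sl0 xr.
  rewrite /lam' e1 -[RHS]Kx !actM; apply: h => //.
  by apply: GM => //; apply: GM => //; exact: GV.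
Unshelve. all: by end_near. Qed.

Definition slice_atlas (c : chart R m X) : Prop := exists v H sigma rho gam O r,
  [/\ S v, slice v H sigma rho gam O r & c = slice_chart H sigma r].

Hypothesis germs : forall v, S v -> exists (H : @mxgroup R m) sigma rho gam,
  germ_slice S G e act v H sigma rho gam.

(** The common chart is a slice through the representative [s1 x1] of the common class, with a
    radius small enough for both embeddings. *)
Lemma slice_atlas_compatible c1 c2 : slice_atlas c1 -> slice_atlas c2 -> compatible c1 c2.
Proof.
move=> [v1 [H1 [s1 [rho1 [gam1 [U1 [r1 [Sv1 sl1 ->]]]]]]]].
move=> [v2 [H2 [s2 [rho2 [gam2 [U2 [r2 [Sv2 sl2 ->]]]]]]]].
move=> _ [x1 A1x <-] [x2 A2x /= e12].
have [Sv _ _ _] := sl_in sl1 (slice_dom_norm A1x).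
have [H [s [rho [gam gs]]]] := germs Sv.
have [U [r sl]] := germ_slice_slice Sv gs.
have [a1 a10 em1] := slice_chart_embeds Sv sl sl1 A1x erefl.
have [a2 a20 em2] := slice_chart_embeds Sv sl sl2 A2x e12.
pose r' := Num.min r (Num.min a1 a2).
have r'0 : 0 < r' by rewrite !lt_min a10 a20 !andbT; exact: sl_r sl.
have sl' : slice (s1 x1) H s rho gam U r'.
  by apply: slice_shrink sl _ _ => //; rewrite ge_min lexx.
have {}em1 : embeds_in (slice_chart H s r') (slice_chart H1 s1 r1).
  by apply: em1 => //; rewrite !ge_min lexx /= orbT.
have {}em2 : embeds_in (slice_chart H s r') (slice_chart H2 s2 r2).
  by apply: em2 => //; rewrite !ge_min lexx /= !orbT.
exists (slice_chart H s r'); split => //.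
- exact: slice_chartP sl'.
- by exists 0; [exact: slice_dom0|rewrite /= (sl_0 sl)].
- have sub c : embeds_in (slice_chart H s r') c -> chart_cod (slice_chart H s r') `<=` chart_cod c.
    move=> [lam [[[_ lamA] _ _ _] elam]] _ [x Ax <-]; exists (lam x); last by rewrite elam.
    by apply: lamA; exists x.
  by move=> p cp; split; exact: sub cp.
Qed.

Lemma slice_atlasP : orbifold_atlas slice_atlas.
Proof.
split; last first.
- move=> p; have [v Sv ->] := pr_surj p.
  have [H [s [rho [gam gs]]]] := germs Sv; have [U [r sl]] := germ_slice_slice Sv gs.
  exists (slice_chart H s r); first by exists v, H, s, rho, gam, U, r.
  by exists 0; [exact: slice_dom0 (sl_r sl)|rewrite /= (sl_0 sl)].
- exact: slice_atlas_compatible.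
- by move=> c [v [H [s [rho [gam [U [r [Sv sl ->]]]]]]]]; exact: slice_chartP sl.
Qed.

End OrbitSpace.

(** * Separation and paracompactness of orbit spaces *)

(* The annuli E n minus the interior of E n.-1 are covered by finitely many
   members of F cut down to the interior of E n.+1 minus E n.-2. *)
Lemma exhaustion_paracompact {T : ptopologicalType} {X : topologicalType} (S : set T)
    (K : nat -> set T) (pr : T -> X) :
  hausdorff_space X -> (forall n, compact (K n)) -> (forall n, K n `<=` S) ->
  {within S, continuous pr} -> (forall p, exists n, (pr @` K n) p) ->
  (forall n, pr @` K n `<=` (pr @` K n.+1)°) -> paracompact X.
Proof.
move=> hX cK KS cpr surj incr F [oF cF].
pose E n := pr @` K n.
have cprK n : {within K n, continuous pr} by exact: continuous_subspaceW (KS n) cpr.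
have cE n : closed (E n).
  by apply: compact_closed => //; apply: continuous_compact; [exact: cprK|exact: cK].
have EE m n : (m <= n)%N -> E m `<=` E n.
  move=> /subnK <-; elim: (n - m)%N => [|l IH] // p /IH; rewrite addSn => /incr.
  exact: interior_subset.
have Eint m n : (m < n)%N -> E m `<=` (E n)°.
  by move=> mn p /(EE m n.-1); case: n mn => // n mn /= H; apply: incr; exact: H.
pose inner n := if n is n'.+1 then (E n')° else set0.
pose inner2 n := if n is n'.+2 then E n' else set0.
pose W n := (E n.+1)° `\` inner2 n.
have oW n : open (W n).
  rewrite /W setDE; apply: openI; first exact: open_interior.
  apply: closed_openC.
  by case: n => [|[|n]] /=; [exact: closed0|exact: closed0|exact: cE].
have annulus n : exists D' : seq (set X), (forall B, B \in D' -> F B) /\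
    E n `\` inner n `<=` \bigcup_(B in [set` D']) B.
  pose L := K n `&` ~` (pr @^-1` inner n).
  have cL : compact L.
    have oi : open (inner n) by case: n {L} => [|n] /=; [exact: open0|exact: open_interior].
    have [Z oZ eZ] := proj1 (open_subspaceP _ _) (proj1 (continuousP _) (cprK n) _ oi).
    have -> : L = K n `&` ~` Z.
      rewrite /L; apply/seteqP; split => x [Kx nx]; split => //.
        by move=> Zx; apply: nx; have : (Z `&` K n) x by []; rewrite eZ => -[].
      by move=> ix; apply: nx; have : (pr @^-1` inner n `&` K n) x by []; rewrite -eZ => -[].
    apply: compact_closedI; [exact: cK|exact: open_closedC].
  have lift (B : set X) : exists Z : set T, F B -> open Z /\ Z `&` K n = pr @^-1` B `&` K n.
    have [FB|nF] := pselect (F B); last by exists set0.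
    have [Z oZ eZ] := proj1 (open_subspaceP _ _) (proj1 (continuousP _) (cprK n) _ (oF B FB)).
    by exists Z.
  have /choice[Z HZ] := lift.
  move: cL; rewrite compact_cover => /(_ _ F Z)[].
  - by move=> B /HZ[].
  - move=> x [Kx _]; have : [set: X] (pr x) by []; rewrite -cF => -[B FB Bx].
    exists B => //; have [_ e] := HZ B FB.
    by have : (pr @^-1` B `&` K n) x by []; rewrite -e => -[].
  move=> D' D'F LD; exists (finmap.enum_fset D'); split => [B BD|_ [[x Kx <-] ix]].
    by have := D'F B BD; rewrite inE.
  have [B BD Zx] := LD x (conj Kx ix); exists B => //.
  have FB : F B by have := D'F B BD; rewrite inE.
  by have [_ e] := HZ B FB; have : (Z B `&` K n) x by []; rewrite e => -[].
have /choice[D HD] := annulus.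
exists [set V | exists n B, B \in D n /\ V = B `&` W n]; split.
- split=> [_ [n [B [BD ->]]]|].
    by apply: openI; [apply: oF; have [h _] := HD n; exact: h|exact: oW].
  rewrite -subTset => p _; have [n0 En0] := surj p.
  have ex : exists n, `[< E n p >] by exists n0; apply/asboolP.
  case: (ex_minnP ex) => n /asboolP Enp nmin.
  have nin j : (j < n)%N -> ~ E j p by move=> jn /asboolP/nmin; rewrite leqNgt jn.
  have [h1 h2] := HD n.
  have [|B BD Bp] := h2 p.
    split => //; case: n {Enp nmin h1 h2} nin => [|n] nin /= H; [exact: H|exact: (nin n (ltnSn n) (interior_subset H))].
  exists (B `&` W n); first by exists n, B.
  split => //; split; first exact: (Eint n).
  by case: n {Enp nmin h1 h2 BD} nin => [|[|n]] nin /=; [by move=> []|by move=> []|exact: nin].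
- move=> p; have [n Enp] := surj p.
  exists (E n.+1)°; first by apply: open_nbhs_nbhs; split; [exact: open_interior|exact: (Eint n)].
  (* A member cut down to [W j] avoids [E j.-2], so it can meet [E n.+1] only for [j < n + 3]. *)
  apply: (@sub_finite_set _ _ (\bigcup_(j in `I_n.+3) ((fun B => B `&` W j) @` [set` D j]))).
    move=> _ [[j [B [BD ->]]] [q [[Bq [Wq nq]] Eq]]].
    exists j; last by exists B.
    rewrite /= ltnNge; apply/negP => nj; apply: nq.
    case: j {BD Bq Wq} nj => [//|[//|j]] /= nj; apply: (EE n.+1); first by rewrite -2!ltnS.
    exact: interior_subset.
  apply: bigcup_finite; first exact: finite_II.
  by move=> j _; apply: finite_image; exact: finite_seq.
- move=> _ [n [B [BD ->]]]; exists B; first by have [h _] := HD n; exact: h.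
  by move=> p [].
Qed.

Section OrbitSpaceTopology.
Context {R : realType} {N Q : nat} {X : topologicalType}.
Variables (S C : set 'rV[R]_N) (G : set 'rV[R]_Q).
Variable act : 'rV[R]_Q -> 'rV[R]_N -> 'rV[R]_N.
Variable pr : 'rV[R]_N -> X.
Hypothesis cG : compact G.
Hypothesis act_near : forall g v (P : set 'rV[R]_N), nbhs (act g v) P ->
  \forall g' \near g & v' \near v, P (act g' v').
Hypothesis S_act : forall g v, G g -> S v -> S (act g v).
Hypothesis prP : forall v w, S v -> S w -> pr v = pr w <-> exists2 g, G g & w = act g v.
Hypothesis pr_surj : forall p, exists2 v, S v & p = pr v.
Hypothesis pr_open : forall U : set X, open U <-> forall v, S v -> U (pr v) ->
  \forall w \near v, S w -> U (pr w).
Hypotheses (cC : compact C) (SC : S `<=` C).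
Hypothesis oS : forall v, S v -> \forall w \near v, C w -> S w.

Let open_image (O : set 'rV[R]_N) : open O -> open (pr @` (O `&` S)).
Proof. exact: pr_open_image act_near S_act prP pr_open O. Qed.

(** For each [g], the points [act g v] and [w] have disjoint neighbourhoods. Compactness of the
    group gives neighbourhoods of [v] and [w] that no group element brings together, and their
    images separate the classes. *)
Lemma orbit_space_hausdorff : hausdorff_space X.
Proof.
rewrite open_hausdorff => p q pq.
have [v Sv ep] := pr_surj p; have [w Sw eq] := pr_surj q.
have gvw g : G g -> act g v != w.
  move=> Gg; apply/eqP => e; move: pq; rewrite ep eq => /eqP; apply.
  by apply/prP => //; exists g.
pose F := filter_prod (nbhs v) (nbhs w).
pose P (z : 'rV[R]_N * 'rV[R]_N) g := G g -> act g z.1 != z.2.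
have key : F (fun z => G `<=` P z).
  apply: (proj1 (compact_near_coveringP G) cG _ F P) => g Gg.
  have d0 : 0 < `|act g v - w| / 2 by rewrite divr_gt0 // normr_gt0 subr_eq0; exact: gvw.
  have n1 : \forall w' \near act g v, `|w' - act g v| < `|act g v - w| / 2.
    by apply/near_ballP; exists (`|act g v - w| / 2).
  have n2 : \forall w' \near w, `|w' - w| < `|act g v - w| / 2.
    by apply/near_ballP; exists (`|act g v - w| / 2).
  have [[B D] /= [nB nD] HBD] := act_near n1.
  exists (B, [set z | D z.1 /\ `|z.2 - w| < `|act g v - w| / 2]).
    by split => //=; exists (D, [set w' | `|w' - w| < `|act g v - w| / 2]).
  move=> [g' [x y]] /= [Bg' [Dx yr]] /= _; apply/eqP => E.
  have := HBD (g', x) (conj Bg' Dx); rewrite /= E => H1.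
  have : `|act g v - w| < `|act g v - w|.
    have eq1 : act g v - w = (act g v - y) + (y - w) by rewrite addrA subrK.
    rewrite {2}[`|act g v - w|]splitr {1}eq1.
    apply: le_lt_trans (ler_normD _ _) _; apply: ltrD => //.
    by rewrite distrC.
  by rewrite ltxx.
have [[A B] /= [nA nB] HAB] := key.
exists (pr @` (A° `&` S), pr @` (B° `&` S)) => /=.
  split; apply/mem_set.
    by exists v => //; split.
  by exists w => //; split.
split; [apply: open_image; exact: open_interior|apply: open_image; exact: open_interior|].
apply/eqP/seteqP; split => // r [[x [Ax Sx] <-] [y [By Sy] exy]].
have [g Gg ey] := proj1 (prP Sx Sy) (esym exy).
have := HAB (x, y) (conj (interior_subset Ax) (interior_subset By)) g Gg Gg.
by rewrite /= -ey eqxx.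
Qed.

(** [K n] consists of the points of the compact set [C] at distance at least 2^-n from the part of
    [C] outside [S]. It is compact, and these sets exhaust [S] because [S] is open in [C]. *)
Lemma orbit_space_paracompact : paracompact X.
Proof.
pose K n := [set v | C v /\ forall w, C w -> `|w - v| < 2^-1 ^+ n -> S w].
have h0 n : 0 < (2^-1 : R) ^+ n by rewrite exprn_gt0.
have KS n : K n `<=` S by move=> v [Cv]; apply => //; rewrite subrr normr0.
have cK n : compact (K n).
  have -> : K n = C `&` ~` [set v | exists w, [/\ C w, ~ S w & `|w - v| < 2^-1 ^+ n]].
    apply/seteqP; split => v [Cv H]; split => //.
      by move=> [w [Cw nS /H]]; apply: contra_not nS; apply.
    by move=> w Cw wv; apply: contrapT => nS; apply: H; exists w.
  apply: compact_closedI => //; apply: open_closedC.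
  rewrite openE => v [w [Cw nS wv]]; apply/near_ballP.
  exists (2^-1 ^+ n - `|w - v|); first by rewrite subr_gt0.
  move=> v' vv'; exists w; split => //; rewrite -(subrKA v).
  by apply: le_lt_trans (ler_normD _ _) _; rewrite -ltrBrDl distrC.
apply: (@exhaustion_paracompact _ X S K pr) => //.
- exact: orbit_space_hausdorff.
- apply/continuousP => U oU; apply/open_subspaceP.
  exists [set v | \forall w \near v, S w -> U (pr w)]°; first exact: open_interior.
  apply/seteqP; split => v [vU Sv]; split => //.
    by have /nbhs_singleton := interior_subset vU; exact.
  apply: filterS (near_join (proj1 (pr_open U) oU v Sv vU)) => //.
- move=> p; have [v Sv ->] := pr_surj p.
  have /near_ballP[r r0 Hr] := oS Sv.
  have [n nr] : exists n, (2^-1 : R) ^+ n < r.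
    have : (fun n => (2^-1 : R) ^+ n) @ \oo --> (0 : R).
      by apply: cvg_expr; rewrite ger0_norm ?invr_ge0 // invf_lt1 // ltr1n.
    move=> /cvgrPdist_lt/(_ r r0)[n _ Hn]; exists n.
    by have := Hn n (leqnn n); rewrite sub0r normrN ger0_norm // ltW.
  exists n, v => //; split; first exact: SC.
  by move=> w Cw wv; apply: Hr => //; exact: lt_trans nr.
- move=> n _ [v Kv <-]; have [Cv Hv] := Kv; have Sv := KS n v Kv.
  (* Half the radius: points within 2^-(n+1) of [v] keep distance 2^-(n+1) from the complement. *)
  pose O := [set w : 'rV[R]_N | `|w - v| < 2^-1 ^+ n.+1].
  have oO : open O.
    rewrite openE => w wO; apply/near_ballP; exists (2^-1 ^+ n.+1 - `|w - v|).
      by rewrite subr_gt0.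
    move=> y yw; rewrite /O /= -(subrKA w); apply: le_lt_trans (ler_normD _ _) _.
    by rewrite -ltrBrDr.
  suff sub : pr @` (O `&` S) `<=` pr @` K n.+1.
    apply: filterS sub _; apply: open_nbhs_nbhs; split; first exact: open_image.
    by exists v => //; split => //; rewrite /O /= subrr normr0.
  move=> _ [w [Ow Sw] <-]; exists w => //; split; first exact: SC.
  move=> y Cy yw; apply: Hv => //; rewrite -(subrKA w).
  apply: le_lt_trans (ler_normD _ _) _.
  have -> : (2^-1 : R) ^+ n = 2^-1 ^+ n.+1 + 2^-1 ^+ n.+1 by rewrite exprS mulrC -splitr.
  exact: ltrD.
Qed.

End OrbitSpaceTopology.

(** * The gauge orbits of irreducible isometries *)

Lemma row_mx_norm_lt {R : realType} p q (x : 'rV[R]_p) (y : 'rV[R]_q) (e : R) :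
  `|x| < e -> `|y| < e -> `|row_mx x y| < e.
Proof.
move=> xe ye; have e0 : 0 < e by exact: le_lt_trans xe.
apply: mx_norm_lt => // i j; rewrite ord1 -[j]splitK; case: (fintype.split j) => l /=.
  by rewrite row_mxEl; apply: le_lt_trans xe; exact: mx_entry_norm.
by rewrite row_mxEr; apply: le_lt_trans ye; exact: mx_entry_norm.
Qed.

Lemma near_row_mx {R : realType} p q (a : 'rV[R]_p) (b : 'rV[R]_q) (P : set 'rV[R]_(p + q)) :
  nbhs (row_mx a b) P -> \forall x \near a & y \near b, P (row_mx x y).
Proof.
move=> /near_ballP[e e0 H].
exists ([set x | `|x - a| < e], [set y | `|y - b| < e]) => /=.
  by split; apply/near_ballP; exists e.
move=> [x y] /= [xa yb]; apply: H; rewrite opp_row_mx add_row_mx.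
exact: row_mx_norm_lt.
Qed.

(** * The gauge action in real coordinates and the normalization of the trace *)

Section GaugeAction.
Context {R : realType} {d k : nat}.
Local Notation C := R[i].
Local Notation N := (d * k * d + d * k * d)%N.
Local Notation Q := ((d * d + d * d) + (1 * 1 + 1 * 1))%N.
Implicit Types (g h w : 'rV[R]_Q) (v : 'rV[R]_N).

Definition gauge_act g v : 'rV[R]_N := gact (gc g) (gW g) v.
Definition gauge_unit : 'rV[R]_Q := genc 1 1%:M.
Definition gauge_mul g h : 'rV[R]_Q := genc (gc g * gc h) (gW g *m gW h).
Definition gauge_inv g : 'rV[R]_Q := genc (gc g)^* ((gW g)^t*).
Definition irreducible_isometries : set 'rV[R]_N :=
  [set v | isometry (cz v) /\ irreducible (cz v)].

Lemma gauge_group_unit : gauge_group gauge_unit.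
Proof.
split; rewrite ?gW_enc ?gc_enc ?normr1 //.
by apply/unitarymxP; rewrite trmx1 map_mx1 mulmx1.
Qed.

Lemma gauge_group_mul g h : gauge_group g -> gauge_group h -> gauge_group (gauge_mul g h).
Proof.
move=> [uW nc] [uW' nc']; split; rewrite ?gW_enc ?gc_enc.
  exact: mul_unitarymx uW uW'.
by rewrite normrM nc nc' mulr1.
Qed.

Lemma gauge_group_inv g : gauge_group g -> gauge_group (gauge_inv g).
Proof.
move=> [uW nc]; split; rewrite ?gW_enc ?gc_enc; last by rewrite norm_conjC.
by rewrite trmxC_unitary.
Qed.

Lemma gauge_actM g h v : gauge_act g (gauge_act h v) = gauge_act (gauge_mul g h) v.
Proof. by rewrite /gauge_act /gauge_mul gW_enc gc_enc gact_comp. Qed.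

Lemma gauge_act1 v : gauge_act gauge_unit v = v.
Proof. by rewrite /gauge_act /gauge_unit gW_enc gc_enc gact1. Qed.

Lemma gauge_actK g v : gauge_group g -> gauge_act (gauge_inv g) (gauge_act g v) = v.
Proof.
by move=> [uW nc]; rewrite /gauge_act /gauge_inv gW_enc gc_enc gactK.
Qed.

Lemma gauge_mulV g : gauge_group g -> gauge_mul g (gauge_inv g) = gauge_unit.
Proof.
move=> [/unitarymxP WW nc]; rewrite /gauge_mul /gauge_inv gW_enc gc_enc WW.
by rewrite -normCK nc expr1n.
Qed.

Lemma gauge_mulK g : gauge_group g ->
  gauge_mul (gauge_mul (gauge_inv g) gauge_unit) g = gauge_unit.
Proof.
move=> [uW nc]; rewrite /gauge_mul /gauge_inv /gauge_unit !gW_enc !gc_enc.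
by rewrite mulr1 mulmx1 mulrC -normCK nc expr1n (unitarymxPl uW).
Qed.

Let oT n : open [set: 'rV[R]_n]. Proof. exact: openT. Qed.
Let sl p q : row_smooth setT (fun z : 'rV[R]_(p + q) => lsubmx z : 'rV[R]_p).
Proof. by apply: row_smooth_lsubmx; exact: row_smooth_id. Qed.
Let sr p q : row_smooth setT (fun z : 'rV[R]_(p + q) => rsubmx z : 'rV[R]_q).
Proof. by apply: row_smooth_rsubmx; exact: row_smooth_id. Qed.

Lemma row_smooth_gauge_act n (A : set 'rV[R]_n) (g : 'rV[R]_n -> 'rV[R]_Q)
    (v : 'rV[R]_n -> 'rV[R]_N) : open A -> row_smooth A g -> row_smooth A v ->
  row_smooth A (fun x => gauge_act (g x) (v x)).
Proof.
move=> oA sg sv; apply: row_smooth_rz; apply: msmooth_gauge => //.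
- exact: csmooth_gc.
- exact: msmooth_gW.
- exact: msmooth_cz.
Qed.

Lemma gauge_act_near g v (P : set 'rV[R]_N) : nbhs (gauge_act g v) P ->
  \forall g' \near g & v' \near v, P (gauge_act g' v').
Proof.
pose f (z : 'rV[R]_(Q + N)) := gauge_act (lsubmx z) (rsubmx z).
have cf : continuous f.
  by apply: row_smooth_continuous; exact: row_smooth_gauge_act.
have fE x y : f (row_mx x y) = gauge_act x y by rewrite /f row_mxKl row_mxKr.
rewrite -fE => nP.
have [AB nAB HAB] := near_row_mx (near_continuous (cf (row_mx g v)) nP).
exists AB => [|z zAB]; first exact: nAB.
exact: (eq_ind _ P (HAB z zAB) _ (fE z.1 z.2)).
Qed.

Lemma gauge_mul_near g h (P : set 'rV[R]_Q) : nbhs (gauge_mul g h) P ->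
  \forall g' \near g & h' \near h, P (gauge_mul g' h').
Proof.
pose f (z : 'rV[R]_(Q + Q)) := gauge_mul (lsubmx z) (rsubmx z).
have cf : continuous f.
  apply: row_smooth_continuous; apply: row_smooth_row_mx; apply: row_smooth_rz.
    by apply: msmoothM => //; apply: msmooth_gW.
  move=> i j; under eq_fun do rewrite mxE.
  by apply: csmoothM => //; exact: csmooth_gc.
have fE x y : f (row_mx x y) = gauge_mul x y by rewrite /f row_mxKl row_mxKr.
rewrite -fE => nP.
have [AB nAB HAB] := near_row_mx (near_continuous (cf (row_mx g h)) nP).
exists AB => [|z zAB]; first exact: nAB.
exact: (eq_ind _ P (HAB z zAB) _ (fE z.1 z.2)).
Qed.

Lemma gauge_act_smooth g : smooth_on setT (gauge_act g).
Proof.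
apply/smooth_onP => //; apply: row_smooth_gauge_act => //.
  exact: row_smooth_cst.
exact: row_smooth_id.
Qed.

Lemma irreducible_isometries_act g v : gauge_group g -> irreducible_isometries v ->
  irreducible_isometries (gauge_act g v).
Proof.
move=> [uW nc] [iv Iv]; rewrite /irreducible_isometries /gauge_act /= cz_gact.
by split; [exact: gauge_isometry|exact: gauge_irreducible].
Qed.

Lemma unit_defect_eq0 g : unit_defect (gW g) (gc g) = 0 -> gauge_group g.
Proof.
rewrite /unit_defect -[RHS]row_mx0 => /eq_row_mx[e1].
rewrite -[RHS]row_mx0 => /eq_row_mx[e2 _]; apply/gauge_groupP; split => //.
by move/rowP/(_ 0): e2; rewrite !mxE.
Qed.

Lemma unit_defect0 g : gauge_group g -> complex.Im (\tr (gW g)) = 0 ->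
  unit_defect (gW g) (gc g) = 0.
Proof.
move=> /gauge_groupP[e1 e2] t0; rewrite /unit_defect e1 e2 t0 -[RHS]row_mx0; congr row_mx.
by rewrite -[RHS]row_mx0; congr row_mx; apply/matrixP => i j; rewrite !mxE.
Qed.

(* The phase making the trace of gW g nonnegative; it acts trivially. *)
Definition trace_phase g : C :=
  let t := \tr (gW g) in let s := Num.sqrt (complex.Re t ^+ 2 + complex.Im t ^+ 2) in
  (complex.Re t / s +i* - (complex.Im t / s))%C.

Definition normalize_trace g : 'rV[R]_Q := genc (gc g) (trace_phase g *: gW g).

Lemma gW_normalize g : gW (normalize_trace g) = trace_phase g *: gW g.
Proof. exact: gW_enc. Qed.

Lemma gc_normalize g : gc (normalize_trace g) = gc g.
Proof. exact: gc_enc. Qed.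

Lemma trace_phase_norm g : \tr (gW g) != 0 -> `|trace_phase g| = 1.
Proof.
move=> t0; rewrite /trace_phase; move: (\tr _) t0 => -[a b] /= t0.
set s := Num.sqrt _; have s0 : 0 < s.
  rewrite sqrtr_gt0 lt_def addr_ge0 ?sqr_ge0 // andbT paddr_eq0 ?sqr_ge0 // !sqrf_eq0.
  by apply: contra t0 => /andP[/eqP -> /eqP ->].
rewrite normc_def /= sqrrN !expr_div_n -mulrDl.
rewrite -[X in X / _]sqr_sqrtr ?addr_ge0 ?sqr_ge0 // -/s divff ?sqrtr1 //.
by rewrite expf_neq0 // gt_eqF.
Qed.

Lemma normalize_trace_group g : \tr (gW g) != 0 -> gauge_group g -> gauge_group (normalize_trace g).
Proof.
move=> t0 [uW nc]; split; last by rewrite gc_normalize.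
rewrite gW_normalize; apply/unitarymxP.
rewrite adjmxZ -scalemxAl -scalemxAr scalerA -normCK trace_phase_norm //.
by rewrite expr1n scale1r; apply/unitarymxP.
Qed.

Lemma normalize_trace_im g : complex.Im (\tr (gW (normalize_trace g))) = 0.
Proof.
rewrite gW_normalize linearZ /trace_phase /=; move: (\tr _) => -[a b] /=.
by ring.
Qed.

Lemma gauge_phase (a c : C) W (V : 'M[C]_(d * k, d)) : `|a| = 1 ->
  gauge c (a *: W) V = gauge c W V.
Proof.
move=> na; apply: kraus_inj => i; apply: etrans (kraus_gauge c (a *: W) V i) _.
apply: etrans _ (esym (kraus_gauge c W V i)); congr (_ *: _); move: (kraus V i) => K.
by rewrite adjmxZ -!scalemxAl -scalemxAr scalerA -normCK na expr1n scale1r.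
Qed.

Lemma normalize_trace_act g v : \tr (gW g) != 0 ->
  gauge_act (normalize_trace g) v = gauge_act g v.
Proof.
move=> t0; have na := trace_phase_norm t0.
by rewrite /gauge_act (gW_normalize g) (gc_normalize g) /gact (gauge_phase _ _ _ na).
Qed.

Lemma normalize_trace_unit : normalize_trace gauge_unit = gauge_unit.
Proof.
have -> : normalize_trace gauge_unit = genc 1 (trace_phase gauge_unit *: 1%:M).
  by rewrite /normalize_trace gc_enc gW_enc.
(* In dimension 0 the phase is the junk value 0 / 0 = 0, but there are no entries to compare. *)
have [d0|d0] := posnP d.
  by congr genc; apply/matrixP => i; have := ltn_ord i; rewrite [X in (_ < X)%N]d0.
have -> : trace_phase gauge_unit = 1; last by rewrite scale1r.
rewrite /trace_phase gW_enc mxtrace1.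
have -> : (d%:R : C) = ((d%:R : R)%:C) by rewrite rmorph_nat.
rewrite /= expr0n addr0 sqrtr_sqr ger0_norm ?ler0n // mul0r oppr0 divff //.
by rewrite pnatr_eq0 -lt0n.
Qed.

Lemma normalize_trace_continuous : (0 < d)%N -> {for gauge_unit, continuous normalize_trace}.
Proof.
move=> d0.
have sW : msmooth setT (fun w : 'rV[R]_Q => gW w) by apply: msmooth_gW; exact: row_smooth_id.
have sc : csmooth setT (fun w : 'rV[R]_Q => gc w) by apply: csmooth_gc; exact: row_smooth_id.
have [st1 st2] : csmooth setT (fun w : 'rV[R]_Q => \tr (gW w)).
  by apply: csmooth_sum => // i; exact: sW.
have Cc (f : 'rV[R]_Q -> R) : smooth setT f -> {for gauge_unit, continuous f}.
  by move=> sf; exact: Cn_continuous (sf 0%N) _.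
pose s w := Num.sqrt (complex.Re (\tr (gW w)) ^+ 2 + complex.Im (\tr (gW w)) ^+ 2).
have cs : {for gauge_unit, continuous s}.
  have cq : {for gauge_unit, continuous (fun w => complex.Re (\tr (gW w)) ^+ 2 + complex.Im (\tr (gW w)) ^+ 2)}.
    by apply: Cc => t; apply: CnD => //; apply: CnM.
  exact: continuous_comp cq (@sqrt_continuous R _).
have s0 : s gauge_unit != 0.
  rewrite /s gW_enc mxtrace1.
  have -> : (d%:R : C) = ((d%:R : R)%:C) by rewrite rmorph_nat.
  by rewrite /= expr0n addr0 sqrtr_sqr normr_eq0 pnatr_eq0 -lt0n.
have ca : {for gauge_unit, continuous (fun w => complex.Re (\tr (gW w)) / s w)}.
  by apply: continuousM; [exact: Cc|exact: continuousV].
have cb : {for gauge_unit, continuous (fun w => - (complex.Im (\tr (gW w)) / s w))}.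
  by apply: continuousN; apply: continuousM; [exact: Cc|exact: continuousV].
apply/continuous_mxP => i j; rewrite ord1 -[j]splitK; case: (fintype.split j) => l /=; last first.
  rewrite (_ : (fun _ => _) = (fun w => w 0 (rshift (d * d + d * d) l))).
    by apply: Cc => t; exact: Cn_coord.
  by apply/funext => w; rewrite -{2}[w]genc_dec !row_mxEr.
rewrite -[l]splitK; case: (fintype.split l) => {}l /=; case/mxvec_indexP: l => a b.
  rewrite (_ : (fun _ => _) = (fun w => complex.Re (\tr (gW w)) / s w * complex.Re (gW w a b)
      - - (complex.Im (\tr (gW w)) / s w) * complex.Im (gW w a b))).
    apply: continuousB; apply: continuousM => //; apply: Cc; exact: (sW a b).1 || exact: (sW a b).2.
  by apply/funext => w; rewrite row_mxEl row_mxEl mxvecE mxE mxE ReCM.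
rewrite (_ : (fun _ => _) = (fun w => complex.Re (\tr (gW w)) / s w * complex.Im (gW w a b)
    + - (complex.Im (\tr (gW w)) / s w) * complex.Re (gW w a b))).
  apply: continuousD; apply: continuousM => //; apply: Cc; exact: (sW a b).1 || exact: (sW a b).2.
by apply/funext => w; rewrite row_mxEl row_mxEr mxvecE mxE mxE ImCM.
Qed.

End GaugeAction.

(** * The slice at an irreducible isometry, from the inverse of the slice map *)

Section GaugeSlice.
Context {R : realType} {d k : nat}.
Local Notation C := R[i].
Local Notation N := (d * k * d + d * k * d)%N.
Local Notation Q := ((d * d + d * d) + (1 * 1 + 1 * 1))%N.
Local Notation sdim := (@slice_dim d k).
Local Notation F1 := (d * d + d * d)%N.
Local Notation K1 := ((d * d + (1 + 1)) + d * d)%N.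
Variable V : 'M[C]_(d * k, d).
Hypotheses (iV : isometry V) (IV : irreducible V).
Variable B : 'M[R]_(sdim, N).
Hypotheses (fB : row_free B) (HB : forall v : 'rV[R]_N, (v <= B)%MS <->
  v *m (Nor V)^T = 0 /\ v *m (Tau V)^T = 0).
Variables (O : set 'rV[R]_(N + Q)) (Th : 'rV[R]_((sdim + F1) + K1) -> 'rV[R]_(N + Q)).
Hypotheses (oO : open O) (Ob : O (base_point V)) (oW : open (slice_map V B @` O)).
Hypothesis ThK : forall z, O z -> Th (slice_map V B z) = z.
Hypothesis sTh : smooth_on (slice_map V B @` O) Th.
Implicit Types (v w : 'rV[R]_N) (g : 'rV[R]_Q) (x : 'rV[R]_sdim).

Let F := slice_coord V B.
Let T v := v *m (Tau V)^T.
Let W := slice_map V B @` O.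
Let e : 'rV[R]_Q := gauge_unit.
Let v0 := rz V.

Let slice_mapE v g : slice_map V B (row_mx v g) =
  row_mx (F v) (row_mx (unit_defect (gW g) (gc g)) (T (gauge_act g v))).
Proof. by rewrite /slice_map /zV row_mxKl row_mxKr. Qed.

Let defect_e : unit_defect (gW e) (gc e) = 0.
Proof.
apply: unit_defect0; first exact: gauge_group_unit.
rewrite gW_enc mxtrace1; have -> : (d%:R : C) = ((d%:R : R)%:C) by rewrite rmorph_nat.
by [].
Qed.

Let slice_map_e v : slice_map V B (row_mx v e) = row_mx (F v) (row_mx 0 (T v)).
Proof. by rewrite slice_mapE defect_e gauge_act1. Qed.

(** [V] is itself a direction [V S] with [S] the identity, and these are orthogonal to the orbit. *)
Let T0 : T v0 = 0.
Proof.
apply/mulTauT => m.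
have h1 : (1%:M : 'M[C]_d)^t* = 1%:M by rewrite trmx1 map_mx1.
apply: etrans (rdot_nor_tau iV m h1); congr rdot; rewrite mulmx1; exact: rzK.
Qed.

Let F_isometry v : isometry (cz v) -> T v = 0 -> F v = row_mx ((v - v0) *m B^T) 0.
Proof.
move=> iv Tv; rewrite /F /slice_coord (proj1 (gram_defectP _) iv) -/(T v) Tv.
by rewrite row_mx0.
Qed.

Let F_inv v x : F v = row_mx x 0 -> [/\ isometry (cz v), T v = 0 & (v - v0) *m B^T = x].
Proof.
rewrite /F /slice_coord => /eq_row_mx[e1]; rewrite -[RHS]row_mx0 => /eq_row_mx[e2 e3].
by split => //; exact/gram_defectP.
Qed.

Let F0 : F v0 = 0.
Proof.
have iv0 : isometry (cz v0) by apply: eq_ind (esym (rzK V)).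
by rewrite (F_isometry iv0 T0) subrr mul0mx row_mx0.
Qed.

Let map_base : slice_map V B (base_point V) = 0.
Proof. by rewrite -/(row_mx v0 e) slice_map_e F0 T0 !row_mx0. Qed.

Let W0 : W 0.
Proof. by rewrite -map_base; exists (base_point V). Qed.

Let Th0 : Th 0 = row_mx v0 e.
Proof. by rewrite -map_base ThK. Qed.

Let ThP y : W y -> O (Th y) /\ slice_map V B (Th y) = y.
Proof. by move=> [z Oz <-]; rewrite ThK. Qed.

Let map_inj z z' : O z -> O z' -> slice_map V B z = slice_map V B z' -> z = z'.
Proof. by move=> Oz Oz' ezz; rewrite -(ThK Oz) -(ThK Oz') ezz. Qed.

Let nO : \forall v \near v0 & g \near e, O (row_mx v g).
Proof. by apply: near_row_mx; exact: open_nbhs_nbhs. Qed.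

Let nOe : \forall v \near v0, O (row_mx v e).
Proof.
have [[A A'] /= [nA nA'] HA] := nO; apply: filterS nA => v Av.
by apply: (HA (v, e)); split => //; exact: nbhs_singleton.
Qed.

(** [iota x] prescribes the slice position [x], with no isometry defect and no orbit component.
    [jota v] keeps the position of [v] and asks for a normalized group element that removes the
    orbit component of [v]. *)
Let iota x : 'rV[R]_((sdim + F1) + K1) := row_mx (row_mx x 0) 0.
Let jota v : 'rV[R]_((sdim + F1) + K1) := row_mx (F v) 0.

Definition slice_sigma x : 'rV[R]_N := lsubmx (Th (iota x)).
Definition slice_gam v : 'rV[R]_Q := rsubmx (Th (jota v)).
(** The coordinate is taken after moving [v] to the slice, which makes it locally constant along
    orbits. *)
Definition slice_rho v : 'rV[R]_sdim := (gauge_act (slice_gam v) v - v0) *m B^T.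

Let oT n : open [set: 'rV[R]_n]. Proof. exact: openT. Qed.

Let s_iota : row_smooth setT iota.
Proof.
apply: row_smooth_row_mx; last exact: row_smooth_cst.
by apply: row_smooth_row_mx; [exact: row_smooth_id|exact: row_smooth_cst].
Qed.

Let s_jota : row_smooth setT jota.
Proof.
apply: row_smooth_row_mx; last exact: row_smooth_cst.
by apply: smooth_slice_coord => //; exact: row_smooth_id.
Qed.

Let preim_smooth n q (f : 'rV[R]_n -> 'rV[R]_((sdim + F1) + K1))
    (h : 'rV[R]_(N + Q) -> 'rV[R]_q) :
  row_smooth setT f -> (forall j, exists l, forall z, h z 0 j = z 0 l) ->
  open (f @^-1` W) /\ smooth_on (f @^-1` W) (fun y => h (Th (f y))).
Proof.
move=> sf Hh; have of_ : open (f @^-1` W).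
  by apply: open_comp => // x _; exact: row_smooth_continuous.
split => //; have sf' : smooth_on (f @^-1` W) f.
  by apply: (@smooth_on_subset _ _ _ _ setT) => //; apply/smooth_onP.
have sc : smooth_on (f @^-1` W) (Th \o f).
  by apply: (smooth_comp of_ oW) => // _ [x Wx <-].
apply/smooth_onP => // j; have [l hl] := Hh j.
by under eq_fun do rewrite hl; move/smooth_onP: sc => /(_ of_); exact.
Qed.

Let iota0 : iota 0 = 0. Proof. by rewrite /iota !row_mx0. Qed.
Let jota0 : jota v0 = 0. Proof. by rewrite /jota F0 row_mx0. Qed.

Let A1 := iota @^-1` W.
Let A2 := jota @^-1` W.

Let sigma_smooth : open A1 /\ smooth_on A1 slice_sigma.
Proof.
apply: (preim_smooth (h := fun z => lsubmx z)) => // j.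
by exists (lshift Q j) => z; rewrite mxE.
Qed.

Let gam_smooth : open A2 /\ smooth_on A2 slice_gam.
Proof.
apply: (preim_smooth (h := fun z => rsubmx z)) => // j.
by exists (rshift N j) => z; rewrite mxE.
Qed.

Let A10 : A1 0. Proof. by rewrite /A1 /= iota0. Qed.
Let A20 : A2 v0. Proof. by rewrite /A2 /= jota0. Qed.

Let sigma0 : slice_sigma 0 = v0.
Proof. by rewrite /slice_sigma iota0 Th0 row_mxKl. Qed.

Let gam0 : slice_gam v0 = e.
Proof. by rewrite /slice_gam jota0 Th0 row_mxKr. Qed.

Let sigma_near (P : set 'rV[R]_N) : nbhs v0 P -> \forall x \near (0 : 'rV[R]_sdim), P (slice_sigma x).
Proof.
have [_ sS] := sigma_smooth; rewrite -sigma0.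
exact: near_continuous (smooth_on_continuous sS A10).
Qed.

Let gam_near (P : set 'rV[R]_Q) : nbhs e P -> \forall v \near v0, P (slice_gam v).
Proof.
have [_ sG] := gam_smooth; rewrite -gam0.
exact: near_continuous (smooth_on_continuous sG A20).
Qed.

Let nA1 : \forall x \near (0 : 'rV[R]_sdim), W (iota x).
Proof. by have [oA _] := sigma_smooth; apply: open_nbhs_nbhs. Qed.

Let nA2 : \forall v \near v0, W (jota v).
Proof. by have [oA _] := gam_smooth; apply: open_nbhs_nbhs. Qed.

(** The inverse yields some pair with first component [slice_sigma x]. The unit paired with the same
    component has the same image, so injectivity identifies the group element. *)
Let sigmaP : \forall x \near (0 : 'rV[R]_sdim), Th (iota x) = row_mx (slice_sigma x) e /\
  F (slice_sigma x) = row_mx x 0.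
Proof.
have n2 := sigma_near nOe.
apply: filterS2 nA1 n2 => x Wx Oe; have [Oz] := ThP Wx.
have eTh : Th (iota x) = row_mx (slice_sigma x) (rsubmx (Th (iota x))) by rewrite hsubmxK.
rewrite {1}eTh slice_mapE => /eq_row_mx[eF _]; split => //.
have [_ Ts _] := F_inv eF.
apply: etrans _ (ThK Oe); rewrite /iota; congr Th.
by rewrite slice_map_e eF Ts row_mx0.
Qed.

(* The slice is the zero set of T among the isometries. *)
Let on_slice : \forall v \near v0, isometry (cz v) -> T v = 0 ->
  slice_sigma ((v - v0) *m B^T) = v.
Proof.
apply: filterS nOe => v Oe iv Tv; rewrite /slice_sigma.
have -> : iota ((v - v0) *m B^T) = slice_map V B (row_mx v e).
  by rewrite slice_map_e Tv row_mx0 F_isometry.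
by rewrite ThK // row_mxKl.
Qed.

(** The inverse yields a pair (v', g) in which v' has the same position coordinates as [v]. The
    pairs (v', e) and (v, e) then have the same image, so v' = v. *)
Let gamP : \forall v \near v0, [/\ O (row_mx v (slice_gam v)), gauge_group (slice_gam v),
  slice_map V B (row_mx v (slice_gam v)) = row_mx (F v) 0 &
  T (gauge_act (slice_gam v) v) = 0].
Proof.
have [oA2 _] := gam_smooth.
have cl : {for v0, continuous (fun v => lsubmx (Th (jota v)))}.
  have [|_ sl] := preim_smooth (h := fun z => lsubmx z) s_jota.
    by move=> j; exists (lshift Q j) => z; rewrite mxE.
  exact: smooth_on_continuous sl A20.
have n1 : \forall v \near v0, O (row_mx (lsubmx (Th (jota v))) e).
  by apply: (near_continuous (P := fun v => O (row_mx v e)) cl); rewrite jota0 Th0 row_mxKl.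
near=> v; have Wv : W (jota v) by near: v.
have Oe : O (row_mx v e) by near: v.
have Oe' : O (row_mx (lsubmx (Th (jota v))) e) by near: v.
have [Oz] := ThP Wv.
have eTh : Th (jota v) = row_mx (lsubmx (Th (jota v))) (slice_gam v) by rewrite hsubmxK.
move: Oe' Oz; rewrite eTh row_mxKl; move: (lsubmx _) => v' Oe' Oz eM.
have := eM; rewrite slice_mapE => /eq_row_mx[eF].
rewrite -[RHS]row_mx0 => /eq_row_mx[dg Tg].
have eT : T v' = T v.
  by move: eF; rewrite /F /slice_coord => /eq_row_mx[_ /eq_row_mx[]].
have /eq_row_mx[ev _] : row_mx v' e = row_mx v e.
  apply: (map_inj Oe' Oe); apply: etrans (slice_map_e v') _.
  by apply: etrans _ (esym (slice_map_e v)); rewrite eF eT.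
by rewrite ev in Oz eM Tg; split => //; exact: unit_defect_eq0.
Unshelve. all: by end_near. Qed.

(** The element [g] need not be normalized. Normalizing its trace does not change its action and
    keeps it near the unit, where injectivity of the slice map identifies it with [slice_gam v]. *)
Let act_unique : \forall g \near e & v \near v0, gauge_group g -> T (gauge_act g v) = 0 ->
  gauge_act g v = gauge_act (slice_gam v) v.
Proof.
have d0 := irreducible_dim IV.
have [[A A'] /= [nA nA'] HA] := nO.
have nt : \forall g \near e, \tr (gW g) != 0.
  have [st _] : csmooth setT (fun w : 'rV[R]_Q => \tr (gW w)).
    apply: csmooth_sum => // i; apply: msmooth_gW; exact: row_smooth_id.
  have ct : {for e, continuous (fun w : 'rV[R]_Q => complex.Re (\tr (gW w)))}.
    exact: Cn_continuous (st 0%N) _.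
  have ne : nbhs (complex.Re (\tr (gW e))) [set t : R | t != 0].
    apply: open_nbhs_nbhs; split; first exact: open_neq.
    rewrite /= gW_enc mxtrace1; have -> : (d%:R : C) = ((d%:R : R)%:C) by rewrite rmorph_nat.
    by rewrite /= pnatr_eq0 -lt0n.
  apply: filterS (near_continuous ct ne) => g /=; apply: contra_neq => ->.
  by [].
have nn : \forall g \near e, A' (normalize_trace g).
  apply: (near_continuous (normalize_trace_continuous d0)).
  by rewrite normalize_trace_unit.
exists ([set g | \tr (gW g) != 0 /\ A' (normalize_trace g)], [set v | A v /\
    [/\ O (row_mx v (slice_gam v)), gauge_group (slice_gam v),
      slice_map V B (row_mx v (slice_gam v)) = row_mx (F v) 0 &
      T (gauge_act (slice_gam v) v) = 0]]).
  split => /=; first by near=> g; split; near: g.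
  by near=> v; split; near: v.
move=> [g v] /= [[t0 A'g] [Av [Oz _ eM _]]] Gg Tg.
have ea := normalize_trace_act v t0.
have {}Tg : T (gauge_act (normalize_trace g) v) = 0 by apply: etrans (congr1 T ea) Tg.
have du := unit_defect0 (normalize_trace_group t0 Gg) (normalize_trace_im g).
have eg : row_mx v (normalize_trace g) = row_mx v (slice_gam v).
  apply: (map_inj (HA (v, normalize_trace g) (conj Av A'g)) Oz).
  apply: etrans (slice_mapE v (normalize_trace g)) _; apply: etrans _ (esym eM).
  by congr row_mx; apply: etrans (congr2 (fun a b => row_mx a b) du Tg) _; rewrite row_mx0.
have /eq_row_mx[_ {}eg] := eg.
rewrite -ea. rewrite eg. reflexivity.
Unshelve. all: by end_near. Qed.

Let sigma_slice : \forall x \near (0 : 'rV[R]_sdim),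
  [/\ isometry (cz (slice_sigma x)), T (slice_sigma x) = 0 & (slice_sigma x - v0) *m B^T = x].
Proof. by apply: filterS sigmaP => x [_ /F_inv]. Qed.

Let gam_sigma : \forall x \near (0 : 'rV[R]_sdim), slice_gam (slice_sigma x) = e.
Proof.
apply: filterS sigmaP => x [eTh eF]; rewrite /slice_gam /jota eF.
by apply: etrans (congr1 (@rsubmx _ 1 N Q) eTh) _; rewrite row_mxKr.
Qed.

Let act_near0 g (P : set 'rV[R]_N) : gauge_act g v0 = v0 -> nbhs v0 P ->
  \forall x \near (0 : 'rV[R]_sdim), P (gauge_act g (slice_sigma x)).
Proof.
move=> gv nP; apply: (sigma_near (P := fun v => P (gauge_act g v))).
have := @gauge_act_near R d k g v0 P; rewrite gv => /(_ nP)[[A A'] /= [nA nA'] HA].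
by apply: filterS nA' => v Av; apply: (HA (g, v)); split => //; exact: nbhs_singleton.
Qed.

(** The stabilizer preserves isometries and the vanishing of [T], so the image of a slice point is
    again on the slice and is recovered from its coordinate, which is [x *m M]. *)
Let stab_sigma c U M : stab V c U -> (forall v, gact c U v *m B^T = v *m B^T *m M) ->
  \forall x \near (0 : 'rV[R]_sdim),
    gauge_act (genc c U) (slice_sigma x) = slice_sigma (x *m M).
Proof.
move=> st eM; have actE v : gauge_act (genc c U) v = gact c U v.
  by rewrite /gauge_act gW_enc gc_enc.
have [nc uU eV] := st.
have gv : gauge_act (genc c U) v0 = v0 by rewrite actE /v0 gact_rz eV.
apply: filterS2 (act_near0 gv on_slice) sigma_slice => x on [ix Tx ex].
have iu : isometry (cz (gauge_act (genc c U) (slice_sigma x))).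
  by rewrite actE cz_gact; exact: gauge_isometry.
have Ts : T (gauge_act (genc c U) (slice_sigma x)) = 0.
  by rewrite actE; exact: (stab_tau st Tx).
have eg : gauge_act (genc c U) (slice_sigma x) - v0 = gact c U (slice_sigma x - v0).
  by rewrite -[X in _ - X]gv !actE -linearB.
rewrite -(on iu Ts); congr slice_sigma.
by apply: etrans (congr1 (fun u => u *m B^T) eg) _; rewrite eM ex.
Qed.

Lemma gauge_germ_slice (H : @mxgroup R sdim) : (forall M, M \in mxg_seq H <-> isotropy V B M) ->
  germ_slice irreducible_isometries gauge_group gauge_unit gauge_act v0 H
    slice_sigma slice_rho slice_gam.
Proof.
move=> HH; have [eps eps0 Heps] := irreducible_open iV IV.
split.
- exact: sigma0.
- have n1 : \forall v \near v0, `|v - v0| < eps by apply/near_ballP; exists eps.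
  apply: filterS2 (sigma_near n1) sigma_slice => x xe [ix _ _]; split => //.
  by apply: Heps => //; rewrite czK.
- apply: filterS2 gam_sigma sigma_slice => x ge [_ _ ex].
  by rewrite /slice_rho ge gauge_act1.
- exact: gam_sigma.
- by have [? ?] := sigma_smooth; exists A1.
- have [oA2 sG] := gam_smooth; exists A2; split => //.
  apply/smooth_onP => //; apply: row_smooth_mulmx => //; apply: row_smoothD => //.
    apply: row_smooth_gauge_act => //; last exact: row_smooth_id.
    exact/smooth_onP.
  exact: row_smooth_cst.
- by have [? ?] := gam_smooth; exists A2.
- by apply: filterS gamP => v [].
- have n1 : \forall v \near v0, isometry (cz (gauge_act (slice_gam v) v)) ->
      T (gauge_act (slice_gam v) v) = 0 -> slice_sigma (slice_rho v) = gauge_act (slice_gam v) v.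
    have [[A A'] /= [nA nA'] HA] : \forall g \near e & v \near v0, isometry (cz (gauge_act g v)) ->
        T (gauge_act g v) = 0 -> slice_sigma ((gauge_act g v - v0) *m B^T) = gauge_act g v.
      apply: (gauge_act_near (P := fun u => isometry (cz u) -> T u = 0 ->
        slice_sigma ((u - v0) *m B^T) = u)).
      by rewrite gauge_act1; exact: on_slice.
    by apply: filterS2 (gam_near nA) nA' => v Ag Av; exact: (HA (slice_gam v, v)).
  apply: filterS2 n1 gamP => v h [_ Gg _ Tg] [iv _]; apply: h => //.
  by rewrite /gauge_act cz_gact; have [? ?] := Gg; exact: gauge_isometry.
(* The product of [slice_gam (g v)] and [g] is close to the unit and moves [v] to the slice, so by
   uniqueness it moves [v] to the same point as [slice_gam v]. *)
- have [[A A'] /= [nA nA'] HA] := act_unique.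
  have [[D D'] /= [nD nD'] HD] : \forall h \near e & g \near e, A (gauge_mul h g).
    apply: (gauge_mul_near (P := A)).
    by have -> : gauge_mul e e = e by rewrite /gauge_mul !gW_enc !gc_enc mulr1 mulmx1.
  have [[E E'] /= [nE nE'] HE] : \forall g \near e & v \near v0, 
      [/\ D (slice_gam (gauge_act g v)), gauge_group (slice_gam (gauge_act g v)) & 
       T (gauge_act (slice_gam (gauge_act g v)) (gauge_act g v)) = 0].
    apply: (gauge_act_near (P := fun u => [/\ D (slice_gam u), gauge_group (slice_gam u) &
       T (gauge_act (slice_gam u) u) = 0])).
    rewrite gauge_act1; apply: filterS2 (gam_near nD) gamP.
    by move=> v Dv [].
  exists (D' `&` E, A' `&` E'); first by split; exact: filterI.
  move=> [g v] /= [[D'g Eg] [A'v E'v]] Sv Gg; rewrite /slice_rho.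
  have [Dg Ggam Tg] := HE (g, v) (conj Eg E'v); rewrite /= in Dg Ggam Tg.
  move: (slice_gam (gauge_act g v)) Dg Ggam Tg => h Dh Gh Th'.
  have eM := gauge_actM h g v; have {}Th' := etrans (congr1 T (esym eM)) Th'.
  have eA := HA (gauge_mul h g, v) (conj (HD (h, g) (conj Dh D'g)) A'v) (gauge_group_mul Gh Gg) Th'.
  exact: (congr1 (fun u => (u - v0) *m B^T) (etrans eM eA)).
- move=> g [uW nc] gv.
  have st : stab V (gc g) (gW g).
    by split => //; move: gv; rewrite /gauge_act /v0 gact_rz => /(can_inj rzK).
  have [M eM] := stab_matrix HB st.
  exists M; first by apply/HH; exists (gc g), (gW g).
  by rewrite -[g]genc_dec; exact: stab_sigma.
- move=> M /HH[c [U [st eM]]]; exists (genc c U).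
    by have [? ? _] := st; split; rewrite ?gW_enc ?gc_enc.
  exact: stab_sigma.
Qed.

End GaugeSlice.

(** * The orbit space of the irreducible isometries *)

Section IrreducibleOrbits.
Context {R : realType} {d k : nat}.
Local Notation C := R[i].
Local Notation N := (d * k * d + d * k * d)%N.
Local Notation S := (@irreducible_isometries R d k).

Definition isometries : set 'rV[R]_N := [set v | isometry (cz v)].

Lemma isometries_compact : compact isometries.
Proof.
apply: bounded_closed_compact.
  exists 1; split; first exact: num_real.
  move=> M M1 w iw; apply: ltW; apply: le_lt_trans M1.
  by rewrite -[w]czK; exact: gram_rz_le.
have oT : open [set: 'rV[R]_N] by exact: openT.
have sz : msmooth [set: 'rV[R]_N] (fun x => cz x : 'M[C]_(d * k, d)).
  by apply: msmooth_cz; exact: row_smooth_id.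
have -> : isometries = (fun v : 'rV[R]_N =>
    mxvec (hmx ((cz v : 'M[C]_(d * k, d))^t* *m cz v - 1%:M))) @^-1` [set 0].
  by apply/seteqP; split => v /gram_defectP.
apply: closed_zero_set; apply: row_smooth_hmx => //.
apply: msmoothD => //; last exact: msmooth_cst.
by apply: msmoothM => //; exact: msmooth_adj.
Qed.

Lemma irreducible_isometries_germ v : S v ->
  exists (H : @mxgroup R (@slice_dim d k)) sigma rho gam,
    germ_slice S gauge_group gauge_unit gauge_act v H sigma rho gam.
Proof.
move=> [iv Iv]; have [B [fB HB]] := slice_basis iv Iv.
have [H HH] := isotropy_mxgroup iv Iv fB HB.
have [U [Th [oU Ub oW ThK sTh]]] := slice_map_inverse iv Iv fB HB.
have := gauge_germ_slice iv Iv HB oU Ub oW ThK sTh HH; rewrite czK => gs.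
by exists H, (slice_sigma Th), (slice_rho (cz v) B Th), (slice_gam (cz v) B Th).
Qed.

Variable p0 : Pirr R d k.

(** A total function on the ambient space; [p0] is only its value off the irreducible isometries,
    which sets apart the case of an empty quotient. *)
Definition orbit_class (v : 'rV[R]_N) : Pirr R d k :=
  if pselect (S v) is left h then \pi_(Pirr R d k) (mkVirr h.1 h.2) else p0.

Lemma vz_irreducible (V : Virr R d k) : S (vz V).
Proof.
rewrite /irreducible_isometries /vz /= rzK; split; first exact: Virr_isometry.
exact: Virr_irreducible.
Qed.

Lemma vz_surj v : S v -> exists V : Virr R d k, vz V = v.
Proof. by move=> [iv Iv]; exists (mkVirr iv Iv); rewrite /vz /= czK. Qed.

Lemma orbit_class_vz (V : Virr R d k) : orbit_class (vz V) = \pi_(Pirr R d k) V.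
Proof.
rewrite /orbit_class; case: pselect => [h|]; last by case; exact: vz_irreducible.
by apply/eq_PirrP; rewrite /= /vz rzK; exact: same_orbit_refl.
Qed.

Lemma orbit_classP v w : S v -> S w ->
  orbit_class v = orbit_class w <-> exists2 g, gauge_group g & w = gauge_act g v.
Proof.
move=> /vz_surj[V <-] /vz_surj[V' <-]; rewrite !orbit_class_vz eq_PirrP; split.
  move=> [c [W [nc uW e]]]; exists (genc c W); first by split; rewrite ?gW_enc ?gc_enc.
  by rewrite /gauge_act gW_enc gc_enc /vz gact_rz e.
move=> [g [uW nc]]; rewrite /gauge_act /vz gact_rz => /(can_inj rzK) e.
by exists (gc g), (gW g).
Qed.

Lemma orbit_class_surj p : exists2 v, S v & p = orbit_class v.
Proof.
have [V ->] := Pirr_surj p.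
by exists (vz V); [exact: vz_irreducible|rewrite orbit_class_vz].
Qed.

Lemma orbit_class_open (U : set (Pirr R d k)) : open U <->
  forall v, S v -> U (orbit_class v) -> \forall w \near v, S w -> U (orbit_class w).
Proof.
rewrite open_PirrP; split => H.
  move=> _ /vz_surj[V <-]; rewrite orbit_class_vz => /H[e e0 He].
  apply/near_ballP; exists e => // w we /vz_surj[V' ew].
  by rewrite -ew orbit_class_vz; apply: He; rewrite ew.
move=> V UV; have [|e e0 He] := proj1 (near_ballP _ _) (H (vz V) (vz_irreducible V) _).
  by rewrite orbit_class_vz.
exists e => // V' V'V; rewrite -orbit_class_vz; apply: He => //.
exact: vz_irreducible.
Qed.

Lemma irreducible_isometries_open v : S v -> \forall w \near v, isometries w -> S w.
Proof.
move=> [iv Iv]; have [e e0 He] := irreducible_open iv Iv.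
apply/near_ballP; exists e => // w we iw; split => //.
by apply: He => //; rewrite !czK.
Qed.

Lemma orbit_classes_orbifold : has_orbifold_structure R (Pirr R d k).
Proof.
have cG := @gauge_group_compact R d.
have aG := @slice_atlasP R N _ (@slice_dim d k) (Pirr R d k) S gauge_group gauge_unit gauge_act
  gauge_mul gauge_inv orbit_class cG gauge_group_mul gauge_group_inv gauge_actM gauge_actK
  gauge_mulV gauge_mulK gauge_mul_near gauge_act_near gauge_act_smooth
  irreducible_isometries_act orbit_classP orbit_class_surj orbit_class_open
  irreducible_isometries_germ.
set A := slice_atlas _ _ _ _ _ in aG.
exists (@slice_dim d k), (fun A' => orbifold_atlas A' /\ equivalent_atlases A A'); split.
- exact: (orbit_space_hausdorff cG gauge_act_near irreducible_isometries_act orbit_classP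
    orbit_class_surj orbit_class_open).
- apply: (orbit_space_paracompact cG gauge_act_near irreducible_isometries_act orbit_classP
    orbit_class_surj orbit_class_open isometries_compact); last exact: irreducible_isometries_open.
  by move=> v [].
- by exists A.
Qed.

End IrreducibleOrbits.

(** There may be no irreducible isometry, for instance when d = 0; the empty atlas then suffices. *)
Lemma empty_orbifold (R : realType) (X : topologicalType) : (X -> False) ->
  has_orbifold_structure R X.
Proof.
move=> X0; pose A (c : chart R 0 X) := False.
exists 0%N, (fun A' => orbifold_atlas A' /\ equivalent_atlases A A'); split.
- by move=> p.
- move=> F cF; by exists F; split => // B FB; exists B.
- by exists A => //; split => // p; case: (X0 p).
Qed.

Theorem theorem10 (R : realType) (d k : nat) :
  (exists h : Pirr R d k -> Virr_mod_G R d k,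
     homeomorphism h /\
     forall V : Virr R d k, h (\pi_(Pirr R d k) V) = \pi_(Virr_mod_G R d k) V) /\
  has_orbifold_structure R (Pirr R d k).
Proof.
split; first exact: Pirr_homeo.
have [p0|nop] := pselect (exists p : Pirr R d k, True).
  by case: p0 => p0 _; exact: orbit_classes_orbifold p0.
by apply: empty_orbifold => p; apply: nop; exists p.
Qed.
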